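(* Let $a\ge0$ and $m\ge0$ be integers and let $\omega$ be a complex number that is $-1$, a primitive third root of unity, or a primitive sixth root of unity. Let $L_c^\omega(C_a(m))=\sum_T\omega^{n(T)}$, where the sum is over all cyclically symmetric lozenge tilings $T$ of the cored hexagon $C_a(m)$, i.e. of the hexagon with side lengths $a,a+m,a,a+m,a,a+m$ with an equilateral triangle of side length $m$ removed from the center. (i) If $\omega=-1$, then $L_c^\omega(C_a(m))=0$ for $a$ odd, and for $a$ even $$L_c^\omega(C_a(m))=(-1)^{a/2}\prod_{i=0}^{a/2-1}\frac{i!^2\,(\frac m2+i)!^2\,(\frac m2+3i+1)!^2\,(m+3i+1)!^2}{(2i)!\,(2i+1)!\,(\frac m2+2i)!^2\,(\frac m2+2i+1)!^2\,(m+2i)!\,(m+2i+1)!}.$$ (ii) If $\omega$ is a primitive third root of unity, then $$\begin{aligned}L_c^\omega(C_a(m))={}&\frac{(1+\omega)^a\,2^{\lfloor a/2\rfloor}}{\prod_{i=1}^{\lfloor a/2\rfloor}(2i-1)!!\,\prod_{i=1}^{\lfloor(a-1)/2\rfloor}(2i-1)!!}\prod_{i\ge0}\left(\tfrac m2+3i+1\right)_{\lfloor(a-4i)/2\rfloor}\left(\tfrac m2+3i+3\right)_{\lfloor(a-4i-3)/2\rfloor}\\&\qquad\cdot\left(\tfrac m2+a-i+\tfrac12\right)_{\lfloor(a-4i-1)/2\rfloor}\left(\tfrac m2+a-i-\tfrac12\right)_{\lfloor(a-4i-2)/2\rfloor}.\end{aligned}$$ (iii) If $\omega$ is a primitive sixth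 root of unity, then $$\begin{aligned}L_c^\omega(C_a(m))={}&\frac{(1+\omega)^a\left(\frac23\right)^{\lfloor a/2\rfloor}}{\prod_{i=1}^{\lfloor a/2\rfloor}(2i-1)!!\,\prod_{i=1}^{\lfloor(a-1)/2\rfloor}(2i-1)!!}\prod_{i\ge0}\left(\tfrac m2+3i+\tfrac32\right)_{\lfloor(a-4i-1)/2\rfloor}\left(\tfrac m2+3i+\tfrac52\right)_{\lfloor(a-4i-2)/2\rfloor}\\&\qquad\cdot\left(\tfrac m2+a-i\right)_{\lfloor(a-4i)/2\rfloor}\left(\tfrac m2+a-i\right)_{\lfloor(a-4i-3)/2\rfloor}.\end{aligned}$$
   Context: Notation: $(\alpha)_k=\alpha(\alpha+1)\cdots(\alpha+k-1)$ for $k\ge1$, $(\alpha)_0=1$; $x!=\Gamma(x+1)$ for non-integer $x$; $(2i-1)!!=1\cdot3\cdots(2i-1)$; empty products are 1. In the subscripts in (ii) and (iii), $\lfloor\alpha\rfloor$ is the usual floor if $\alpha\ge0$ but is read as $0$ if $\alpha<0$, so that the products over $i\ge0$ are finite. Tilings: Work in the triangular lattice with unit edges, drawn so that one family of lattice lines is vertical. A lozenge is a rhombus with side lengths 1 and angles $60^\circ,120^\circ$ (the union of two unit lattice triangles sharing an edge). A lozenge tiling of a region is a covering of it by lozenges without gaps or overlaps. The region $C_a(m)$: the lattice hexagon with all angles $120^\circ$ and side lengths, clockwise starting with the northwestern side, $a$ (NW), $a+m$ (NE), $a$ (E, vertical), $a+m$ (SE), $a$ (SW), $a+m$ (W, vertical),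 from which the core is removed: the equilateral lattice triangle of side $m$, concentric with the hexagon, with a vertical side on its left and the opposite vertex pointing to the right (each side of the core faces the parallel hexagon side of length $a+m$; for $m=0$ the core is the center point and nothing is removed). A tiling is cyclically symmetric if it is invariant under rotation by $120^\circ$ about the center. The statistic $n(T)$: Extend the bottom side of the core to the right beyond the right vertex of the core, i.e. take the ray from that vertex in the upper-right direction parallel to the NW side, up to the boundary of the hexagon. $n(T)$ is the number of unit edges of lozenges of $T$ contained in this extension (unit lattice segments of the extension that are not crossed by the interior of a lozenge of $T$). *)

(* Defs.v *)
From HB Require Import structures.
From mathcomp Require Import all_boot all_order all_algebra.
From mathcomp Require Import all_classical all_reals all_analysis.
From mathcomp Require Export complex.
From mathcomp Require Export all_boot all_order all_algebra reals.

Set Implicit Arguments.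
Unset Strict Implicit.
Unset Printing Implicit Defensive.

Import Order.TTheory GRing.Theory Num.Theory.

(* Coordinates.  The sides of the hexagon of length a + m are the W, SE and NE
   sides.  Let x, y, z be the distances to the lines through these three sides,
   divided by sqrt(3)/2 (the height of a unit triangle).
   - They are integers at lattice points, and x + y + z = 3a + m everywhere.
   - The E, NW and SW sides (of length a) lie on x = 2a + m, y = 2a + m and
     z = 2a + m, so the hexagon is 0 <= x, y, z <= 2a + m.
   - The concentric core of side m, with its left, bottom and top sides facing
     the W, SE and NE sides, is x, y, z >= a.
   - The rotation by 120 degrees (counterclockwise) about the center is
     (x, y, z) |-> (z, x, y).

   A unit triangle is encoded by the minima (i, j, k) of x, y, z over it: it is
   one of the triangles in i <= x <= i + 1, j <= y <= j + 1, k <= z <= k + 1.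
   - If i + j + k = 3a + m - 1, this is the right-pointing triangle with vertices
     (i+1, j, k), (i, j+1, k), (i, j, k+1).
   - If i + j + k = 3a + m - 2, this is the left-pointing triangle with vertices
     (i, j+1, k+1), (i+1, j, k+1), (i+1, j+1, k).
   The triples with any other sum encode nothing and are excluded below. *)
Section Tilings.
Variables a m : nat.

Definition cell : finType := ('I_(2 * a + m) * 'I_(2 * a + m) * 'I_(2 * a + m))%type.

Definition cx (c : cell) : nat := c.1.1.
Definition cy (c : cell) : nat := c.1.2.
Definition cz (c : cell) : nat := c.2.

Definition right_pointing (c : cell) : bool :=
  (cx c + cy c + cz c).+1 == 3 * a + m.
Definition left_pointing (c : cell) : bool :=
  (cx c + cy c + cz c).+2 == 3 * a + m.

Definition in_core (c : cell) : bool := [&& a <= cx c, a <= cy c & a <= cz c].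

Definition cored_hexagon : {set cell} :=
  [set c | (right_pointing c || left_pointing c) && ~~ in_core c].

(* For c right-pointing: d is the left-pointing triangle on the other side of
   the left (vertical), bottom, or top side of c, respectively. *)
Definition left_nbr (c d : cell) : bool :=
  [&& (cx d).+1 == cx c, cy d == cy c & cz d == cz c].
Definition bottom_nbr (c d : cell) : bool :=
  [&& cx d == cx c, (cy d).+1 == cy c & cz d == cz c].
Definition top_nbr (c d : cell) : bool :=
  [&& cx d == cx c, cy d == cy c & (cz d).+1 == cz c].

Definition is_lozenge (l : {set cell}) : bool :=
  [exists c, exists d,
    [&& right_pointing c, left_pointing d,
        [|| left_nbr c d, bottom_nbr c d | top_nbr c d]
      & l == [set c; d]]].

Definition is_tiling (T : {set {set cell}}) : bool :=
  partition T cored_hexagon && [forall l in T, is_lozenge l].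

Definition rot (c : cell) : cell := (c.2, c.1.1, c.1.2).

Definition cyclically_symmetric (T : {set {set cell}}) : bool :=
  [set rot @: l | l : {set cell} in T] == T.

(* The extension of the bottom side (on the line y = a) beyond the right vertex
   (a + m, a, a) of the core is the part of that line with 0 <= z <= a.  Its unit
   segments are the bottom sides of the right-pointing triangles with j = a and
   k < a; such a segment is crossed by the interior of a lozenge of T exactly
   when the two triangles on its sides form a lozenge of T. *)
Definition above_extension (c : cell) : bool :=
  [&& right_pointing c, cy c == a & cz c < a].

Definition nstat (T : {set {set cell}}) : nat :=
  #|[set c | above_extension c &
             ~~ [exists d, bottom_nbr c d && ([set c; d] \in T)]]|.

End Tilings.

Local Open Scope ring_scope.

Definition Lc (C : nzRingType) (w : C) (a m : nat) : C :=
  \sum_(T : {set {set cell a m}} | is_tiling T && cyclically_symmetric T)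
     w ^+ nstat T.

Definition poch (C : nzRingType) (x : C) (k : nat) : C :=
  \prod_(j < k) (x + j%:R).

(* (2i-1)!! = 1 * 3 * ... * (2i-1) *)
Definition odd_dfact (i : nat) : nat := (\prod_(1 <= j < i.+1) (2 * j - 1))%N.

(* Euler's integral. *)
Definition Gamma (R : realType) (x : R) : R :=
  \int[@lebesgue_measure R]_(t in `]0, +oo[%classic) (powR t (x - 1) * expR (- t)).

(* x! = Gamma(x+1); for x a natural number this is the usual factorial. *)
Definition rfact (R : realType) (x : R) : R := Gamma (x + 1).

(* Main.v *)
Require Import Defs.
From mathcomp Require Import perm ring lra zify.
From mathcomp Require all_classical all_reals all_analysis measurable_realfun.

Set Implicit Arguments.
Unset Strict Implicit.
Unset Printing Implicit Defensive.

Import Order.TTheory GRing.Theory Num.Theory.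
Local Open Scope ring_scope.

(** The weighted sum over tilings is first written as a determinant, and the
    determinant is then evaluated as a Hankel determinant.

    Tilings.  A cyclically symmetric tiling is determined by the lozenges that
    cover the right-pointing triangles of a fundamental domain of the rotation,
    an array of a + m rows of a triangles; each triangle chooses its left,
    bottom or top neighbour ([Lc_rows]).  Read row by row, the triangles that do
    not choose the bottom neighbour behave like particles that stay or step by
    one place without colliding.  The rotation sends the triangles of row 0 that
    do choose the bottom neighbour to the far end of later rows, where they
    create new particles.  Giving every future particle a waiting place outside
    the array keeps the number of particles equal to a, and the count of
    collision-free histories becomes a determinant ([cnt_wdet]).  Summing over
    the configuration of row 0 is a multilinear expansion, and multiplication by
    unitriangular binomial matrices leaves det(1 + w C(m+i+j, j)), which is
    [gdet w a m%:R] ([sum_rows_det], [det_kmat]).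

    Evaluation.  [gdet w a X] is a polynomial in X, so it suffices to know it at
    X = -n-1 for all large naturals n.  There the matrix has the entries
    delta_ij + w (-1)^j C(n-i, j).  Let z^2 = z - 1 and let u + v = 1, u = z v.
    The identity and the binomial matrix are, up to one diagonal factor, the Gram
    matrices of one and the same sequence of polynomials (of Krawtchouk type) for
    the weight C(n,k) u^k v^(n-k) and for the reversed weight ([kgram1],
    [kgram2]).  Hence the determinant is a Hankel determinant of the functional
    [bfun z n w] on the nodes t_k = (n/2 - k)/3 ([gdet_hank]).

    Because z^3 = -1, three steps of the recursion of the weight cancel the power
    of u/v, and the functional satisfies a Pearson equation with the cubic
    (A-t)(B-t)(C-t), where A, B, C = -n/6, -n/6 + 1/3, -n/6 + 2/3
    ([bfun_pearson]).  When the parameter of the functional is 1 or -1 it kills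
    the odd or the even functions.  Then the Hankel determinant splits into
    determinants of the pairings of prod (t^2 - (A+i)^2) with prod (t^2 - (B+i)^2);
    the Pearson equation gives a first order recursion for these entries, as for
    Wilson polynomials, and the determinants are products ([det_wilson_gram]).
    This applies at once to w = -1.  For the cube and sixth roots of unity one
    uses that multiplying the weight by A + t lowers n by one and divides the
    parameter by z ([bfun_christoffel]): the parameter w is replaced by w z, and z
    can be chosen with w z = -1 or w z = 1 ([gdet_hankc]).

    The right-hand sides.  The products over i in the last two parts satisfy
    R(a, x) = T(a, x) R(a-4, x+3) with x = m/2, so their quotients
    R(a+1, x) / R(a, x) follow from four initial values ([shprod_ratio]); they
    agree with the quotients of the evaluated determinants.  In the first part
    the factorials of half-integers occur only in quotients, and the functional
    equation of the Gamma function reduces them to Pochhammer symbols. *)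

(** * The Gamma function *)

Module EulerGamma.
Import all_classical all_reals all_analysis measurable_realfun.
Import numFieldNormedType.Exports.
Local Open Scope classical_set_scope.

Section GammaFunction.
Variable R : realType.
Notation mu := (@lebesgue_measure R).

(** Half of the exponential absorbs the power: with n above x, both t^x <= t^n
    (for t >= 1) and (t/2)^n / n! <= e^(t/2). *)
Lemma powR_mul_expR_le (x : R) : 0 <= x ->
  exists2 K, 0 < K & forall t, 0 <= t -> powR t x * expR (- t) <= K * expR (- (t / 2)).
Proof.
move=> x0; pose n := Num.trunc x.
exists (1 + 2 ^+ n.+1 * (n.+1)`!%:R) => [|t t0].
  by rewrite ltr_wpDr // mulr_ge0 ?exprn_ge0.
have -> : expR (- t) = expR (- (t / 2)) * expR (- (t / 2)).
  by rewrite -expRD; congr expR; field.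
rewrite mulrA ler_pM2r ?expR_gt0 // expRN -ler_pdivlMr ?invr_gt0 ?expR_gt0 // invrK.
have e1 := @expR_ge1Dxn _ (t / 2) n (divr_ge0 t0 (ler0n _ 2)).
have n0 : 0 < (n.+1)`!%:R :> R by rewrite ltr0n fact_gt0.
have e0 : 1 <= expR (t / 2) by apply: le_trans e1; rewrite lerDl !mulr_ge0 ?invr_ge0 ?exprn_ge0 ?divr_ge0 ?ler0n.
have [t1|t1] := leP t 1.
  apply: (@le_trans _ _ 1).
    have := @ge0_ler_powR R x x0 t 1; rewrite powR1; apply=> //; rewrite nnegrE //.
  rewrite -[leLHS]mulr1 ler_pM // lerDl mulr_ge0 ?exprn_ge0 //.
have tn : powR t x <= t ^+ n.+1.
  rewrite -powR_mulrn //; apply: ler_powR; first exact: ltW.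
  by rewrite ltW // truncnS_gt.
apply: (le_trans tn); have e2 : (t / 2) ^+ n.+1 / (n.+1)`!%:R <= expR (t / 2).
  by apply: le_trans e1; rewrite lerDr.
rewrite mulrDl; apply: (@le_trans _ _ (2 ^+ n.+1 * (n.+1)`!%:R * expR (t / 2))); last first.
  by rewrite lerDr mul1r expR_ge0.
move: e2; rewrite expr_div_n ler_pdivrMr // ler_pdivrMr ?exprn_gt0 // => e2.
by apply: (le_trans e2); rewrite [leLHS]mulrC [expR _ * _]mulrC mulrA.
Qed.

Lemma cvg_expR_half (c : R) : 0 < c -> expR (- (t * c)) @[t --> +oo] --> (0 : R).
Proof.
move=> c0; have := @cvgr_expR R => h.
apply: (@cvg_comp _ _ _ (fun t : R => t * c) (fun t => expR (- t)) +oo +oo) => //.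
exact: gt0_cvgMly.
Qed.

Lemma continuous_expR_scale (c : R) : continuous (fun t : R => expR (- (t * c))).
Proof.
move=> t; apply: continuous_comp; last exact: continuous_expR.
by apply: cvgN; apply: cvgM; [exact: cvg_id|exact: cvg_cst].
Qed.

Lemma integral_expR_ray (a K c : R) : 0 <= K -> 0 < c ->
  (\int[mu]_(t in `[a, +oo[) (K * expR (- (t * c)))%:E = (K / c * expR (- (a * c)))%R%:E)%E.
Proof.
move=> K0 c0.
rewrite (@ge0_continuous_FTC2y R _ (fun t => - (K / c) * expR (- (t * c))) a 0).
- by rewrite -EFinB sub0r mulNr opprK.
- by move=> t _; rewrite mulr_ge0 ?expR_ge0.
- by apply: continuous_subspaceT => t; apply: cvgM; [exact: cvg_cst|exact: continuous_expR_scale].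
- rewrite -[X in _ --> X](mulr0 (- (K / c))); apply: cvgM; first exact: cvg_cst.
  exact: cvg_expR_half.
- by move=> t _; apply: ex_derive.
- by apply: cvg_at_right_filter; apply: cvgM; [exact: cvg_cst|exact: continuous_expR_scale].
move=> t _; rewrite derive1E derive_val /GRing.scale /=.
by field; rewrite gt_eqF.
Qed.

Variable x : R.
Hypothesis x1 : 1 <= x.
Let x0 : 0 < x. Proof. exact: lt_le_trans x1. Qed.

Let f1 t := x * (powR t (x - 1) * expR (- t)).
Let f2 t := powR t x * expR (- t).
Let E (K : R) t := K * expR (- (t / 2)).

Lemma measurable_gamma_integrand y (D : set R) :
  measurable_fun D (fun t : R => powR t y * expR (- t)).
Proof.
apply: measurable_funM; first exact: measurable_funTS (measurable_powR y).
apply: measurableT_comp; first exact: measurable_expR.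
exact: measurable_funN.
Qed.

Lemma measurable_E K (D : set R) : measurable_fun D (E K).
Proof.
apply: measurable_funM; first exact: measurable_cst.
apply: measurableT_comp; first exact: measurable_expR.
by apply: measurable_funN; apply: measurable_funM.
Qed.

Lemma integral_E K : 0 <= K -> (\int[mu]_(t in `[0%R, +oo[) (E K t)%:E = (2 * K)%R%:E)%E.
Proof.
move=> K0; rewrite (integral_expR_ray 0 K0) ?invr_gt0 // invrK mul0r oppr0 expR0 mulr1.
by rewrite mulrC.
Qed.

Lemma continuous_powR_ray y : 0 <= y -> {within `[0, +oo[, continuous (fun t : R => powR t y)}.
Proof.
move=> y0; apply/continuous_within_itvcyP; split=> [t|].
  rewrite in_itv /= andbT => t0; apply: differentiable_continuous.
  by apply/derivable1_diffP; apply: derivable_powR; rewrite in_itv /= t0.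
have [->|yn0] := eqVneq y 0.
  rewrite powRr0 (_ : (fun t => _) = fun=> 1); first exact: cvg_cst.
  by apply/funext => t; rewrite powRr0.
by rewrite powR0 //; apply: powR_cvg0; rewrite lt_neqAle eq_sym yn0.
Qed.

Lemma continuous_f1 : {within `[0, +oo[, continuous f1}.
Proof.
have c1 := @continuous_powR_ray (x - 1).
have {}c1 := c1 (ltac:(by rewrite subr_ge0)).
have c2 : {within `[0, +oo[, continuous (fun t : R => expR (- t))}.
  apply: continuous_subspaceT => t; have := @continuous_expR_scale 1 t.
  by rewrite (_ : (fun t => expR (- (t * 1))) = (fun t => expR (- t))) //; apply/funext => u; rewrite mulr1.
move=> t; apply: cvgM; first exact: cvg_cst.
by apply: cvgM; [exact: c1|exact: c2].
Qed.

Lemma continuous_f2 : {within `[0, +oo[, continuous f2}.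
Proof.
have c1 := continuous_powR_ray (ltW x0).
have c2 : {within `[0, +oo[, continuous (fun t : R => expR (- t))}.
  apply: continuous_subspaceT => t; have := @continuous_expR_scale 1 t.
  by rewrite (_ : (fun t => expR (- (t * 1))) = (fun t => expR (- t))) //; apply/funext => u; rewrite mulr1.
by move=> t; apply: cvgM; [exact: c1|exact: c2].
Qed.

Lemma continuous_E K : continuous (E K).
Proof. move=> t; apply: cvgM; [exact: cvg_cst|exact: continuous_expR_scale]. Qed.

(** With g = K e^(-t/2) - t^x e^-t >= 0, the function f1 + g is nonnegative and is
    the derivative of t^x e^-t - 2 K e^(-t/2), so that its integral is 2 K; the
    integral of f2 + g is 2 K as well.  Cancelling the finite integral of g avoids
    any integration by parts of functions without a sign. *)
Lemma gamma_by_parts :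
  [/\ (\int[mu]_(t in `[0%R, +oo[) (f1 t)%:E = \int[mu]_(t in `[0%R, +oo[) (f2 t)%:E)%E
    & (\int[mu]_(t in `[0%R, +oo[) (f2 t)%:E < +oo)%E ].
Proof.
have [K K0 leK] := powR_mul_expR_le (ltW x0).
have f1_ge0 t : 0 <= f1 t by rewrite !mulr_ge0 ?powR_ge0 ?expR_ge0 // ltW.
have f2_ge0 t : 0 <= f2 t by rewrite mulr_ge0 ?powR_ge0 ?expR_ge0.
(* the dominating exponential minus the integrand *)
pose g t := E K t - f2 t.
have g_ge0 t : 0 <= t -> 0 <= g t by move=> t0; rewrite subr_ge0 leK.
have dt (t : R) : `[0%R, +oo[%classic t -> 0 <= t by rewrite /= in_itv /= andbT.
have mI : measurable `[0%R : R, +oo[%classic by [].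
have m1 : measurable_fun `[0%R : R, +oo[%classic f1.
  by apply: measurable_funM; [exact: measurable_cst|exact: measurable_gamma_integrand].
have m2 : measurable_fun `[0%R : R, +oo[%classic f2 by exact: measurable_gamma_integrand.
have mg : measurable_fun `[0%R : R, +oo[%classic g by apply: measurable_funB => //; exact: measurable_E.
have I1 : (\int[mu]_(t in `[0%R, +oo[) (f1 t)%:E + \int[mu]_(t in `[0%R, +oo[) (g t)%:E = (2 * K)%R%:E)%E.
  rewrite -ge0_integralD //; first last.
  - exact/measurable_EFinP.
  - by move=> t /dt t0; rewrite lee_fin g_ge0.
  - exact/measurable_EFinP.
  - by move=> t _; rewrite lee_fin.
  under eq_integral => t _ do rewrite -EFinD.
  rewrite (@ge0_continuous_FTC2y R (fun t => f1 t + g t) (fun t => f2 t - 2 * K * expR (- (t / 2))) 0 0).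
  - by rewrite /f2 powR0 ?gt_eqF // !mul0r oppr0 expR0 mulr1 -EFinB !sub0r opprK.
  - by move=> t t0; rewrite addr_ge0 ?g_ge0.
  - move=> t; apply: cvgD; first exact: continuous_f1.
    apply: cvgB; last exact: continuous_f2.
    by apply: (continuous_subspaceT (@continuous_E K)).
  - rewrite -[X in _ --> X](subr0 0); apply: cvgB.
      apply: (@squeeze_cvgr _ _ _ _ (fun=> 0) (E K)); last 2 first.
      + exact: cvg_cst.
      + by rewrite -[X in _ --> X](mulr0 K); apply: cvgM; [exact: cvg_cst|exact: cvg_expR_half].
      by near=> t; rewrite f2_ge0 leK //; near: t; exact: nbhs_pinfty_ge.
    rewrite -[X in _ --> X](mulr0 (2 * K)); apply: cvgM; first exact: cvg_cst.
    exact: cvg_expR_half.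
  - move=> t t0; have h := is_derive1_powR x t0; apply: derivableB => //.
  - apply: cvgB; last first.
      apply: cvg_at_right_filter; apply: cvgM; first exact: cvg_cst.
      exact: continuous_expR_scale.
    by have /continuous_within_itvcyP[] := continuous_f2.
  move=> t; rewrite in_itv /= andbT => t0; have h := is_derive1_powR x t0.
  rewrite derive1E /f2 derive_val /f1 /g /E /GRing.scale /= /f2.
  by field.
have I2 : (\int[mu]_(t in `[0%R, +oo[) (f2 t)%:E + \int[mu]_(t in `[0%R, +oo[) (g t)%:E = (2 * K)%R%:E)%E.
  rewrite -ge0_integralD //; first last.
  - exact/measurable_EFinP.
  - by move=> t /dt t0; rewrite lee_fin g_ge0.
  - exact/measurable_EFinP.
  - by move=> t _; rewrite lee_fin.
  rewrite -(integral_E (ltW K0)); apply: eq_integral => t _.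
  by rewrite -EFinD /g addrC subrK.
have i1 : (0 <= \int[mu]_(t in `[0%R, +oo[) (f1 t)%:E)%E by apply: integral_ge0 => t _; rewrite lee_fin.
have i2 : (0 <= \int[mu]_(t in `[0%R, +oo[) (f2 t)%:E)%E by apply: integral_ge0 => t _; rewrite lee_fin.
have ig : (0 <= \int[mu]_(t in `[0%R, +oo[) (g t)%:E)%E.
  by apply: integral_ge0 => t /dt t0; rewrite lee_fin g_ge0.
move: I1 I2 i1 i2 ig.
case: (\int[mu]_(t in _) (f1 t)%:E)%E => [u||]; case: (\int[mu]_(t in _) (f2 t)%:E)%E => [v||];
  case: (\int[mu]_(t in _) (g t)%:E)%E => [z||] //= [e1] [e2] _ _ _.
by split; rewrite ?ltry //; congr EFin; lra.
Unshelve. all: by end_near.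
Qed.

Lemma Gamma_rec : Gamma (x + 1) = x * Gamma x.
Proof.
have [e fin] := gamma_by_parts; rewrite /Gamma /Rintegral !integral_itv_obnd_cbnd //; last 2 first.
- by apply/measurable_EFinP; exact: measurable_gamma_integrand.
- by apply/measurable_EFinP; exact: measurable_gamma_integrand.
under eq_integral => t _ do rewrite addrK.
rewrite -[X in fine X = _]e.
have -> : (\int[mu]_(t in `[0%R, +oo[) (f1 t)%:E = x%:E * \int[mu]_(t in `[0%R, +oo[) (powR t (x - 1) * expR (- t))%:E)%E.
  rewrite -ge0_integralZl //.
  - by apply/measurable_EFinP; exact: measurable_gamma_integrand.
  - by move=> t _; rewrite lee_fin mulr_ge0 ?powR_ge0 ?expR_ge0.
  - by rewrite lee_fin ltW.
case: (\int[mu]_(t in _) _)%E => [u||] //=.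
- by rewrite gt0_muley ?lte_fin //= mulr0.
- by rewrite gt0_muleNy ?lte_fin //= mulr0.
Qed.

(** Bounded below by the integral of e^-t over t >= 1; finiteness comes from
    [gamma_by_parts]. *)
Lemma Gamma_gt0 : 0 < Gamma x.
Proof.
have [e fin] := gamma_by_parts; rewrite /Gamma /Rintegral !integral_itv_obnd_cbnd //; last first.
  by apply/measurable_EFinP; exact: measurable_gamma_integrand.
set I := (\int[mu]_(t in _) _)%E.
have eI : (\int[mu]_(t in `[0%R, +oo[) (f1 t)%:E = x%:E * I)%E.
  rewrite -ge0_integralZl //.
  - by apply/measurable_EFinP; exact: measurable_gamma_integrand.
  - by move=> t _; rewrite lee_fin mulr_ge0 ?powR_ge0 ?expR_ge0.
  - by rewrite lee_fin ltW.
have lI : ((expR (- 1))%:E <= I)%E.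
  have <- : (\int[mu]_(t in `[1%R, +oo[) (1 * expR (- (t * 1)))%:E = (expR (- 1))%:E)%E.
    by rewrite integral_expR_ray // divr1 !mul1r.
  apply: (@le_trans _ _ (\int[mu]_(t in `[1%R, +oo[) (powR t (x - 1) * expR (- t))%:E)%E).
    apply: ge0_le_integral => //.
    - apply/measurable_EFinP; have h := @measurable_gamma_integrand 0 `[1%R : R, +oo[%classic.
      by apply: (eq_measurable_fun _ _ h) => t _ /=; rewrite powRr0 mulr1.
    - by apply/measurable_EFinP; exact: measurable_gamma_integrand.
    move=> t; rewrite /= in_itv /= andbT => t1; rewrite lee_fin mulr1 ler_pM2r ?expR_gt0 //.
    by rewrite -[leLHS](powRr0 t) ler_powR // subr_ge0.
  apply: ge0_subset_integral => //.
  - by apply/measurable_EFinP; exact: measurable_gamma_integrand.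
  - by move=> t _; rewrite lee_fin mulr_ge0 ?powR_ge0 ?expR_ge0.
  by move=> t; rewrite /= !in_itv /= !andbT; apply: le_trans.
have I0 : (0 < I)%E by apply: lt_le_trans lI; rewrite lte_fin expR_gt0.
rewrite -e eI in fin; move: I fin I0 {e eI lI} => I fin I0.
by case: I fin I0 => [u||] //=; rewrite gt0_muley ?lte_fin.
Qed.

End GammaFunction.

Section Factorial.
Variable R : realType.

Lemma rfact_gt0 (y : R) : 0 <= y -> 0 < rfact y.
Proof. by move=> y0; apply: Gamma_gt0; rewrite lerDr. Qed.

Lemma rfactD (y : R) k : 0 <= y -> rfact (y + k%:R) = rfact y * poch (y + 1) k.
Proof.
move=> y0; elim: k => [|k IH]; first by rewrite addr0 /poch big_ord0 mulr1.
have -> : rfact (y + k.+1%:R) = (y + k%:R + 1) * rfact (y + k%:R).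
  by rewrite /rfact -natr1 addrA Gamma_rec // lerDr addr_ge0.
by rewrite IH /poch big_ord_recr /= addrAC; ring.
Qed.

End Factorial.

End EulerGamma.

(** * Pochhammer symbols and a Hankel determinant of their quotients *)

Section Poch.
Variable R : nzRingType.
Implicit Types x : R.

Lemma poch0 x : poch x 0 = 1.
Proof. by rewrite /poch big_ord0. Qed.

Lemma pochS x k : poch x k.+1 = poch x k * (x + k%:R).
Proof. by rewrite /poch big_ord_recr. Qed.

Lemma pochD x k l : poch x (k + l) = poch x k * poch (x + k%:R) l.
Proof.
elim: l => [|l IH]; first by rewrite addn0 poch0 mulr1.
by rewrite addnS !pochS IH natrD !addrA mulrA.
Qed.

Lemma pochSl x k : poch x k.+1 = x * poch (x + 1) k.
Proof. by rewrite -[k.+1]add1n pochD pochS poch0 mul1r addr0. Qed.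

End Poch.

Lemma poch_neq0 (F : idomainType) (x : F) k :
  (forall j, (j < k)%N -> x + j%:R != 0) -> poch x k != 0.
Proof. by move=> x0; apply/prodf_neq0 => j _; apply: x0. Qed.

Lemma det_scale (R : comNzRingType) n (f g : nat -> R) (A : 'M[R]_n) :
  \det (\matrix_(i, j) (f i * g j * A i j)) =
  \prod_(i < n) f i * \prod_(j < n) g j * \det A.
Proof.
have -> : \matrix_(i, j) (f i * g j * A i j) =
    diag_mx (\row_i f i) *m A *m diag_mx (\row_j g j).
  apply/matrixP => i j; rewrite mul_mx_diag mul_diag_mx !mxE; ring.
rewrite !det_mulmx !det_diag mulrAC; congr (_ * _ * _);
  by apply: eq_bigr => i _; rewrite mxE.
Qed.

Lemma det_col0 (R : comNzRingType) n (A : 'M[R]_n.+1) :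
  (forall i, A (lift ord0 i) ord0 = 0) ->
  \det A = A ord0 ord0 * \det (\matrix_(i, j) A (lift ord0 i) (lift ord0 j)).
Proof.
move=> A0; rewrite (expand_det_col _ ord0) big_ord_recl big1 => [|i _].
  rewrite addr0 /cofactor expr0 mul1r; congr (_ * \det _).
  by apply/matrixP => i j; rewrite !mxE.
by rewrite A0 mul0r.
Qed.

(** Subtracting from each row the multiple of the previous one that kills its first entry
    leaves, up to factors of rows and columns, the matrix with al + 1 and be + 2. *)
Lemma det_poch_ratio (F : fieldType) K (al be : F) :
  (forall j, (j < 2 * K)%N -> be + j%:R != 0) ->
  \det (\matrix_(i < K, j < K) (poch al (i + j) / poch be (i + j))) =
  \prod_(k < K) (k`!%:R * poch al k * poch (be - al) k
                 / (poch be (2 * k) * poch (be + k%:R - 1) k)).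
Proof.
elim: K al be => [|K IH] al be be0; first by rewrite det_mx00 big_ord0.
pose h j := poch al j / poch be j.
have hS j : (j < 2 * K.+1)%N -> h j.+1 = h j * ((al + j%:R) / (be + j%:R)).
  by move=> jK; rewrite /h !pochS invfM mulrACA.
pose M := \matrix_(i < K.+1, j < K.+1) h (i + j)%N.
(* the row operation; L is unitriangular *)
pose L := \matrix_(i < K.+1, j < K.+1)
  ((i == j)%:R - (i == j.+1 :> nat)%:R * ((al + j%:R) / (be + j%:R)) : F).
have detL : \det L = 1.
  rewrite det_trig; last first.
    apply/is_trig_mxP => i j ij; rewrite mxE; have /negbTE-> : i != j.
      by apply/eqP => eij; rewrite eij ltnn in ij.
    by rewrite (ltn_eqF (leqW ij)) mul0r subr0.
  by apply: big1 => i _; rewrite mxE eqxx (ltn_eqF (ltnSn _)) mul0r subr0.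
have LM0 j : (L *m M) ord0 j = h j.
  rewrite mxE (bigD1 ord0) //= big1 => [|k /negbTE k0].
    by rewrite !mxE /= mul0r subr0 mul1r addr0.
  by rewrite !mxE eq_sym k0 mul0r subr0 mul0r.
have LMS (i : 'I_K) (j : 'I_K.+1) : (L *m M) (lift ord0 i) j =
    h (i + j).+1 - (al + i%:R) / (be + i%:R) * h (i + j)%N.
  rewrite mxE (bigD1 (lift ord0 i)) //= (bigD1 (widen_ord (leqnSn K) i)) /=; last first.
    by rewrite -val_eqE /= /bump /= add1n (ltn_eqF (ltnSn _)).
  rewrite big1 => [|k /andP[k1 k2]]; last first.
    rewrite !mxE eq_sym (negbTE k1) eqSS.
    rewrite -val_eqE /= in k2.
    by rewrite eq_sym (negbTE k2) mul0r subr0 mul0r.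
  rewrite !mxE -!val_eqE /= /bump /= !add1n !eqxx (gtn_eqF (ltnSn _)).
  rewrite (ltn_eqF (ltnSn _)) addSn.
  by rewrite mul0r subr0 mul1r sub0r mul1r addr0 mulNr.
have -> : \matrix_(i < K.+1, j < K.+1) (poch al (i + j) / poch be (i + j)) = M.
  by apply/matrixP => i j; rewrite !mxE.
have -> : \det M = \det (L *m M) by rewrite det_mulmx detL mul1r.
rewrite det_col0; last first.
  move=> i; rewrite LMS addn0 hS ?[h i * _]mulrC ?subrr //.
  by have /= := ltn_ord i; lia.
rewrite LM0 /h !poch0 divr1 mul1r.
pose f (i : nat) : F := (be - al) * al / ((be + i%:R) * be * (be + 1)).
pose g (j : nat) : F := j.+1%:R.
have be_neq0 j : (j < 2 * K.+1)%N -> be + j%:R != 0 by apply: be0.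
rewrite (_ : \matrix_(_, _) _ = \matrix_(i < K, j < K) (f i * g j *
   (\matrix_(i < K, j < K) (poch (al + 1) (i + j) / poch (be + 2) (i + j))) i j)); last first.
  apply/matrixP => i j; rewrite mxE LMS [RHS]mxE mxE /= /bump /= add1n addnS.
  have iK := ltn_ord i; have jK := ltn_ord j.
  have e0 : be + (i + j).+1%:R != 0 by apply: be_neq0; lia.
  have e1 : be + i%:R != 0 by apply: be_neq0; lia.
  have e2 : be != 0 by have := be_neq0 0%N; rewrite addr0; apply; lia.
  have e3 : be + 1 != 0 by apply: (be_neq0 1%N); lia.
  have e4 : poch (be + 1 + 1) (i + j) != 0.
    apply: poch_neq0 => k kij; have -> : be + 1 + 1 + k%:R = be + k.+2%:R.
      by rewrite -!natr1; ring.
    by apply: be_neq0; lia.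
  rewrite hS; last by lia.
  rewrite /h /f /g [poch al _]pochSl.
  have -> : poch be (i + j).+1 = be * (be + 1) * poch (be + 2) (i + j) / (be + (i + j).+1%:R).
    apply: (canRL (mulfK e0)); rewrite -pochS pochSl pochSl mulrA.
    by have -> : be + 1 + 1 = be + 2 by ring.
  have eb : be + 1 + 1 = be + 2 by ring.
  rewrite eb in e4.
  have e0' : be + (i%:R + j%:R + 1) != 0 by rewrite -natrD natr1.
  move: (poch (be + 2) _) e4 (poch (al + 1) _) => X e4 Y.
  rewrite -!natr1 natrD.
  by field; rewrite e0' e1 e2 e3 e4.
rewrite det_scale IH; last first.
  by move=> j jK; rewrite -addrA -natrD; apply: be_neq0; lia.
rewrite -!big_split big_ord_recl /= !poch0 !mulr1 divr1 mul1r.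
apply: eq_bigr => i _; rewrite /f /g /bump /= add1n.
have iK := ltn_ord i.
have e1 : be + i%:R != 0 by apply: be_neq0; lia.
have e2 : be != 0 by have := be_neq0 0%N; rewrite addr0; apply; lia.
have e3 : be + 1 != 0 by apply: (be_neq0 1%N); lia.
have e4 : poch (be + 2) (2 * i) != 0.
  by apply: poch_neq0 => k kij; rewrite -addrA -natrD; apply: be_neq0; lia.
have e5 : poch (be + i%:R + 1) i != 0.
  apply: poch_neq0 => k kij; have -> : be + i%:R + 1 + k%:R = be + (i + k).+1%:R.
    by rewrite -!natr1 natrD; ring.
  by apply: be_neq0; lia.
rewrite mulnS !add2n [poch be _]pochSl [poch (be + 1) _]pochSl factS natrM.
rewrite [poch al _]pochSl [poch (be - al) _]pochSl.
have -> : be + i.+1%:R - 1 = be + i%:R by rewrite -natr1; ring.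
have -> : be + 2 + i%:R - 1 = be + i%:R + 1 by ring.
rewrite [poch (be + i%:R) _]pochSl.
have -> : be + 1 + 1 = be + 2 by ring.
have -> : be + 2 - (al + 1) = be - al + 1 by ring.
move: (poch _ _) e4 (poch _ _) e5 => X e4 Y e5.
by field; rewrite e1 e2 e3 e4 e5.
Qed.

(** * The binomial functional and its Pearson equation *)

Section WilsonGram.
Variables (F : fieldType) (a b c d : F) (W : nat -> nat -> F).
Let s := a + b + c + d.
Hypothesis Wl : forall k l, (s + (k + l)%:R) * W k.+1 l =
  - ((a + b + (k + l)%:R) * (a + c + k%:R) * (a + d + k%:R)) * W k l.
Hypothesis Wr : forall k l, (s + (k + l)%:R) * W k l.+1 =
  - ((a + b + (k + l)%:R) * (b + c + l%:R) * (b + d + l%:R)) * W k l.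

(** Both recursions together determine W from W 0 0.  The common factor depends on
    k + l only, which leaves the determinant of Pochhammer quotients above. *)
Lemma wilson_gram_entry k l : poch s (k + l) * W k l =
  (-1) ^+ k * (-1) ^+ l * poch (a + b) (k + l) *
  (poch (a + c) k * poch (a + d) k) * (poch (b + c) l * poch (b + d) l) * W 0 0.
Proof.
elim: k => [|k IH].
  elim: l => [|l IH]; first by rewrite !poch0; ring.
  rewrite add0n in IH.
  have := Wr 0 l; rewrite add0n => Wr0l.
  by rewrite add0n !pochS -mulrA Wr0l mulrCA IH !exprS; ring.
by rewrite addSn !pochS -mulrA Wl mulrCA IH !exprS; ring.
Qed.

Lemma det_wilson_gram K : (forall j, (j < 2 * K)%N -> s + j%:R != 0) ->
  \det (\matrix_(k < K, l < K) W k l) = W 0 0 ^+ K *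
  \prod_(k < K)
     (k`!%:R * (poch (a + b) k * poch (a + c) k * poch (b + c) k)
      * (poch (a + d) k * poch (b + d) k * poch (c + d) k)
      / (poch s (2 * k) * poch (s + k%:R - 1) k)).
Proof.
move=> s0.
pose f k := (-1) ^+ k * (poch (a + c) k * poch (a + d) k) * W 0 0.
pose g l := (-1) ^+ l * (poch (b + c) l * poch (b + d) l).
have -> : \matrix_(k < K, l < K) W k l = \matrix_(k < K, l < K) (f k * g l *
    (\matrix_(k < K, l < K) (poch (a + b) (k + l) / poch s (k + l))) k l).
  apply/matrixP => k l; rewrite !mxE.
  have kK := ltn_ord k; have lK := ltn_ord l.
  have skl : poch s (k + l) != 0 by apply: poch_neq0 => j jkl; apply: s0; lia.
  apply: (mulfI skl); rewrite wilson_gram_entry /f /g.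
  by field.
rewrite det_scale det_poch_ratio // !big_split /= prodr_const cardT size_enum_ord.
have -> : s - (a + b) = c + d by rewrite /s; ring.
have sg : \prod_(i < K) (-1) ^+ i * \prod_(i < K) (-1) ^+ i = 1 :> F.
  by rewrite -big_split big1 // => i _ /=; rewrite -expr2 sqrr_sign.
move: (\prod_(i < K) (-1) ^+ i) sg => sgn sg.
apply/eqP; rewrite -subr_eq0; apply/eqP.
rewrite -[X in _ - X]mul1r -[X in _ - X * _]sg; ring.
Qed.

End WilsonGram.

Lemma eq_opp_eq0 (F : numDomainType) (x : F) : x = - x -> x = 0.
Proof. by move/eqP; rewrite -addr_eq0 -mulr2n mulrn_eq0 => /eqP. Qed.

Section Functional.
Variables (F : numFieldType) (z : F) (n : nat).
Hypothesis zE : z ^+ 2 = z - 1.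
Definition uz := z / (1 + z).
Definition vz := (1 + z)^-1.

Lemma z_neq0 : z != 0.
Proof.
by apply/eqP => z0; move: zE => /eqP; rewrite z0 expr0n sub0r eq_sym oppr_eq0 oner_eq0.
Qed.

Lemma z1_neq0 : 1 + z != 0.
Proof.
apply/eqP => z1; have ez : z = -1 by apply/eqP; rewrite -subr_eq0 opprK addrC z1.
have : (3 : F) != 0 by rewrite pnatr_eq0.
move: zE; rewrite ez sqrrN expr1n => h /eqP; apply.
rewrite (_ : 3 = 1 - (-1 - 1)); first by rewrite {1}h subrr.
ring.
Qed.

Lemma uvD : uz + vz = 1.
Proof. by rewrite /uz /vz; field; rewrite z1_neq0. Qed.

Lemma uzE : uz = z * vz. Proof. by []. Qed.

Lemma z3 : z ^+ 3 = -1.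
Proof. by rewrite exprS zE mulrBr mulr1 -expr2 zE; ring. Qed.

Definition bnode (k : nat) : F := (n%:R / 2 - k%:R) / 3.
Definition bwt (k : nat) : F := 'C(n, k)%:R * uz ^+ k * vz ^+ (n - k).

(** A sum over the binomial weight with complex parameter plus x times the sum over
    the reversed weight; the nodes are centred, so that reversal is t -> -t. *)
Definition bfun (x : F) (f : F -> F) : F :=
  \sum_(k < n.+1) bwt k * f (bnode k) + x * \sum_(k < n.+1) bwt (n - k) * f (bnode k).

Lemma bnode_rev k : (k <= n)%N -> bnode (n - k) = - bnode k.
Proof. by move=> kn; rewrite /bnode natrB //; field. Qed.

Lemma bfun_sum_rev (f : F -> F) :
  \sum_(k < n.+1) bwt (n - k) * f (bnode k) = \sum_(k < n.+1) bwt k * f (- bnode k).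
Proof.
rewrite (reindex_inj rev_ord_inj); apply: eq_bigr => k _ /=.
have kn : (k <= n)%N by rewrite -ltnS.
by rewrite subSS subKn // bnode_rev.
Qed.

Lemma bfunE x f : bfun x f = \sum_(k < n.+1) bwt k * (f (bnode k) + x * f (- bnode k)).
Proof.
rewrite /bfun bfun_sum_rev mulr_sumr -big_split; apply: eq_bigr => k _.
by rewrite mulrDr mulrCA.
Qed.

Lemma bfunD x f g : bfun x (fun t => f t + g t) = bfun x f + bfun x g.
Proof. by rewrite !bfunE -big_split; apply: eq_bigr => k _; rewrite /=; ring. Qed.

Lemma bfunZ x c f : bfun x (fun t => c * f t) = c * bfun x f.
Proof. by rewrite !bfunE mulr_sumr; apply: eq_bigr => k _; ring. Qed.

Lemma bfunN x f : bfun x (fun t => - f t) = - bfun x f.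
Proof. by rewrite !bfunE -sumrN; apply: eq_bigr => k _; ring. Qed.

Lemma eq_bfun x f g : f =1 g -> bfun x f = bfun x g.
Proof. by move=> fg; rewrite !bfunE; apply: eq_bigr => k _; rewrite !fg. Qed.

Lemma bfun_split x f : bfun x f =
  \sum_(k < n.+1) bwt k * f (bnode k) + x * \sum_(k < n.+1) bwt k * f (- bnode k).
Proof. by rewrite /bfun bfun_sum_rev. Qed.

Lemma bfun_even f : bfun 1 (fun t => f (- t)) = bfun 1 f.
Proof. by rewrite !bfunE; apply: eq_bigr => k _; rewrite opprK !mul1r addrC. Qed.

Lemma bfun_odd f : bfun (-1) (fun t => f (- t)) = - bfun (-1) f.
Proof.
rewrite !bfunE -sumrN; apply: eq_bigr => k _.
by rewrite opprK; ring.
Qed.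

Definition isev (f : F -> F) := forall t, f (- t) = f t.
Definition isodd (f : F -> F) := forall t, f (- t) = - f t.

Lemma bfun_even0 f : isodd f -> bfun 1 f = 0.
Proof.
move=> fo; rewrite bfunE big1 // => k _.
by rewrite fo mul1r subrr mulr0.
Qed.

Lemma bfun_odd0 f : isev f -> bfun (-1) f = 0.
Proof.
move=> fo; rewrite bfunE big1 // => k _.
by rewrite fo mulN1r subrr mulr0.
Qed.

(** The weight satisfies (n - k) bwt k = (k + 1) bwt (k + 1) / z, as u = z v. *)
Lemma bsum_step (g : F -> F) :
  \sum_(k < n.+1) bwt k * ((n%:R - k%:R) * g k%:R) =
  z^-1 * \sum_(k < n.+1) bwt k * (k%:R * g (k%:R - 1)).
Proof.
rewrite big_ord_recr /= subrr mul0r mulr0 addr0.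
rewrite big_ord_recl /= mul0r mulr0 add0r mulr_sumr.
apply: eq_bigr => k _; rewrite /bump /= add1n.
have kn := ltn_ord k.
rewrite -natr1 addrK /bwt.
have -> : (n - k = (n - k.+1).+1)%N by lia.
have hb : ('C(n, k)%:R * (n%:R - k%:R) = 'C(n, k.+1)%:R * (k%:R + 1) :> F).
  rewrite natr1 -!natrM -natrB ?(ltnW kn) // -natrM; congr (_%:R).
  by rewrite mulnC -mul_bin_left mulnC.
have -> : 'C(n, k)%:R * uz ^+ k * vz ^+ (n - k.+1).+1 * ((n%:R - k%:R) * g k%:R)
  = ('C(n, k)%:R * (n%:R - k%:R)) * uz ^+ k * vz ^+ (n - k.+1).+1 * g k%:R by ring.
rewrite hb !exprS; move: (uz ^+ k) (vz ^+ (n - k.+1)) => X Y; rewrite uzE.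
by field; rewrite z_neq0.
Qed.

(** Three steps produce z^-3 = -1, so that no power of z is left: this is where the
    sixth root of unity is used. *)
Lemma bsum_step3 (g : F -> F) :
  \sum_(k < n.+1) bwt k * ((n%:R - k%:R) * (n%:R - k%:R - 1) * (n%:R - k%:R - 2) * g k%:R) =
  - \sum_(k < n.+1) bwt k * (k%:R * (k%:R - 1) * (k%:R - 2) * g (k%:R - 3)).
Proof.
pose g1 x := (n%:R - x - 1) * (n%:R - x - 2) * g x.
pose g2 x := x * ((n%:R - x - 1) * g (x - 1)).
pose g3 x := x * ((x - 1) * g (x - 2)).
have -> : \sum_(k < n.+1) bwt k * ((n%:R - k%:R) * (n%:R - k%:R - 1) * (n%:R - k%:R - 2) * g k%:R)
  = \sum_(k < n.+1) bwt k * ((n%:R - k%:R) * g1 k%:R).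
  by apply: eq_bigr => k _; rewrite /g1; ring.
rewrite bsum_step.
have -> : \sum_(k < n.+1) bwt k * (k%:R * g1 (k%:R - 1))
  = \sum_(k < n.+1) bwt k * ((n%:R - k%:R) * g2 k%:R).
  by apply: eq_bigr => k _; rewrite /g1 /g2; ring.
rewrite bsum_step.
have -> : \sum_(k < n.+1) bwt k * (k%:R * g2 (k%:R - 1))
  = \sum_(k < n.+1) bwt k * ((n%:R - k%:R) * g3 k%:R).
  apply: eq_bigr => k _; rewrite /g2 /g3.
  by have -> : k%:R - 1 - 1 = k%:R - 2 :> F; ring.
rewrite bsum_step !mulrA -!invfM -expr2 -exprSr z3 invrN invr1 mulN1r; congr (- _).
apply: eq_bigr => k _; rewrite /g3.
by have -> : k%:R - 1 - 2 = k%:R - 3 :> F; ring.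
Qed.

(** With [pb] and [pc], the three zeros of the cubic of the Pearson equation: in terms
    of the node t, the product k (k-1) (k-2) is a multiple of (pa+t)(pb+t)(pc+t). *)
Definition pa : F := - (n%:R / 6).
Definition pb : F := pa + 1 / 3.
Definition pc : F := pa + 2 / 3.

Lemma bsum_pearson (f : F -> F) :
  \sum_(k < n.+1) bwt k * ((pa - bnode k) * (pb - bnode k) * (pc - bnode k) * f (bnode k)) =
  - \sum_(k < n.+1) bwt k * ((pa + bnode k) * (pb + bnode k) * (pc + bnode k) * f (bnode k + 1)).
Proof.
have /= := bsum_step3 (fun x => f ((n%:R / 2 - x) / 3)).
set L := (X in X = _ -> _); set R := (X in _ = - X -> _) => e.
transitivity (- 1 / 27 * L).
  rewrite mulr_sumr; apply: eq_bigr => k _ /=.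
  by rewrite /pb /pc /pa /bnode; field.
transitivity (- (- 1 / 27 * R)); first by rewrite e; ring.
rewrite mulr_sumr; congr (- _); apply: eq_bigr => k _ /=.
rewrite /pb /pc /pa /bnode.
have -> : (n%:R / 2 - (k%:R - 3)) / 3 = (n%:R / 2 - k%:R) / 3 + 1 :> F by field.
by field.
Qed.

(** The reversed weight satisfies the same equation, because t -> -t exchanges its
    two sides. *)
Lemma bfun_pearson x (f : F -> F) :
  bfun x (fun t => (pa - t) * (pb - t) * (pc - t) * f t) =
  - bfun x (fun t => (pa + t) * (pb + t) * (pc + t) * f (t + 1)).
Proof.
have e1 := bsum_pearson f; have e2 := bsum_pearson (fun t => f (1 - t)).
rewrite !bfun_split e1.
rewrite opprD -mulrN; congr (_ + _ * _).
transitivity (\sum_(k < n.+1) bwt k * ((pa + bnode k) * (pb + bnode k) * (pc + bnode k) * f (- bnode k))).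
  by apply: eq_bigr => k _; rewrite !opprK.
apply: oppr_inj; rewrite opprK.
rewrite (eq_bigr (fun k : 'I_n.+1 => bwt k * ((pa + bnode k) * (pb + bnode k) * (pc + bnode k) * f (1 - (bnode k + 1))))); last first.
  by move=> k _; have -> : 1 - (bnode k + 1) = - bnode k by ring.
rewrite -e2; apply: eq_bigr => k _.
by have -> : 1 - bnode k = - bnode k + 1 by ring.
Qed.

Definition ev (a : F) (k : nat) (t : F) := \prod_(i < k) (t ^+ 2 - (a + i%:R) ^+ 2).

Lemma evS a k t : ev a k.+1 t = ev a k t * (t ^+ 2 - (a + k%:R) ^+ 2).
Proof. by rewrite /ev big_ord_recr. Qed.

Lemma ev0 a t : ev a 0 t = 1. Proof. by rewrite /ev big_ord0. Qed.

Lemma ev_isev a k : isev (ev a k).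
Proof. by move=> t; rewrite /ev; apply: eq_bigr => i _; rewrite sqrrN. Qed.

Lemma evE a k t : ev a k t = (-1) ^+ k * (poch (a + t) k * poch (a - t) k).
Proof.
elim: k => [|k IH]; first by rewrite ev0 !poch0; ring.
by rewrite evS IH !pochS [(-1) ^+ k.+1]exprS; ring.
Qed.

(** Inserting ev pa k * ev pb l shifts the parameters pa and pb by k and l, because
    y (y+1)_k = (y)_k (y + k) moves the shifted Pochhammer symbols back. *)
Lemma bfun_pearson_ev x k l (g : F -> F) :
  let P t := ev pa k t * ev pb l t in
  let A := pa + k%:R in let B := pb + l%:R in
  bfun x (fun t => P t * ((A - t) * (B - t) * (pc - t) * g t)) =
  - bfun x (fun t => P t * ((A + t) * (B + t) * (pc + t) * g (t + 1))).
Proof.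
move=> P A B.
have := bfun_pearson x (fun t => (-1) ^+ k * (-1) ^+ l *
  (poch (pa + t) k * poch (pa + 1 - t) k * (poch (pb + t) l * poch (pb + 1 - t) l)) * g t).
have split (y : F) j : y * poch (y + 1) j = poch y j * (y + j%:R) by rewrite -pochSl pochS.
move=> e; apply: etrans (etrans e _).
  apply: eq_bfun => t; rewrite /P !evE.
  have s1 := split (pa - t) k; have s2 := split (pb - t) l.
  have -> : pa + 1 - t = pa - t + 1 by ring.
  have -> : pb + 1 - t = pb - t + 1 by ring.
  transitivity ((-1) ^+ k * (-1) ^+ l * (poch (pa + t) k * poch (pb + t) l) * (poch (pa - t) k * (pa - t + k%:R)) * (poch (pb - t) l * (pb - t + l%:R)) * (pc - t) * g t).
    by rewrite /A /B; ring.
  by rewrite -s1 -s2; ring.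
congr (- _); apply: eq_bfun => t; rewrite /P !evE.
have s1 := split (pa + t) k; have s2 := split (pb + t) l.
have -> : pa + 1 - (t + 1) = pa - t by ring.
have -> : pb + 1 - (t + 1) = pb - t by ring.
rewrite !addrA; symmetry.
transitivity ((-1) ^+ k * (-1) ^+ l * (poch (pa - t) k * poch (pb - t) l) * (poch (pa + t) k * (pa + t + k%:R)) * (poch (pb + t) l * (pb + t + l%:R)) * (pc + t) * g (t + 1)).
  by rewrite /A /B; ring.
by rewrite -s1 -s2; ring.
Qed.

(** The relation that determines W(k+1, l) and W(k, l+1) from W(k, l), where
    W(k, l) is the value at P h: it says that the value at
    P h ((A+B+C+d) t^2 + e_3(A,B,C,d)) vanishes.  It is what the Wilson weight with
    parameters A, B, C, d satisfies. *)
Definition wilson_case (x d : F) (h : F -> F) :=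
  forall k l, let P t := ev pa k t * ev pb l t in
  let A := pa + k%:R in let B := pb + l%:R in
  (A + B + pc + d) * bfun x (fun t => P t * h t * t ^+ 2) =
  - (A * B * pc + A * B * d + A * pc * d + B * pc * d) * bfun x (fun t => P t * h t).

(** In each of the three cases g is such that the integrand on the right-hand side of the
    Pearson equation is, up to sign, the image of the one on the left under t -> -t.  By
    the parity of the functional the value is then its own negative and vanishes, and
    the part of the integrand that the functional does not kill is the asserted relation. *)
Lemma wilson_case_odd : wilson_case (-1) (1 / 2) id.
Proof.
move=> k l P A B.
have Pev t : P (- t) = P t by rewrite /P !ev_isev.
pose q t := (A - t) * (B - t) * (pc - t) * (t - 1 / 2).
have e1 : bfun (-1) (fun t => P t * q t) = 0.
  have e := bfun_pearson_ev (-1) k l (fun t => t - 1 / 2).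
  have e' : bfun (-1) (fun t => P t * q t) = bfun (-1) (fun t => P (- t) * q (- t)).
    rewrite [LHS]e -bfunN; apply: eq_bfun => t; rewrite Pev /q -/(P t) -/A -/B.
    by field.
  rewrite (bfun_odd (fun t => P t * q t)) in e'.
  exact: eq_opp_eq0.
have e2 : bfun (-1) (fun t => P t * (- (A * B * pc) / 2 - (A * B + A * pc + B * pc + (A + B + pc) / 2) * t ^+ 2 - t ^+ 4)) = 0.
  by apply: bfun_odd0 => t; rewrite Pev; ring.
apply/eqP; rewrite -subr_eq0 -!bfunZ -bfunN -bfunD; apply/eqP.
move: e1 e2; set b1 := bfun _ _; set b2 := bfun _ _ => e1 e2.
transitivity (b1 - b2); last by rewrite e1 e2 subr0.
rewrite /b1 /b2 -bfunN -bfunD; apply: eq_bfun => t.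
by rewrite /q; field.
Qed.

Lemma wilson_case_even0 : wilson_case 1 0 (fun=> 1).
Proof.
move=> k l P A B.
have Pev t : P (- t) = P t by rewrite /P !ev_isev.
pose q t := (A - t) * (B - t) * (pc - t).
have e1 : bfun 1 (fun t => P t * q t) = 0.
  have e := bfun_pearson_ev 1 k l (fun t => 1).
  have e' : bfun 1 (fun t => P t * q t) = - bfun 1 (fun t => P (- t) * q (- t)).
    under eq_bfun => t do rewrite /q -[X in _ * X]mulr1.
    rewrite [LHS]e; congr (- _); apply: eq_bfun => t; rewrite Pev /q -/(P t) -/A -/B.
    by ring.
  rewrite (bfun_even (fun t => P t * q t)) in e'.
  exact: eq_opp_eq0.
have e2 : bfun 1 (fun t => P t * (- (A * B + A * pc + B * pc) * t - t ^+ 3)) = 0.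
  by apply: bfun_even0 => t; rewrite Pev; ring.
apply/eqP; rewrite -subr_eq0 -!bfunZ -bfunN -bfunD; apply/eqP.
move: e1 e2; set b1 := bfun _ _; set b2 := bfun _ _ => e1 e2.
transitivity (b1 - b2); last by rewrite e1 e2 subr0.
rewrite /b1 /b2 -bfunN -bfunD; apply: eq_bfun => t.
rewrite /q; ring.
Qed.

Lemma wilson_case_even1 : wilson_case 1 1 (fun t => t ^+ 2).
Proof.
move=> k l P A B.
have Pev t : P (- t) = P t by rewrite /P !ev_isev.
pose q t := (A - t) * (B - t) * (pc - t) * (t ^+ 2 - t).
have e1 : bfun 1 (fun t => P t * q t) = 0.
  have e := bfun_pearson_ev 1 k l (fun t => t ^+ 2 - t).
  have e' : bfun 1 (fun t => P t * q t) = - bfun 1 (fun t => P (- t) * q (- t)).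
    rewrite [LHS]e; congr (- _); apply: eq_bfun => t; rewrite Pev /q -/(P t) -/A -/B.
    by ring.
  rewrite (bfun_even (fun t => P t * q t)) in e'.
  exact: eq_opp_eq0.
have e2 : bfun 1 (fun t => P t * (- (A * B * pc) * t - (A * B + A * pc + B * pc + (A + B + pc)) * t ^+ 3 - t ^+ 5)) = 0.
  by apply: bfun_even0 => t; rewrite Pev; ring.
apply/eqP; rewrite -subr_eq0 -!bfunZ -bfunN -bfunD; apply/eqP.
move: e1 e2; set b1 := bfun _ _; set b2 := bfun _ _ => e1 e2.
transitivity (b1 - b2); last by rewrite e1 e2 subr0.
rewrite /b1 /b2 -bfunN -bfunD; apply: eq_bfun => t.
rewrite /q; ring.
Qed.

End Functional.

(** * Gram determinants *)

Section Gram.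
Variables (F : comNzRingType) (N : nat) (wt nd : nat -> F).
Definition fsum (f : F -> F) := \sum_(k < N) wt k * f (nd k).

Lemma det_gram a (p q : nat -> {poly F}) :
  (forall i, size (p i) <= i.+1)%N -> (forall i, size (q i) <= i.+1)%N ->
  \det (\matrix_(i < a, j < a) fsum (fun t => (p i).[t] * (q j).[t])) =
  (\prod_(i < a) (p i)`_i) * (\prod_(i < a) (q i)`_i) *
  \det (\matrix_(i < a, j < a) fsum (fun t => t ^+ i * t ^+ j)).
Proof.
move=> sp sq.
pose cf (p : nat -> {poly F}) := \matrix_(i < a, j < a) (p i)`_j.
have dcf (r : nat -> {poly F}) : (forall i, size (r i) <= i.+1)%N -> \det (cf r) = \prod_(i < a) (r i)`_i.
  move=> sr; rewrite det_trig; first by apply: eq_bigr => i _; rewrite mxE.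
  apply/is_trig_mxP => i j ij; rewrite mxE nth_default //.
  exact: leq_trans (sr i) ij.
rewrite -(dcf p) // -(dcf q) // -[\det (cf q)]det_tr mulrAC -!det_mulmx.
congr (\det _); apply/matrixP => i j; rewrite !mxE /fsum.
transitivity (\sum_(k < N) \sum_(j0 < a) \sum_(i0 < a)
   wt k * ((p i)`_i0 * nd k ^+ i0 * ((q j)`_j0 * nd k ^+ j0))).
  apply: eq_bigr => k _.
  rewrite (@horner_coef_wide _ a (p i)) ?(leq_trans (sp i)) //.
  rewrite (@horner_coef_wide _ a (q j)) ?(leq_trans (sq j)) //.
  rewrite !mulr_sumr; apply: eq_bigr => j0 _.
  by rewrite mulr_suml mulr_sumr.
rewrite exchange_big; apply: eq_bigr => j0 _ /=.
rewrite exchange_big !mxE mulr_suml; apply: eq_bigr => i0 _ /=.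
rewrite !mxE mulr_sumr mulr_suml; apply: eq_bigr => k _; ring.
Qed.
End Gram.

Section EvenOdd.
Variables (F : comNzRingType) (K K' : nat).
Hypothesis KK' : (K' <= K <= K'.+1)%N.

Definition eo_fun (i : 'I_(K + K')) : nat :=
  match split i with inl k => 2 * k | inr k => 2 * k + 1 end.

Lemma eo_lt i : (eo_fun i < K + K')%N.
Proof.
case/andP: KK' => h1 h2.
by rewrite /eo_fun; case: (split i) => k; have := ltn_ord k; lia.
Qed.
Definition eo_ord i := Ordinal (eo_lt i).

Lemma eo_inj : injective eo_ord.
Proof.
move=> i j /(congr1 val) /=; rewrite /eo_fun => h.
apply: (can_inj (@splitK K K')).
case: (split i) (split j) h => k [] l h;
  by [congr inl; apply: val_inj => /=; lia | exfalso; lia | congr inr; apply: val_inj => /=; lia].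
Qed.

Lemma det_even_odd (A : nat -> nat -> F) :
  \det (\matrix_(i < K + K', j < K + K') A i j) =
  \det (block_mx (\matrix_(i < K, j < K) A (2 * i)%N (2 * j)%N)
                 (\matrix_(i < K, j < K') A (2 * i)%N (2 * j + 1)%N)
                 (\matrix_(i < K', j < K) A (2 * i + 1)%N (2 * j)%N)
                 (\matrix_(i < K', j < K') A (2 * i + 1)%N (2 * j + 1)%N)).
Proof.
pose s := perm.perm eo_inj.
have -> : block_mx (\matrix_(i < K, j < K) A (2 * i)%N (2 * j)%N)
                 (\matrix_(i < K, j < K') A (2 * i)%N (2 * j + 1)%N)
                 (\matrix_(i < K', j < K) A (2 * i + 1)%N (2 * j)%N)
                 (\matrix_(i < K', j < K') A (2 * i + 1)%N (2 * j + 1)%N) =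
   row_perm s (col_perm s (\matrix_(i < K + K', j < K + K') A i j)).
  apply/matrixP => i j; rewrite !mxE /= !perm.permE /= /eo_fun.
  by case: (split i) => k; rewrite !mxE; case: (split j) => l; rewrite !mxE.
rewrite row_permE col_permE !det_mulmx !det_perm perm.odd_permV mulrCA.
by rewrite -signr_addb addbb mulr1.
Qed.
End EvenOdd.

(** Multiplying by the block exchange makes the matrix block triangular; the
    determinant of the exchange follows from an elementary factorization. *)
Lemma det_swap (F : comNzRingType) K (U A B : 'M[F]_K) :
  \det (block_mx U A B 0) = (-1) ^+ K * (\det A * \det B).
Proof.
have -> : block_mx U A B 0 = block_mx A U 0 B *m block_mx 0 1%:M 1%:M 0.
  by rewrite mulmx_block !mulmx0 !mul0mx !mulmx1 !addr0 !add0r.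
(* only the determinant of the block exchange is wanted, and it follows by comparing
   determinants in this identity *)
have e : block_mx 0 1%:M 1%:M 0 *m block_mx 1%:M 1%:M 0 1%:M =
   block_mx (- 1%:M) 1%:M 0 1%:M *m block_mx 1%:M 0 1%:M 1%:M :> 'M[F]_(K + K).
  by rewrite !mulmx_block !mulmx0 !mul0mx !mulmx1 !add0r !addr0 addNr.
move: e => /(congr1 determinant).
rewrite !det_mulmx !det_ublock det_lblock -scaleN1r detZ !det1 !mulr1 => ->.
by rewrite mulrC.
Qed.

Section WilsonCase.
Variables (F : numFieldType) (z : F) (n : nat).
Hypothesis zE : z ^+ 2 = z - 1.
Variables (x d : F) (h : F -> F).
Local Notation pa := (pa F n).
Local Notation pb := (pb F n).
Local Notation pc := (pc F n).
Hypothesis wc : wilson_case z n x d h.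

Definition gramW k l := bfun z n x (fun t => ev pa k t * ev pb l t * h t).

Lemma gramWl k l : (pa + pb + pc + d + (k + l)%:R) * gramW k.+1 l =
  - ((pa + pb + (k + l)%:R) * (pa + pc + k%:R) * (pa + d + k%:R)) * gramW k l.
Proof.
have e := wc k l; rewrite natrD.
have -> : gramW k.+1 l = bfun z n x (fun t => ev pa k t * ev pb l t * h t * t ^+ 2)
   + - (pa + k%:R) ^+ 2 * gramW k l.
  rewrite /gramW -bfunZ -bfunD; apply: eq_bfun => t; rewrite evS; ring.
rewrite mulrDr.
rewrite (_ : _ + (k%:R + l%:R) = pa + k%:R + (pb + l%:R) + pc + d); last by ring.
rewrite e /gramW; ring.
Qed.

Lemma gramWr k l : (pa + pb + pc + d + (k + l)%:R) * gramW k l.+1 =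
  - ((pa + pb + (k + l)%:R) * (pb + pc + l%:R) * (pb + d + l%:R)) * gramW k l.
Proof.
have e := wc k l; rewrite natrD.
have -> : gramW k l.+1 = bfun z n x (fun t => ev pa k t * ev pb l t * h t * t ^+ 2)
   + - (pb + l%:R) ^+ 2 * gramW k l.
  rewrite /gramW -bfunZ -bfunD; apply: eq_bfun => t; rewrite evS; ring.
rewrite mulrDr.
rewrite (_ : _ + (k%:R + l%:R) = pa + k%:R + (pb + l%:R) + pc + d); last by ring.
rewrite e /gramW; ring.
Qed.

(** The k-th factor of [det_wilson_gram].  In its uses a, b, c come from the functional,
    and d is 1/2, 0 or 1 according to the case. *)
Definition wprod (a b c d : F) k :=
  (k`!%:R * (poch (a + b) k * poch (a + c) k * poch (b + c) k)
      * (poch (a + d) k * poch (b + d) k * poch (c + d) k)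
      / (poch (a + b + c + d) (2 * k) * poch (a + b + c + d + k%:R - 1) k)).

Lemma det_gramW K : (forall j, (j < 2 * K)%N -> pa + pb + pc + d + j%:R != 0) ->
  \det (\matrix_(k < K, l < K) gramW k l) =
  gramW 0 0 ^+ K * \prod_(k < K) wprod pa pb pc d k.
Proof. by apply: det_wilson_gram => k l; [apply: gramWl | apply: gramWr]. Qed.

Lemma det_gramW1 K : (forall j, (j <= 2 * K)%N -> pa + pb + pc + d + j%:R != 0) ->
  \det (\matrix_(k < K, l < K) gramW k.+1 l) =
  gramW 1 0 ^+ K * \prod_(k < K) wprod (pa + 1) pb pc d k.
Proof.
move=> nz; apply: (@det_wilson_gram _ (pa + 1) pb pc d (fun k l => gramW k.+1 l)) => [k l|k l|j jK].
- have := gramWl k.+1 l; rewrite addSn -natr1 -[k.+1%:R]natr1 => e.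
  have -> : pa + 1 + pb + pc + d + (k + l)%:R = pa + pb + pc + d + ((k + l)%:R + 1) by ring.
  rewrite e; ring.
- have := gramWr k.+1 l; rewrite addSn -natr1 => e.
  have -> : pa + 1 + pb + pc + d + (k + l)%:R = pa + pb + pc + d + ((k + l)%:R + 1) by ring.
  rewrite e; ring.
have -> : pa + 1 + pb + pc + d + j%:R = pa + pb + pc + d + j.+1%:R.
  by rewrite -natr1; ring.
exact: nz.
Qed.

End WilsonCase.

(** * Hankel determinants of the functional *)

Definition monic_seq (F : nzRingType) (p : nat -> {poly F}) :=
  forall i, p i \is monic /\ size (p i) = i.+1.

Lemma det_gram_monic (F : comNzRingType) (N : nat) (wt nd : nat -> F) a (p q : nat -> {poly F}) :
  monic_seq p -> monic_seq q ->
  \det (\matrix_(i < a, j < a) fsum N wt nd (fun t => (p i).[t] * (q j).[t])) =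
  \det (\matrix_(i < a, j < a) fsum N wt nd (fun t => t ^+ i * t ^+ j)).
Proof.
move=> mp mq; rewrite det_gram; try by move=> i; rewrite ?(mp i).2 ?(mq i).2.
have lc r : monic_seq r -> \prod_(i < a) (r i)`_i = 1 :> F.
  move=> mr; apply: big1 => i _; case: (mr i) => /monicP; rewrite /lead_coef => + e.
  by rewrite e.
by rewrite !lc // !mul1r.
Qed.

Section Families.
Variables (F : fieldType).

Definition evp (a : F) k : {poly F} := \prod_(i < k) ('X^2 - ((a + i%:R) ^+ 2)%:P).

(** Monic polynomials, even and odd alternately, so that a functional of definite
    parity has a Gram matrix in block form. *)
Definition fam (a : F) i := if odd i then 'X * evp a i./2 else evp a i./2.

(** Replaces [fam] when the weight carries the factor a + t: its odd members times
    a + t are again even. *)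
Definition famc (a : F) i := if odd i then ('X - a%:P) * evp (a + 1) i./2 else evp a i./2.

Lemma evp_monic a k : evp a k \is monic.
Proof. by apply: monic_prod => i _; apply: monicXnsubC. Qed.

Lemma evp_size a k : size (evp a k) = k.*2.+1.
Proof.
elim: k => [|k IH]; first by rewrite /evp big_ord0 size_poly1.
rewrite /evp big_ord_recr /= size_monicM ?evp_monic //; last first.
  by rewrite -size_poly_eq0 size_XnsubC.
by rewrite -/(evp a k) IH size_XnsubC // doubleS addnS addn2.
Qed.

Lemma fam_monic a : monic_seq (fam a).
Proof.
move=> i; rewrite /fam; have := odd_double_half i; case: odd => /= e.
  split; first by rewrite monicMl ?monicX ?evp_monic.
  by rewrite mulrC size_mulX ?evp_size ?monic_neq0 ?evp_monic // -{2}e.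
by split; rewrite ?evp_monic ?evp_size // -{2}e.
Qed.

Lemma famc_monic a : monic_seq (famc a).
Proof.
move=> i; rewrite /famc; have := odd_double_half i; case: odd => /= e.
  split; first by rewrite monicMl ?monicXsubC ?evp_monic.
  by rewrite mulrC size_Mmonic ?monicXsubC ?monic_neq0 ?evp_monic // evp_size size_XsubC addn2 -{2}e.
by split; rewrite ?evp_monic ?evp_size // -{2}e.
Qed.

End Families.

Lemma evpE (F : numFieldType) (a : F) k t : (evp a k).[t] = ev a k t.
Proof.
rewrite /evp horner_prod; apply: eq_bigr => i _.
by rewrite !hornerE.
Qed.

(** The outer factors (a+t)(t-a) are split off so that one of them can be absorbed by the
    Christoffel factor. *)
Lemma evSl (F : numFieldType) (a : F) k t :
  ev a k.+1 t = (a + t) * ((t - a) * ev (a + 1) k t).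
Proof.
rewrite /ev big_ord_recl /= mulrA; congr (_ * _); first by ring.
by apply: eq_bigr => i _; rewrite /bump /= add1n -natr1; ring.
Qed.

Section Hankel.
Variables (F : numFieldType) (z : F) (n : nat).
Hypothesis zE : z ^+ 2 = z - 1.
Local Notation pa := (pa F n).
Local Notation pb := (pb F n).
Local Notation pc := (pc F n).

Definition hank x a := \det (\matrix_(i < a, j < a) bfun z n x (fun t => t ^+ i * t ^+ j)).

(** The Hankel determinant of the functional with the Christoffel factor pa + t. *)
Definition hankc x a :=
  \det (\matrix_(i < a, j < a) bfun z n x (fun t => (pa + t) * (t ^+ i * t ^+ j))).

Definition bw x k := bwt z n k + x * bwt z n (n - k).

Lemma bfun_fsum x f : bfun z n x f = fsum n.+1 (bw x) (bnode F n) f.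
Proof.
rewrite /bfun /fsum mulr_sumr -big_split; apply: eq_bigr => k _ /=.
by rewrite /bw mulrDl mulrA.
Qed.

Lemma hank_fam x a : hank x a =
  \det (\matrix_(i < a, j < a) bfun z n x (fun t => (fam pa i).[t] * (fam pb j).[t])).
Proof.
transitivity (\det (\matrix_(i < a, j < a) fsum n.+1 (bw x) (bnode F n) (fun t => t ^+ i * t ^+ j))).
  by congr (\det _); apply/matrixP => i j; rewrite !mxE bfun_fsum.
rewrite -(det_gram_monic _ _ _ _ (fam_monic pa) (fam_monic pb)).
by congr (\det _); apply/matrixP => i j; rewrite !mxE bfun_fsum.
Qed.

Lemma hankc_fam x a : hankc x a =
  \det (\matrix_(i < a, j < a) bfun z n x
     (fun t => (pa + t) * ((famc pa i).[t] * (fam pb j).[t]))).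
Proof.
pose w k := bw x k * (pa + bnode F n k).
have e f : bfun z n x (fun t => (pa + t) * f t) = fsum n.+1 w (bnode F n) f.
  by rewrite bfun_fsum; apply: eq_bigr => k _; rewrite /w mulrA.
transitivity (\det (\matrix_(i < a, j < a) fsum n.+1 w (bnode F n) (fun t => t ^+ i * t ^+ j))).
  by congr (\det _); apply/matrixP => i j; rewrite !mxE e.
rewrite -(det_gram_monic _ _ _ _ (famc_monic pa) (fam_monic pb)).
by congr (\det _); apply/matrixP => i j; rewrite !mxE e.
Qed.

Lemma fam0 (a : F) k t : (fam a (2 * k)).[t] = ev a k t.
Proof. by rewrite /fam mul2n odd_double doubleK evpE. Qed.

Lemma fam1 (a : F) k t : (fam a (2 * k + 1)).[t] = t * ev a k t.
Proof. by rewrite /fam mul2n addn1 /= odd_double uphalf_double hornerM hornerX evpE. Qed.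

Lemma famc0 (a : F) k t : (famc a (2 * k)).[t] = ev a k t.
Proof. by rewrite /famc mul2n odd_double doubleK evpE. Qed.

Lemma famc1 (a : F) k t : (a + t) * (famc a (2 * k + 1)).[t] = ev a k.+1 t.
Proof.
by rewrite /famc mul2n addn1 /= odd_double uphalf_double hornerM evpE evSl !hornerE.
Qed.

Local Notation FF := (gramW z n (-1) id).
Local Notation EE := (gramW z n 1 (fun=> 1)).
Local Notation OO := (gramW z n 1 (fun t => t ^+ 2)).

(** For the odd functional only the pairings of an even with an odd polynomial survive;
    both off-diagonal blocks are the same matrix. *)
Lemma hank_odd K : hank (-1) (K + K) =
  (-1) ^+ K * (\det (\matrix_(k < K, l < K) FF k l)) ^+ 2.
Proof.
rewrite hank_fam (@det_even_odd _ K K _ (fun i j =>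
  bfun z n (-1) (fun t => (fam pa i).[t] * (fam pb j).[t]))) ?leqnn ?leqnSn //.
set A := (X in block_mx X _ _ _); set B := (X in block_mx _ X _ _).
set C := (X in block_mx _ _ X _); set D := (X in block_mx _ _ _ X).
have -> : D = 0.
  apply/matrixP => i j; rewrite !mxE; apply: bfun_odd0 => t.
  by rewrite !fam1 !ev_isev; ring.
rewrite det_swap expr2; congr (_ * (_ * _)); congr (\det _).
  apply/matrixP => i j; rewrite !mxE; apply: eq_bfun => t.
  by rewrite fam0 fam1; ring.
apply/matrixP => i j; rewrite !mxE; apply: eq_bfun => t.
by rewrite fam0 fam1; ring.
Qed.

(** The odd-even block consists of even integrands and vanishes, so that the matrix is
    block triangular. *)
Lemma hankc_odd K K' : (K' <= K <= K'.+1)%N -> hankc (-1) (K + K') =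
  \det (\matrix_(k < K, l < K) FF k l) * \det (\matrix_(k < K', l < K') FF k.+1 l).
Proof.
move=> KK; rewrite hankc_fam (@det_even_odd _ K K' _ (fun i j =>
  bfun z n (-1) (fun t => (pa + t) * ((famc pa i).[t] * (fam pb j).[t])))) //.
set A := (X in block_mx X _ _ _); set B := (X in block_mx _ X _ _).
set C := (X in block_mx _ _ X _); set D := (X in block_mx _ _ _ X).
have -> : C = 0.
  apply/matrixP => i j; rewrite !mxE; apply: bfun_odd0 => t.
  by rewrite !mulrA !famc1 !fam0 !ev_isev.
rewrite det_ublock; congr (_ * _); congr (\det _).
  apply/matrixP => i j; rewrite !mxE.
  transitivity (bfun z n (-1) (fun t => ev pa i t * ev pb j t * id t) +
     bfun z n (-1) (fun t => pa * (ev pa i t * ev pb j t))).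
    by rewrite -bfunD; apply: eq_bfun => t; rewrite famc0 fam0; ring.
  by rewrite [X in _ + X]bfun_odd0 ?addr0 // => t; rewrite !ev_isev.
apply/matrixP => i j; rewrite !mxE; apply: eq_bfun => t.
by rewrite mulrA famc1 fam1; ring.
Qed.

(** Two odd members give, after multiplication by pa + t, an odd integrand: the
    last block vanishes. *)
Lemma hankc_even_block K K' : (K' <= K <= K'.+1)%N -> hankc 1 (K + K') =
  \det (block_mx (pa *: \matrix_(k < K, l < K) EE k l) (\matrix_(k < K, l < K') OO k l)
                 (\matrix_(k < K', l < K) EE k.+1 l) 0).
Proof.
move=> KK; rewrite hankc_fam (@det_even_odd _ K K' _ (fun i j =>
  bfun z n 1 (fun t => (pa + t) * ((famc pa i).[t] * (fam pb j).[t])))) //.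
congr (\det (block_mx _ _ _ _)); apply/matrixP => i j; rewrite !mxE.
- transitivity (bfun z n 1 (fun t => pa * (ev pa i t * ev pb j t * 1)) +
     bfun z n 1 (fun t => t * (ev pa i t * ev pb j t))).
    by rewrite -bfunD; apply: eq_bfun => t; rewrite famc0 fam0; ring.
  by rewrite [X in _ + X]bfun_even0 ?addr0 ?bfunZ // => t; rewrite !ev_isev; ring.
- transitivity (bfun z n 1 (fun t => ev pa i t * ev pb j t * t ^+ 2) +
     bfun z n 1 (fun t => pa * t * (ev pa i t * ev pb j t))).
    by rewrite -bfunD; apply: eq_bfun => t; rewrite famc0 fam1; ring.
  by rewrite [X in _ + X]bfun_even0 ?addr0 // => t; rewrite !ev_isev; ring.
- by apply: eq_bfun => t; rewrite mulrA famc1 fam0 mulr1.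
by apply: bfun_even0 => t; rewrite !mulrA !famc1 !fam1 !ev_isev; ring.
Qed.

Lemma hankc_even0 K : hankc 1 (K + K) =
  (-1) ^+ K * (\det (\matrix_(k < K, l < K) OO k l) * \det (\matrix_(k < K, l < K) EE k.+1 l)).
Proof. by rewrite hankc_even_block ?det_swap // leqnn leqnSn. Qed.

(** The blocks are not square here.  The lower left block consists of the rows of EE other
    than the first one, so det EE factors out on the right; a column operation that
    clears the upper right block leaves - 1 / pa times OO without its first row. *)
Lemma hankc_even1 K : pa != 0 -> hankc 1 (K.+1 + K) =
  (-1) ^+ K * pa * (\det (\matrix_(k < K.+1, l < K.+1) EE k l)
             * \det (\matrix_(k < K, l < K) OO k.+1 l)).
Proof.
move=> pa0; rewrite hankc_even_block ?leqnn ?leqnSn //.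
set E := \matrix_(k, l) _; set O := \matrix_(k, l) _; set E1 := \matrix_(k, l) _.
pose J : 'M[F]_(K, K.+1) := \matrix_(i, j) (j == lift ord0 i)%:R.
have -> : block_mx (pa *: E) O E1 0 = block_mx pa%:M O J 0 *m block_mx E 0 0 1%:M.
  rewrite mulmx_block !mulmx0 !mul0mx !mulmx1 mul_scalar_mx !addr0 !add0r.
  congr block_mx; apply/matrixP => i j; rewrite !mxE (bigD1 (lift ord0 i)) //= big1.
    by rewrite !mxE eqxx mul1r addr0 /bump.
  by move=> k /negbTE k0; rewrite !mxE k0 mul0r.
have e : block_mx pa%:M O J 0 *m block_mx 1%:M (- pa^-1 *: O) 0 1%:M =
    block_mx pa%:M 0 J (- pa^-1 *: (J *m O)).
  rewrite mulmx_block !mulmx0 !mul0mx !mulmx1 !addr0 mul_scalar_mx scalerA mulrN.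
  by rewrite divff // scaleN1r addNr -scalemxAr.
rewrite det_mulmx det_ublock det1 mulr1.
move: e => /(congr1 determinant); rewrite det_mulmx det_ublock !det1 !mulr1 => ->.
rewrite det_lblock det_scalar detZ.
have -> : J *m O = \matrix_(k < K, l < K) OO k.+1 l.
  apply/matrixP => i j; rewrite !mxE (bigD1 (lift ord0 i)) //= big1.
    by rewrite !mxE eqxx mul1r addr0 /bump.
  by move=> k /negbTE k0; rewrite !mxE k0 mul0r.
rewrite (exprNn pa^-1) exprVn exprS; field; exact: expf_neq0.
Qed.

End Hankel.

(** * Change of weight, and polynomials of Krawtchouk type *)

Section Shift.
Variables (F : numFieldType) (z : F) (n : nat).
Hypothesis zE : z ^+ 2 = z - 1.

(** On the nodes pa + t is -k/3, and k C(n+1, k) = (n+1) C(n, k-1).  This removes one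
    factor u from the weight and one factor v = u / z from the reversed weight; the
    shift of k moves the nodes by 1/6. *)
Lemma bfun_christoffel x f :
  bfun z n.+1 x (fun t => (pa F n.+1 + t) * f t) =
  - (n.+1%:R * uz z / 3) * bfun z n (x / z) (fun t => f (t - 1 / 6)).
Proof.
have z0 := z_neq0 zE.
have nk k : pa F n.+1 + bnode F n.+1 k = - (k%:R / 3).
  by rewrite /pa /bnode; field.
have nS k : bnode F n.+1 k.+1 = bnode F n k - 1 / 6.
  by rewrite /bnode -!natr1; field.
rewrite /bfun mulrDr; congr (_ + _).
  rewrite big_ord_recl nk mul0r oppr0 mul0r mulr0 add0r mulr_sumr.
  apply: eq_bigr => k _; rewrite /= /bump /= add1n nk nS.
  have e : (n.+1%:R * 'C(n, k)%:R = k.+1%:R * 'C(n.+1, k.+1)%:R :> F).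
    by rewrite -!natrM mul_bin_diag.
  rewrite /bwt subSS.
  transitivity (- (1 / 3) * (k.+1%:R * 'C(n.+1, k.+1)%:R) * uz z ^+ k.+1 * vz z ^+ (n - k) * f (bnode F n k - 1 / 6)).
    by field.
  by rewrite -e exprS; field.
rewrite big_ord_recl nk mul0r oppr0 mul0r mulr0 add0r !mulr_sumr.
apply: eq_bigr => k _; rewrite /= /bump /= add1n nk nS subSS.
have kn : (k <= n)%N by rewrite -ltnS.
have e : (n.+1%:R * 'C(n, n - k)%:R = k.+1%:R * 'C(n.+1, n - k)%:R :> F).
  rewrite -!natrM bin_sub // mul_bin_diag; congr (_ * _)%:R.
  by rewrite -(bin_sub (n := n.+1) (m := k.+1)) // subSS.
rewrite /bwt subKn // subSn ?leq_subr // subKn // uzE.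
transitivity (- (1 / 3) * x * (k.+1%:R * 'C(n.+1, n - k)%:R) * (z * vz z) ^+ (n - k) * vz z ^+ k.+1 * f (bnode F n k - 1 / 6)).
  by field.
by rewrite -e [vz z ^+ k.+1]exprS; field.
Qed.

Lemma hankc_christoffel x a :
  hankc z n.+1 x a = (- (n.+1%:R * uz z / 3)) ^+ a * hank z n (x / z) a.
Proof.
pose p i : {poly F} := ('X - (1 / 6)%:P) ^+ i.
have mp : monic_seq p.
  move=> i; split; first by rewrite monic_exp ?monicXsubC.
  by rewrite size_exp_XsubC.
rewrite /hankc.
have -> : \matrix_(i < a, j < a) bfun z n.+1 x (fun t => (pa F n.+1 + t) * (t ^+ i * t ^+ j)) =
  (- (n.+1%:R * uz z / 3)) *: \matrix_(i < a, j < a) fsum n.+1 (bw z n (x / z)) (bnode F n)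
    (fun t => (p i).[t] * (p j).[t]).
  apply/matrixP => i j; rewrite !mxE bfun_christoffel; congr (_ * _).
  rewrite bfun_fsum; apply: eq_bigr => k _.
  by rewrite /p !horner_exp !hornerE.
rewrite detZ det_gram_monic //; congr (_ * \det _).
by apply/matrixP => i j; rewrite !mxE bfun_fsum.
Qed.

End Shift.

Lemma coef_exp_linear (R : comNzRingType) (c d : R) n i :
  ((c%:P + d *: 'X) ^+ n)`_i = 'C(n, i)%:R * c ^+ (n - i) * d ^+ i.
Proof.
rewrite exprDn coef_sum.
under eq_bigr => j _ do rewrite exprZn -rmorphXn /= coefMn -scalerAr coefZ coefMXn.
have e (j : nat) : (if (i < j)%N then 0 else (c ^+ (n - j))%:P`_(i - j)) =
   (i == j)%:R * c ^+ (n - j).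
  rewrite coefC subn_eq0; case: ltngtP => //= h; rewrite ?mul0r ?mul1r //.
case: (ltnP i n.+1) => hi.
  rewrite (bigD1 (Ordinal hi)) //= big1 ?addr0.
    by rewrite e eqxx mul1r -mulr_natl; ring.
  move=> j ji; have /negbTE ij : i != j by rewrite eq_sym.
  by rewrite e ij mul0r mulr0 mul0rn.
rewrite big1 ?bin_small ?mul0r // => j _.
by rewrite e gtn_eqF ?mul0r ?mulr0 ?mul0rn // (leq_ltn_trans _ hi) // -ltnS.
Qed.

Lemma deriv_linear_exp (R : comNzRingType) (c : R) N :
  (1 + c *: 'X) * ((1 + c *: 'X) ^+ N)^`() = (N%:R * c) *: (1 + c *: 'X) ^+ N.
Proof.
rewrite deriv_exp derivD derivC derivZ derivX add0r.
case: N => [|N]; first by rewrite mulr0n mulr0 mul0r scale0r.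
rewrite /= exprS -[_ *+ N.+1]mulr_natl -!mul_polyC !rmorphM /= rmorph_nat; ring.
Qed.

Section Krawtchouk.
Variables (F : numFieldType) (z : F).
Hypothesis zE : z ^+ 2 = z - 1.

(** With M = N + k fixed, the coefficient of X^i is a polynomial of degree i in k. *)
Definition kgen N k : {poly F} := (1 + (z - 1) *: 'X) ^+ N * (1 + (- z) *: 'X) ^+ k.

Lemma kgen_deriv N k :
  (1 - 'X + 'X ^+ 2) * (kgen N k)^`() =
  ((N%:R * (z - 1) - k%:R * z)%:P + (N + k)%:R *: 'X) * kgen N k.
Proof.
have zP : z%:P ^+ 2 = z%:P - 1 :> {poly F}.
  by rewrite -rmorphXn zE rmorphB rmorph1.
have e1 := deriv_linear_exp (z - 1) N; have e2 := deriv_linear_exp (- z) k.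
rewrite /kgen derivM.
have -> : 1 - 'X + 'X ^+ 2 = (1 + (z - 1) *: 'X) * (1 + (- z) *: 'X) :> {poly F}.
  rewrite -!mul_polyC rmorphB rmorphN rmorph1.
  transitivity (1 - 'X - (z%:P ^+ 2 - z%:P) * 'X ^+ 2 : {poly F}); last by ring.
  by rewrite zP; ring.
move: e1 e2; set A := _ ^+ N; set B := _ ^+ k.
set A' := A^`(); set B' := B^`(); set a := 1 + _; set b := 1 + _ => e1 e2.
transitivity (a * A' * (b * B) + a * A * (b * B')); first by ring.
rewrite e1 e2 /a /b -!mul_polyC !rmorphM /= !rmorphB !rmorphN /= !rmorphM /= !rmorphB rmorph1 !rmorph_nat natrD.
transitivity (((N%:R * (z%:P - 1) - k%:R * z%:P) + (N%:R + k%:R) * (- (z%:P ^+ 2 - z%:P)) * 'X) * (A * B) : {poly F}).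
  by ring.
by rewrite zP; ring.
Qed.

Definition kcoef N k i := (kgen N k)`_i.

Lemma kcoef0 N k : kcoef N k 0 = 1.
Proof.
rewrite /kcoef -horner_coef0 /kgen hornerM !horner_exp !hornerE.
by rewrite !expr1n mulr1.
Qed.

(** Comparing coefficients in the differential equation of the generating function;
    the quadratic factor is 1 - X + X^2 because z (1 - z) = 1. *)
Lemma kcoef_rec N k i :
  i.+2%:R * kcoef N k i.+2 =
  (i.+1%:R + (N%:R * (z - 1) - k%:R * z)) * kcoef N k i.+1
  + ((N + k)%:R - i%:R) * kcoef N k i.
Proof.
have e := congr1 (fun p : {poly F} => p`_i.+1) (kgen_deriv N k).
move: e; set D := (kgen N k)^`(); set P := kgen N k => e.
have l : ((1 - 'X + 'X ^+ 2) * D)`_i.+1 = D`_i.+1 - D`_i + ('X * ('X * D))`_i.+1.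
  have -> : (1 - 'X + 'X ^+ 2) * D = D - 'X * D + 'X * ('X * D) by ring.
  by rewrite coefD coefB (coefXM D).
have r c d : ((c%:P + d *: 'X) * P)`_i.+1 = c * P`_i.+1 + d * P`_i.
  by rewrite mulrDl coefD coefCM -scalerAl coefZ coefXM.
rewrite l r coefXM /= coefXM !coef_deriv /= in e.
rewrite /kcoef -/P.
have {}e : P`_i.+2 *+ i.+2 = (N%:R * (z - 1) - k%:R * z) * P`_i.+1 + (N + k)%:R * P`_i
   + P`_i.+1 *+ i.+1 - P`_i *+ i.
  rewrite -e; case: (i) => [|i'] /=; rewrite ?mulr0n; ring.
rewrite mulr_natl e -mulr_natl -[P`_i *+ i]mulr_natl; ring.
Qed.

Lemma kcoef1 N k : kcoef N k 1 = N%:R * (z - 1) - k%:R * z.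
Proof.
have e := congr1 (fun p : {poly F} => p`_0) (kgen_deriv N k).
have := kcoef0 N k; rewrite /kcoef.
move: e; set D := (kgen N k)^`(); set P := kgen N k => e P0.
have l : ((1 - 'X + 'X ^+ 2) * D)`_0 = D`_0.
  have -> : (1 - 'X + 'X ^+ 2) * D = D - 'X * D + 'X * ('X * D) by ring.
  by rewrite coefD coefB (coefXM D) coefXM subr0 addr0.
have r c d : ((c%:P + d *: 'X) * P)`_0 = c * P`_0.
  by rewrite mulrDl coefD coefCM -scalerAl coefZ coefXM mulr0 addr0.
by rewrite l r coef_deriv P0 mulr1 in e.
Qed.

(** The sum over k of the products of two generating functions is an n-th power, by
    the binomial theorem; X and Y are the inner and the outer variable. *)
Lemma kgen_gram n (A B : F) i j :
  \sum_(k < n.+1) 'C(n, k)%:R * A ^+ (n - k) * B ^+ k * (kcoef (n - k) k i * kcoef (n - k) k j) =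
  (((A *: (1 + (z - 1) *: 'X) + B *: (1 + (- z) *: 'X))%:P +
    (A * (z - 1) *: (1 + (z - 1) *: 'X) - B * z *: (1 + (- z) *: 'X)) *: 'X : {poly {poly F}}) ^+ n)`_i`_j.
Proof.
pose a : {poly F} := 1 + (z - 1) *: 'X; pose b : {poly F} := 1 + (- z) *: 'X.
pose a' : {poly {poly F}} := 1 + (z - 1)%:P *: 'X.
pose b' : {poly {poly F}} := 1 + (- z)%:P *: 'X.
rewrite (_ : _ + _ *: 'X = (A *: a)%:P * a' + (B *: b)%:P * b'); last first.
  rewrite /a' /b' -/a -/b -!mul_polyC !rmorphB !rmorphN rmorph1 /= rmorphM /= [(_ * a)%:P]rmorphM /=.
  by rewrite ?rmorphM ?rmorphB ?rmorphN /=; ring.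
rewrite exprDn !coef_sum; apply: eq_bigr => k _.
have kg : map_poly polyC (kgen (n - k) k) = a' ^+ (n - k) * b' ^+ k.
  rewrite /kgen rmorphM !rmorphXn /= !rmorphD /= !rmorph1 /=.
  by rewrite !map_polyZ /= map_polyX.
rewrite !exprMn -!rmorphXn /= mulrACA -rmorphM /= -kg !exprZn -scalerAl -scalerAr -/(kgen (n - k) k).
rewrite coefMn coefCM coef_map /= coefMn -scalerAl coefZ -scalerAl coefZ.
rewrite coefMC -/(kcoef _ _ i) -/(kcoef _ _ j) -mulr_natl.
ring.
Qed.

End Krawtchouk.

Lemma lin_comb (R : comNzRingType) (A B c d : R) :
  A *: (1 + c *: 'X) + B *: (1 + d *: 'X) = (A + B)%:P + (A * c + B * d) *: 'X.
Proof.
rewrite !scalerDr !scalerA addrACA -!scalerDl alg_polyC //.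
Qed.

Section KGram.
Variables (F : numFieldType) (z : F) (n : nat).
Hypothesis zE : z ^+ 2 = z - 1.

Lemma kgram1 i j :
  \sum_(k < n.+1) bwt z n k * (kcoef z (n - k) k i * kcoef z (n - k) k j) =
  (i == j)%:R * ((-1) ^+ i * 'C(n, i)%:R).
Proof.
have z1 := z1_neq0 zE.
transitivity (\sum_(k < n.+1) 'C(n, k)%:R * vz z ^+ (n - k) * uz z ^+ k * (kcoef z (n - k) k i * kcoef z (n - k) k j)).
  by apply: eq_bigr => k _; rewrite /bwt; ring.
rewrite kgen_gram.
set p := (X in X%:P); set q := (X in _ + X *: _).
have e0 : vz z * (z - 1) - uz z * z = 0.
  rewrite uzE; transitivity (vz z * (z - 1 - z ^+ 2)); first by ring.
  by rewrite zE subrr mulr0.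
have -> : p = 1%:P.
  by rewrite /p lin_comb mulrN e0 scale0r addr0 addrC uvD.
have e1 : vz z * (z - 1) * (z - 1) + - (uz z * z) * - z = -1.
  rewrite uzE; transitivity (vz z * ((z ^+ 2 - (2 * z - 1)) + z ^+ 3)); first by ring.
  by rewrite z3 // zE /vz; field.
have -> : q = (-1) *: 'X.
  by rewrite /q -scaleNr lin_comb e0 e1 polyC0 add0r.
rewrite coef_exp_linear expr1n mulr1 exprZn mulr_natl coefMn coefZ coefXn -mulr_natl eq_sym.
by ring.
Qed.

(** For the reversed weight the n-th power is (1 - X - Y)^n. *)
Lemma kgram2 i j :
  \sum_(k < n.+1) bwt z n (n - k) * (kcoef z (n - k) k i * kcoef z (n - k) k j) =
  (-1) ^+ i * 'C(n, i)%:R * ((-1) ^+ j * 'C(n - i, j)%:R).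
Proof.
have z1 := z1_neq0 zE.
transitivity (\sum_(k < n.+1) 'C(n, k)%:R * uz z ^+ (n - k) * vz z ^+ k * (kcoef z (n - k) k i * kcoef z (n - k) k j)).
  apply: eq_bigr => k _; rewrite /bwt.
  have kn : (k <= n)%N by rewrite -ltnS.
  by rewrite subKn // bin_sub.
rewrite kgen_gram.
set p := (X in X%:P); set q := (X in _ + X *: _).
have e0 : uz z * (z - 1) - vz z * z = -1.
  rewrite uzE; transitivity (vz z * (z ^+ 2 - 2 * z)); first by ring.
  by rewrite zE /vz; field.
have -> : p = 1%:P + (-1) *: 'X.
  by rewrite /p lin_comb mulrN e0 uvD.
have e1 : uz z * (z - 1) * (z - 1) + - (vz z * z) * - z = 0.
  rewrite uzE; transitivity (vz z * z * (z ^+ 2 - (z - 1))); first by ring.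
  by rewrite zE subrr mulr0.
have -> : q = -1.
  by rewrite /q -scaleNr lin_comb e0 e1 scale0r addr0 rmorphN1.
rewrite coef_exp_linear.
transitivity ((('C(n, i)%:R * (-1) ^+ i)%:P * (1%:P + (-1) *: 'X) ^+ (n - i) : {poly F})`_j).
  congr (_`_ j); rewrite rmorphM /= rmorphXn /= rmorphN1 rmorph_nat.
  by rewrite mulrAC.
rewrite coefCM coef_exp_linear expr1n.
by ring.
Qed.

(** The first coefficient of [kgen (n - k) k], as a polynomial in the node t_k. *)
Definition klin : {poly F} := (- (n%:R / 2))%:P + (3 * (2 * z - 1)) *: 'X.

(** The recursion of [kcoef_rec] has order two, hence the pairs. *)
Fixpoint kpolys i : {poly F} * {poly F} :=
  if i is i'.+1 then
    let pq := kpolys i' in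
    (pq.2, (i'.+2%:R)^-1 *: ((i'.+1%:R%:P + klin) * pq.2 + (n%:R - i'%:R) *: pq.1))
  else (1, klin).
Definition kpoly i := (kpolys i).1.

Lemma kpoly_rec i : kpoly i.+2 =
  (i.+2%:R)^-1 *: ((i.+1%:R%:P + klin) * kpoly i.+1 + (n%:R - i%:R) *: kpoly i).
Proof. by []. Qed.

Lemma nat_ind2 (P : nat -> Prop) :
  P 0 -> P 1 -> (forall i, P i -> P i.+1 -> P i.+2) -> forall i, P i.
Proof.
move=> P0 P1 PS i; suff : P i /\ P i.+1 by case.
by elim: i => [|i [h1 h2]]; split=> //; apply: PS.
Qed.

Lemma kpolyE i k : (k <= n)%N -> (kpoly i).[bnode F n k] = kcoef z (n - k) k i.
Proof.
move=> kn.
have kl : klin.[bnode F n k] = (n - k)%:R * (z - 1) - k%:R * z.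
  by rewrite /klin hornerD hornerC hornerZ hornerX /bnode natrB //; field.
elim/nat_ind2: i => [||i h1 h2].
- by rewrite kcoef0 /kpoly /= hornerE.
- by rewrite kcoef1 // /kpoly /= kl.
have i0 : i.+2%:R != 0 :> F by rewrite pnatr_eq0.
apply: (mulfI i0); rewrite kcoef_rec // kpoly_rec hornerZ hornerD hornerM hornerZ hornerD hornerC h1 h2 kl mulrA divff // mul1r.
by rewrite subnK //.
Qed.

Lemma size_klin : (size klin <= 2)%N.
Proof.
rewrite /klin (leq_trans (size_polyD _ _)) // geq_max (leq_trans (size_polyC_leq1 _)) //=.
by rewrite (leq_trans (size_scale_leq _ _)) // size_polyX.
Qed.

Lemma size_kpoly i : (size (kpoly i) <= i.+1)%N.
Proof.
elim/nat_ind2: i => [||i h1 h2]; rewrite ?size_poly1 ?size_klin //.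
rewrite kpoly_rec (leq_trans (size_scale_leq _ _)) //.
rewrite (leq_trans (size_polyD _ _)) // geq_max; apply/andP; split.
  rewrite (leq_trans (size_polyMleq _ _)) //.
  have : (size ((i.+1%:R)%:P + klin)%R <= 2)%N.
    rewrite (leq_trans (size_polyD _ _)) // geq_max size_klin andbT.
    by rewrite (leq_trans (size_polyC_leq1 _)).
  by move: h2; lia.
by rewrite (leq_trans (size_scale_leq _ _)) // (leq_trans h1) // leqW.
Qed.

Lemma lead_kpoly i : (kpoly i)`_i = (3 * (2 * z - 1)) ^+ i / i`!%:R.
Proof.
elim/nat_ind2: i => [||i h1 h2].
- by rewrite coef1 /= expr0 divr1.
- by rewrite /kpoly /= /klin coefD coefC coefZ coefX /= add0r mulr1 expr1 divr1.
rewrite kpoly_rec coefZ coefD coefZ.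
rewrite [(kpoly i)`_i.+2]nth_default ?mulr0 ?addr0; last first.
  by rewrite (leq_trans (size_kpoly i)).
rewrite /klin addrA -rmorphD /= mulrDl coefD coefCM nth_default ?mulr0 ?add0r; last first.
  exact: size_kpoly.
rewrite -scalerAl coefZ coefXM /= h2 [_ ^+ i.+2]exprS [in RHS]factS natrM.
by field; rewrite -natrD !pnatr_eq0 -lt0n fact_gt0.
Qed.

End KGram.

(** * The determinant at negative integers *)

(** The determinant of 1 + w C(m+i+j, j), with m replaced by a field element X. *)
Definition gdet (F : fieldType) (w : F) a (X : F) :=
  \det (\matrix_(i < a, j < a) ((i == j)%:R + w * (poch (X + 1 + i%:R) j / j`!%:R))).

Section GdetHank.
Variables (F : numFieldType) (z : F) (n : nat).
Hypothesis zE : z ^+ 2 = z - 1.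

Lemma poch_neg (N j : nat) : (poch (- N%:R) j : F) = (-1) ^+ j * (N ^_ j)%:R.
Proof.
elim: j => [|j IH]; first by rewrite poch0 ffactn0 mulr1.
rewrite pochS IH ffactnSr natrM exprS.
case: (ltnP N j) => h; first by rewrite ffact_small //; ring.
by rewrite natrB //; ring.
Qed.

Lemma poch_neg_fact (N j : nat) : poch (- N%:R) j / j`!%:R = (-1) ^+ j * 'C(N, j)%:R :> F.
Proof.
by rewrite poch_neg -bin_ffact natrM mulrA mulfK // pnatr_eq0 -lt0n fact_gt0.
Qed.

(** At X = -n-1 the matrix is, after multiplication of row i by (-1)^i C(n, i), the
    sum of the two Gram matrices of [kpoly]; their leading coefficients turn it into
    a Hankel determinant. *)
Lemma gdet_hank w a : (a <= n.+1)%N ->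
  gdet w a (- n.+1%:R) =
  \prod_(i < a) ((-27) ^+ i / (i`!%:R * poch (1 - n.+1%:R) i)) * hank z n w a.
Proof.
move=> an.
have g : \det (\matrix_(i < a, j < a) fsum n.+1 (bw z n w) (bnode F n)
     (fun t => (kpoly z n i).[t] * (kpoly z n j).[t])) =
   \prod_(i < a) ((-1) ^+ i * 'C(n, i)%:R) * gdet w a (- n.+1%:R).
  transitivity (\det (\matrix_(i < a, j < a) ((-1) ^+ i * 'C(n, i)%:R * 1 *
    (\matrix_(i < a, j < a) ((i == j)%:R + w * (poch (- n.+1%:R + 1 + i%:R) j / j`!%:R))) i j)) : F).
    congr (\det _); apply/matrixP => i j; rewrite !mxE /fsum.
    have inn : (i <= n)%N by rewrite -ltnS (leq_trans (ltn_ord i)).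
    transitivity (\sum_(k < n.+1) bwt z n k * (kcoef z (n - k) k i * kcoef z (n - k) k j) +
       w * \sum_(k < n.+1) bwt z n (n - k) * (kcoef z (n - k) k i * kcoef z (n - k) k j)).
      rewrite mulr_sumr -big_split; apply: eq_bigr => k _ /=.
      have kn : (k <= n)%N by rewrite -ltnS.
      by rewrite !kpolyE // /bw; ring.
    rewrite kgram1 // kgram2 //.
    have -> : - n.+1%:R + 1 + i%:R = - (n - i)%:R :> F.
      by rewrite natrB // -natr1; ring.
    rewrite poch_neg_fact.
    by rewrite -val_eqE; ring.
  rewrite (@det_scale _ a (fun i => (-1) ^+ i * 'C(n, i)%:R) (fun=> 1)).
  by rewrite [X in _ * X * _]big1 ?mulr1.
have z2 : (3 * (2 * z - 1)) ^+ 2 = -27.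
  transitivity (9 * (4 * z ^+ 2 - 4 * z + 1)); first by ring.
  by rewrite zE; ring.
rewrite det_gram in g; try exact: size_kpoly.
have c0 (i : 'I_a) : (-1) ^+ i * 'C(n, i)%:R != 0 :> F.
  rewrite mulf_neq0 ?expf_neq0 ?oppr_eq0 ?oner_eq0 // pnatr_eq0 -lt0n bin_gt0.
  by rewrite -ltnS (leq_trans (ltn_ord i)).
have p0 : \prod_(i < a) ((-1) ^+ i * 'C(n, i)%:R) != 0 :> F by apply/prodf_neq0 => i _.
apply: (mulfI p0); rewrite -g mulrA -!big_split /=; congr (_ * _).
  apply: eq_bigr => i _; rewrite !lead_kpoly //.
  have -> : 1 - n.+1%:R = - n%:R :> F by rewrite -natr1; ring.
  rewrite poch_neg -bin_ffact natrM -z2 exprAC expr2.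
  have f0 : i`!%:R != 0 :> F by rewrite pnatr_eq0 -lt0n fact_gt0.
  have b0 : 'C(n, i)%:R != 0 :> F.
    by rewrite pnatr_eq0 -lt0n bin_gt0 -ltnS (leq_trans (ltn_ord i)).
  have s0 : (-1) ^+ i != 0 :> F by rewrite signr_eq0.
  by field; rewrite f0 b0 s0.
by congr (\det _); apply/matrixP => i j; rewrite !mxE bfun_fsum.
Qed.

End GdetHank.

Lemma poch3 (F : numFieldType) (x : F) k :
  poch (x / 3) k * poch (x / 3 + 1 / 3) k * poch (x / 3 + 2 / 3) k = poch x (3 * k) / 27 ^+ k.
Proof.
elim: k => [|k IH]; first by rewrite muln0 !poch0 expr0 !mul1r invr1.
rewrite mulnS !addSn add0n !pochS exprS.
have n0 : (27 : F) ^+ k != 0 by rewrite expf_neq0 // pnatr_eq0.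
have -> : poch x (3 * k) = 27 ^+ k * (poch (x / 3) k * poch (x / 3 + 1 / 3) k * poch (x / 3 + 2 / 3) k).
  by rewrite IH; field.
have e1 : (3 * k).+1%:R = 3 * k%:R + 1 :> F by rewrite -natr1 natrM.
have e2 : (3 * k).+2%:R = 3 * k%:R + 2 :> F by rewrite -addn2 natrD natrM.
by rewrite e1 e2 natrM; field.
Qed.

Section Base.
Variables (F : numFieldType) (z : F) (n : nat).
Hypothesis zE : z ^+ 2 = z - 1.
Local Notation pa := (pa F n).
Local Notation pb := (pb F n).
Local Notation pc := (pc F n).

Lemma bwt_sum : \sum_(k < n.+1) bwt z n k = 1.
Proof.
rewrite -[RHS](expr1n _ n) -(uvD zE) addrC exprDn; apply: eq_bigr => k _.
by rewrite /bwt -mulr_natl; ring.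
Qed.

Lemma bwt_mean : \sum_(k < n.+1) bwt z n k * k%:R = n%:R * uz z.
Proof.
have := bsum_step n zE (fun=> 1).
set s := (X in _ = _ * X); set d := (X in X = _).
have -> : s = \sum_(k < n.+1) bwt z n k * k%:R by apply: eq_bigr => k _; rewrite mulr1.
have -> : d = n%:R - \sum_(k < n.+1) bwt z n k * k%:R.
  transitivity (\sum_(k < n.+1) (bwt z n k * n%:R - bwt z n k * k%:R)).
    by apply: eq_bigr => k _; rewrite mulr1 mulrBr.
  by rewrite sumrB -mulr_suml bwt_sum mul1r.
move: (\sum_(k < _) _) => m e.
have z0 := z_neq0 zE; have z1 := z1_neq0 zE.
have -> : n%:R = (1 + z^-1) * m by rewrite mulrDl -e; ring.
by rewrite /uz; field; rewrite z0 z1.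
Qed.

(** Reduces to the mean of the binomial weight. *)
Lemma odd_base : gramW z n (-1) id 0 0 = n%:R * (vz z - uz z) / 3.
Proof.
rewrite /gramW.
transitivity (bfun z n (-1) id); first by apply: eq_bfun => t; rewrite !ev0; ring.
rewrite bfunE.
transitivity (\sum_(k < n.+1) (n%:R / 3 * bwt z n k - 2 / 3 * (bwt z n k * k%:R))).
  by apply: eq_bigr => k _; rewrite /bnode; field.
rewrite sumrB -!mulr_sumr bwt_sum bwt_mean.
have -> : vz z = 1 - uz z by rewrite -(uvD zE); ring.
by field.
Qed.

Lemma even_base : gramW z n 1 (fun=> 1) 0 0 = 2.
Proof.
rewrite /gramW.
transitivity (bfun z n 1 (fun=> 1)); first by apply: eq_bfun => t; rewrite !ev0; ring.
rewrite bfunE -mulr_suml bwt_sum; ring.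
Qed.

(** The instance k = l = 0 of the Wilson recursion. *)
Lemma even_base1 : pa + pb + pc != 0 ->
  gramW z n 1 (fun=> 1) 1 0 = - ((pa + pb) * (pa + pc) * pa) * 2 / (pa + pb + pc).
Proof.
move=> s0; have := gramWl (wilson_case_even0 n zE) 0 0.
by rewrite !addr0 even_base => <-; field.
Qed.

Lemma even_base_sq : gramW z n 1 (fun t => t ^+ 2) 0 0 =
  gramW z n 1 (fun=> 1) 1 0 + pa ^+ 2 * gramW z n 1 (fun=> 1) 0 0.
Proof.
rewrite /gramW -bfunZ -bfunD; apply: eq_bfun => t.
by rewrite evS !ev0 addr0; ring.
Qed.

End Base.

Lemma prod_even_odd (R : comNzRingType) (K K' : nat) (h : nat -> R) :
  (K' <= K <= K'.+1)%N ->
  \prod_(i < K + K') h i = \prod_(k < K) h (2 * k)%N * \prod_(k < K') h (2 * k + 1)%N.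
Proof.
move=> KK; rewrite (reindex_inj (@eo_inj K K' KK)) big_split_ord /=.
congr (_ * _); apply: eq_bigr => k _; rewrite /= /eo_fun.
  by rewrite -[lshift _ _]/(unsplit (inl k)) unsplitK.
by rewrite -[rshift _ _]/(unsplit (inr k)) unsplitK.
Qed.

Section Wprod.
Variables (F : numFieldType) (c d : F).

Lemma wprodE k : wprod (c / 6) (c / 6 + 1 / 3) (c / 6 + 2 / 3) d k =
  k`!%:R * (poch (c + 1) (3 * k) / 27 ^+ k) * (poch (c / 2 + 3 * d) (3 * k) / 27 ^+ k) /
  (poch (c / 2 + 1 + d) (2 * k) * poch (c / 2 + 1 + d + k%:R - 1) k).
Proof.
rewrite /wprod.
have -> : c / 6 + (c / 6 + 1 / 3) = (c + 1) / 3 by field.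
have -> : c / 6 + (c / 6 + 2 / 3) = (c + 1) / 3 + 1 / 3 by field.
have -> : c / 6 + 1 / 3 + (c / 6 + 2 / 3) = (c + 1) / 3 + 2 / 3 by field.
have -> : c / 6 + d = (c / 2 + 3 * d) / 3 by field.
have -> : c / 6 + 1 / 3 + d = (c / 2 + 3 * d) / 3 + 1 / 3 by field.
have -> : c / 6 + 2 / 3 + d = (c / 2 + 3 * d) / 3 + 2 / 3 by field.
rewrite !poch3.
by have -> : (c + 1) / 3 + (c / 6 + 2 / 3) + d = c / 2 + 1 + d by field.
Qed.

Lemma wprodE1 k : wprod (c / 6 + 1) (c / 6 + 1 / 3) (c / 6 + 2 / 3) d k =
  k`!%:R * (poch (c + 3) (3 * k) / 27 ^+ k) * (poch (c / 2 + 1 + 3 * d) (3 * k) / 27 ^+ k) /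
  (poch (c / 2 + 2 + d) (2 * k) * poch (c / 2 + 2 + d + k%:R - 1) k).
Proof.
rewrite /wprod.
have -> : c / 6 + 1 + (c / 6 + 1 / 3) = (c + 3) / 3 + 1 / 3 by field.
have -> : c / 6 + 1 + (c / 6 + 2 / 3) = (c + 3) / 3 + 2 / 3 by field.
have -> : c / 6 + 1 / 3 + (c / 6 + 2 / 3) = (c + 3) / 3 by field.
have -> : c / 6 + 1 + d = (c / 2 + 1 + 3 * d) / 3 + 2 / 3 by field.
have -> : c / 6 + 1 / 3 + d = (c / 2 + 1 + 3 * d) / 3 by field.
have -> : c / 6 + 2 / 3 + d = (c / 2 + 1 + 3 * d) / 3 + 1 / 3 by field.
rewrite -!poch3.
have -> : (c + 3) / 3 + 1 / 3 + (c / 6 + 2 / 3) + d = c / 2 + 2 + d by field.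
by congr (_ / _); ring.
Qed.

End Wprod.

Section Closed.
Variables (F : numFieldType) (z : F) (n : nat).
Hypothesis zE : z ^+ 2 = z - 1.
Let X : F := - n.+1%:R.

Lemma paS : pa F n.+1 = X / 6. Proof. by rewrite /pa /X; field. Qed.

Lemma pbS : pb F n.+1 = X / 6 + 1 / 3. Proof. by rewrite /pb paS. Qed.

Lemma pcS : pc F n.+1 = X / 6 + 2 / 3. Proof. by rewrite /pc paS. Qed.

Lemma nzX : X != 0.
Proof. by rewrite oppr_eq0 pnatr_eq0. Qed.

Lemma nzX1 j : (j < n)%N -> X + 1 + j%:R != 0.
Proof.
move=> jn; rewrite /X -natr1 (_ : _ + _ = - (n - j)%:R).
  by rewrite oppr_eq0 pnatr_eq0 subn_eq0 -ltnNge.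
by rewrite natrB 1?ltnW //; ring.
Qed.

Lemma nzX2 j : (j.*2 < n.+1)%N -> X / 2 + j%:R != 0.
Proof.
move=> jn; rewrite /X (_ : _ + _ = - (n.+1 - j.*2)%:R / 2).
  by rewrite mulf_neq0 ?invr_eq0 ?oppr_eq0 ?pnatr_eq0 // subn_eq0 -ltnNge.
by rewrite natrB 1?ltnW // -[j.*2]mul2n natrM; field.
Qed.

Lemma nzX3 j : (j.*2.+1 < n.+1)%N -> X / 2 + 1 / 2 + j%:R != 0.
Proof.
move=> jn; rewrite /X (_ : _ + _ = - (n.+1 - j.*2.+1)%:R / 2).
  by rewrite mulf_neq0 ?invr_eq0 ?oppr_eq0 ?pnatr_eq0 // subn_eq0 -ltnNge.
by rewrite natrB 1?ltnW // -[j.*2.+1%:R]natr1 -mul2n natrM; field.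
Qed.

Lemma gdet_hankc w x a : (a <= n.+1)%N -> w * z = x ->
  gdet w a X = (3 / (X * uz z)) ^+ a *
  \prod_(i < a) ((-27) ^+ i / (i`!%:R * poch (X + 1) i)) * hankc z n.+1 x a.
Proof.
move=> an wz; rewrite (gdet_hank zE) // hankc_christoffel //.
have z0 := z_neq0 zE; have z1 := z1_neq0 zE.
have u0 : uz z != 0 by rewrite /uz mulf_neq0 ?invr_eq0.
have -> : x / z = w by rewrite -wz mulfK.
have -> : - (n.+1%:R * uz z / 3) = X * uz z / 3 by rewrite /X; ring.
rewrite -/X [1 + X]addrC; set P := \prod_(i < a) _; set H := hank _ _ _ _.
have e (Y u : F) : Y != 0 -> u != 0 -> 3 / (Y * u) * (Y * u / 3) = 1.
  by move=> Y0 u1; field; rewrite Y0 u1.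
transitivity ((3 / (X * uz z) * (X * uz z / 3)) ^+ a * (P * H)); last by rewrite exprMn; ring.
by rewrite e ?nzX // expr1n mul1r.
Qed.

End Closed.

(** * The factors of the evaluated determinant *)

Section Terms.
Variable F : numFieldType.
Implicit Types (X : F) (k : nat).

Definition third_num0 X k := k`!%:R * poch (X + 1 + (2 * k)%:R) k * poch (X / 2 + 3 / 2 + (2 * k)%:R) k.
Definition third_den0 X k := (2 * k)`!%:R * poch (X / 2 + 1 / 2 + k%:R) k.
Definition third_num1 X k := k`!%:R * poch (X + 2 + (2 * k)%:R) k.+1 * poch (X / 2 + 5 / 2 + (2 * k)%:R) k.
Definition third_den1 X k := (2 * k).+1`!%:R * poch (X / 2 + 3 / 2 + k%:R) k.

Lemma mul3n k : (3 * k = 2 * k + k)%N. Proof. lia. Qed.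

Lemma fact_neq0 k : k`!%:R != 0 :> F.
Proof. by rewrite pnatr_eq0 -lt0n fact_gt0. Qed.

Lemma exp27 k : (-27) ^+ (2 * k) = 27 ^+ k * 27 ^+ k :> F.
Proof. by rewrite exprM sqrrN expr2 exprMn. Qed.

Lemma exp27_neq0 k : (27 : F) ^+ k != 0.
Proof. by rewrite expf_neq0 // pnatr_eq0. Qed.

(** [third_term0] and [third_term1] simplify the k-th factors that come from
    [hankc_odd]: the even and the odd row factor of [gdet_hankc] times the factor
    [wprod] of the Wilson determinant. *)
Lemma third_term0 X k :
  poch (X + 1) (2 * k) != 0 -> poch (X / 2 + 3 / 2) (2 * k) != 0 ->
  poch (X / 2 + 1 / 2 + k%:R) k != 0 ->
  (-27) ^+ (2 * k) / ((2 * k)`!%:R * poch (X + 1) (2 * k)) *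
  wprod (X / 6) (X / 6 + 1 / 3) (X / 6 + 2 / 3) (1 / 2) k = third_num0 X k / third_den0 X k.
Proof.
move=> h1 h2 h3; rewrite wprodE exp27 /third_num0 /third_den0.
have -> : X / 2 + 3 * (1 / 2) = X / 2 + 3 / 2 by field.
have -> : X / 2 + 1 + 1 / 2 = X / 2 + 3 / 2 by field.
have -> : X / 2 + 3 / 2 + k%:R - 1 = X / 2 + 1 / 2 + k%:R by field.
rewrite mul3n !(pochD _ (2 * k)).
have f0 := exp27_neq0 k; have f1 := fact_neq0 (2 * k).
move: (27 ^+ k) f0 (poch _ _) h1 (poch _ _) h2 (poch _ _) h3 => c f0 p1 h1 p2 h2 p3 h3.
by field; rewrite f0 f1 h1 h2 h3.
Qed.

Lemma third_term1 X k :
  poch (X + 1) (2 * k).+1 != 0 -> poch (X / 2 + 5 / 2) (2 * k) != 0 ->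
  poch (X / 2 + 3 / 2 + k%:R) k != 0 ->
  (-27) ^+ (2 * k).+1 / ((2 * k).+1`!%:R * poch (X + 1) (2 * k).+1) *
  (- ((X + 1) * (X + 2) / 27) *
  wprod (X / 6 + 1) (X / 6 + 1 / 3) (X / 6 + 2 / 3) (1 / 2) k) = third_num1 X k / third_den1 X k.
Proof.
move=> h1 h2 h3; rewrite wprodE1 exprS exp27 /third_num1 /third_den1.
have -> : X / 2 + 1 + 3 * (1 / 2) = X / 2 + 5 / 2 by field.
have -> : X / 2 + 2 + 1 / 2 = X / 2 + 5 / 2 by field.
have -> : X / 2 + 5 / 2 + k%:R - 1 = X / 2 + 3 / 2 + k%:R by field.
have e : poch (X + 3) (3 * k) * ((X + 1) * (X + 2)) =
    poch (X + 1) (2 * k).+1 * poch (X + 2 + (2 * k)%:R) k.+1.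
  have -> : X + 2 + (2 * k)%:R = X + 1 + (2 * k).+1%:R by rewrite -natr1; ring.
  rewrite -pochD (_ : ((2 * k).+1 + k.+1 = (3 * k).+2)%N); last by lia.
  rewrite !pochSl; have -> : X + 1 + 1 = X + 2 by ring.
  by have -> : X + 2 + 1 = X + 3; ring.
have -> : poch (X / 2 + 5 / 2) (3 * k) = poch (X / 2 + 5 / 2) (2 * k) * poch (X / 2 + 5 / 2 + (2 * k)%:R) k.
  by rewrite -pochD mul3n.
have f0 := exp27_neq0 k; have f1 := fact_neq0 (2 * k).+1.
move: (27 ^+ k) f0 (poch _ (2 * k).+1) h1 (poch _ (2 * k)) h2 (poch _ k) h3 (poch _ (3 * k)) e (poch _ k) => c f0 p1 h1 p2 h2 p3 h3 q3 e s.
transitivity (k`!%:R * (q3 * ((X + 1) * (X + 2))) * s / ((2 * k).+1`!%:R * p1 * p3)).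
  by field; rewrite f0 f1 h1 h2 h3.
by rewrite e; field; rewrite f1 h1 h3.
Qed.

(** The factors for w = -1; here the parameters of the weight are (X+1)/6 + i/3. *)
Definition neg_num X k := k`!%:R * poch (X + 1) (3 * k).+1 * poch (X / 2 + 2 + (2 * k)%:R) k.
Definition neg_den X k := poch (X / 2 + 1 + k%:R) k.
Definition neg_den_fact X k := (2 * k)`!%:R * (2 * k).+1`!%:R * poch (X + 1) (2 * k) * poch (X + 1) (2 * k).+1.

Lemma neg_term X k :
  poch (X + 1) (2 * k) != 0 -> poch (X + 1) (2 * k).+1 != 0 ->
  poch (X / 2 + 2) (2 * k) != 0 -> poch (X / 2 + 1 + k%:R) k != 0 ->
  (-27) ^+ (2 * k) / ((2 * k)`!%:R * poch (X + 1) (2 * k)) *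
  ((-27) ^+ (2 * k).+1 / ((2 * k).+1`!%:R * poch (X + 1) (2 * k).+1)) *
  (- ((X + 1) ^+ 2 / 27) *
  wprod ((X + 1) / 6) ((X + 1) / 6 + 1 / 3) ((X + 1) / 6 + 2 / 3) (1 / 2) k ^+ 2) * (-1) =
  - (neg_num X k / neg_den X k) ^+ 2 / neg_den_fact X k.
Proof.
move=> h1 h1' h2 h3; rewrite wprodE exprS exp27 /neg_num /neg_den /neg_den_fact.
have -> : (X + 1) / 2 + 3 * (1 / 2) = X / 2 + 2 by field.
have -> : (X + 1) / 2 + 1 + 1 / 2 = X / 2 + 2 by field.
have -> : X / 2 + 2 + k%:R - 1 = X / 2 + 1 + k%:R by field.
rewrite [poch (X + 1) (3 * k).+1]pochSl.
have -> : poch (X / 2 + 2) (3 * k) = poch (X / 2 + 2) (2 * k) * poch (X / 2 + 2 + (2 * k)%:R) k.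
  by rewrite -pochD mul3n.
have f0 := exp27_neq0 k; have f1 := fact_neq0 (2 * k).+1; have f2 := fact_neq0 (2 * k).
move: (27 ^+ k) f0 (poch _ (2 * k).+1) h1' (poch _ (2 * k)) h1 (poch _ (2 * k)) h2 (poch _ k) h3 (poch _ (3 * k)) (poch _ k) => c f0 p1 h1 p2 h2 p3 h3 p4 h4 q s.
by field; rewrite f0 f1 f2 h1 h2 h3 h4.
Qed.

Definition sixth_num0 X k := k`!%:R * poch (X + 1 + (2 * k)%:R) k * poch (X / 2 + 1 + (2 * k)%:R) k.
Definition sixth_den0 X k := (2 * k)`!%:R * poch (X / 2 + 1 + k%:R) k.
Definition sixth_num1 X k := 1 / 3 * k`!%:R * poch (X + 2 + (2 * k)%:R) k.+1 * poch (X / 2 + 2 + (2 * k)%:R) k.+1.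
Definition sixth_den1 X k := (2 * k).+1`!%:R * poch (X / 2 + 1 + k%:R) k.+1.

End Terms.

Lemma nat_e1 k : ((2 * k).+1 + k.+1 = (3 * k).+2)%N. Proof. lia. Qed.

Lemma nat_e2 k : (2 * k + k.+1 = (3 * k).+1)%N. Proof. lia. Qed.

Lemma nat_e3 k : (3 * k.+1 = (2 * k).+2 + k.+1)%N. Proof. lia. Qed.

Lemma nat_e4 k : ((2 * k).+2 + k.+1 = (3 * k).+3)%N. Proof. lia. Qed.

Lemma nat_e5 k : (3 * k.+1 = ((2 * k).+1 + k.+1).+1)%N. Proof. lia. Qed.

Section Terms.
Variable F : numFieldType.
Implicit Types (X : F) (k : nat).

(** The values of the starting pairings at parameters X/6 + i/3: of [EE 1 0], of
    [OO 0 0], and of [OO 1 0]. *)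
Definition even_value1 X : F := - ((X + 1) / 3 * ((X + 2) / 3) * (X / 6)) * 2 / (X / 2 + 1).
Definition even_value_sq X : F := even_value1 X + (X / 6) ^+ 2 * 2.
Definition even_value_sq1 X : F := - ((X + 1) / 3 * ((X + 2) / 3) * (X / 6 + 1)) * even_value_sq X / (X / 2 + 2).

Lemma sixth_term_pair X k :
  X != 0 -> X + 1 != 0 -> X + 2 != 0 -> X / 2 + 1 != 0 -> X / 2 + 2 != 0 ->
  X / 2 + 1 + (2 * k)%:R != 0 ->
  poch (X + 1) (2 * k) != 0 -> poch (X + 1) (2 * k).+1 != 0 ->
  poch (X / 2 + 2) (2 * k) != 0 -> poch (X / 2 + 1 + k%:R) k != 0 ->
  (-27) ^+ (2 * k) / ((2 * k)`!%:R * poch (X + 1) (2 * k)) *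
  ((-27) ^+ (2 * k).+1 / ((2 * k).+1`!%:R * poch (X + 1) (2 * k).+1)) *
  (9 / X ^+ 2 * (-1) * (even_value_sq X * wprod (X / 6) (X / 6 + 1 / 3) (X / 6 + 2 / 3) 1 k) *
   (even_value1 X * wprod (X / 6 + 1) (X / 6 + 1 / 3) (X / 6 + 2 / 3) 0 k)) =
  sixth_num0 X k / sixth_den0 X k * (sixth_num1 X k / sixth_den1 X k).
Proof.
move=> X0 X1 X2 x1 x2 y0 h1 h1' h2 h3.
rewrite wprodE wprodE1 exprS exp27 /sixth_num0 /sixth_den0 /sixth_num1 /sixth_den1.
have -> : X / 2 + 3 * 1 = X / 2 + 3 by field.
have -> : X / 2 + 1 + 1 = X / 2 + 2 by field.
have -> : X / 2 + 1 + 3 * 0 = X / 2 + 1 by field.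
have -> : X / 2 + 2 + 0 = X / 2 + 2 by field.
have -> : X / 2 + 2 + k%:R - 1 = X / 2 + 1 + k%:R by field.
have e2 : poch (X + 3) (3 * k) =
    poch (X + 1) (2 * k).+1 * poch (X + 2 + (2 * k)%:R) k.+1 / ((X + 1) * (X + 2)).
  apply: (canRL (mulfK (mulf_neq0 X1 X2))).
  have -> : X + 2 + (2 * k)%:R = X + 1 + (2 * k).+1%:R by rewrite -natr1; ring.
  rewrite -pochD nat_e1.
  rewrite !pochSl; have -> : X + 1 + 1 = X + 2 by ring.
  by have -> : X + 2 + 1 = X + 3; ring.
have e3 : poch (X / 2 + 3) (3 * k) =
    poch (X / 2 + 2) (2 * k) * poch (X / 2 + 2 + (2 * k)%:R) k.+1 / (X / 2 + 2).
  apply: (canRL (mulfK x2)).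
  rewrite -pochD nat_e2.
  by rewrite pochSl mulrC; congr (_ * poch _ _); ring.
have e4 : poch (X / 2 + 1) (3 * k) =
    (X / 2 + 1) * poch (X / 2 + 2) (2 * k) * poch (X / 2 + 1 + (2 * k)%:R) k / (X / 2 + 1 + (2 * k)%:R).
  rewrite mul3n pochD; apply: (canRL (mulfK y0)); rewrite mulrAC; congr (_ * _).
  by rewrite -pochS pochSl; congr (_ * poch _ _); ring.
have e1 : poch (X + 1) (3 * k) = poch (X + 1) (2 * k) * poch (X + 1 + (2 * k)%:R) k.
  by rewrite -pochD mul3n.
have e5 : poch (X / 2 + 1 + k%:R) k.+1 = poch (X / 2 + 1 + k%:R) k * (X / 2 + 1 + (2 * k)%:R).
  by rewrite pochS mul2n -addnn natrD addrA.
rewrite e1 e2 e3 e4 e5 /even_value_sq /even_value1.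
have f0 := exp27_neq0 F k; have f1 := fact_neq0 F (2 * k).+1; have f2 := fact_neq0 F (2 * k).
move: (27 ^+ k) f0 (poch (X / 2 + 1 + k%:R) k) h3 (poch _ (2 * k).+1) h1' => c f0 p4 h4 p1 h1'.
move: (poch (X + 1) (2 * k)) h1 (poch (X / 2 + 2) (2 * k)) h2 => p2 h1 p3 h2.
move: (poch _ k) (poch _ k.+1) (poch _ k.+1) (poch _ k) => q1 q2 q3 q4.
move: (2 * k)`!%:R f2 (2 * k).+1`!%:R f1 k`!%:R (2 * k)%:R y0 => a1 f2 a2 f1 a3 b y0.
have x1' : 2 + X != 0 by rewrite addrC.
have x2' : X + 4 != 0.
  have -> : X + 4 = (X / 2 + 2) * 2 by field.
  by rewrite mulf_neq0 // pnatr_eq0.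
have y0' : X + 2 + 2 * b != 0.
  have -> : X + 2 + 2 * b = (X / 2 + 1 + b) * 2 by field.
  by rewrite mulf_neq0 // pnatr_eq0.
have {}y0 : X + 2 + b * 2 != 0 by rewrite [b * 2]mulrC.
by field; rewrite y0 h1 h1' h2 h4 f0 f1 f2 X0 X1 X2 x2'.
Qed.

Lemma sixth_term_shifted_pair X k :
  X != 0 -> X + 1 != 0 -> X + 2 != 0 -> X / 2 + 1 != 0 -> X / 2 + 2 != 0 -> X / 2 + 3 != 0 ->
  X / 2 + 2 + (2 * k)%:R != 0 ->
  poch (X + 1) (2 * k).+2 != 0 -> poch (X + 1) (2 * k).+1 != 0 ->
  poch (X / 2 + 1) (2 * k).+1 != 0 -> poch (X / 2 + 1 + k%:R) k.+1 != 0 ->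
  poch (X / 2 + 2 + k%:R) k != 0 ->
  (-27) ^+ (2 * k).+2 / ((2 * k).+2`!%:R * poch (X + 1) (2 * k).+2) *
  wprod (X / 6) (X / 6 + 1 / 3) (X / 6 + 2 / 3) 0 k.+1 *
  ((-27) ^+ (2 * k).+1 / ((2 * k).+1`!%:R * poch (X + 1) (2 * k).+1) *
  (- (18 / X ^+ 2) * (even_value_sq1 X * wprod (X / 6 + 1) (X / 6 + 1 / 3) (X / 6 + 2 / 3) 1 k))) =
  sixth_num0 X k.+1 / sixth_den0 X k.+1 * (sixth_num1 X k / sixth_den1 X k).
Proof.
move=> X0 X1 X2 x1 x2 x3 y0 h1 h2 h3 h4 h5.
have e27 : (-27) ^+ (2 * k).+1 = -27 * (27 ^+ k * 27 ^+ k) :> F by rewrite exprS exp27.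
have e27' : (-27) ^+ (2 * k).+2 = 27 * 27 * (27 ^+ k * 27 ^+ k) :> F by rewrite exprS e27; ring.
rewrite wprodE wprodE1 e27 e27' /sixth_num0 /sixth_den0 /sixth_num1 /sixth_den1.
have -> : (2 * k.+1 = (2 * k).+2)%N by rewrite mulnS.
have -> : X / 2 + 3 * 0 = X / 2 by field.
have -> : X / 2 + 1 + 0 = X / 2 + 1 by field.
have -> : X / 2 + 1 + k.+1%:R - 1 = X / 2 + 1 + k%:R by rewrite -natr1; ring.
have -> : X / 2 + 1 + k.+1%:R = X / 2 + 2 + k%:R by rewrite -natr1; ring.
have -> : X / 2 + 1 + 3 * 1 = X / 2 + 4 by field.
have -> : X / 2 + 2 + 1 = X / 2 + 3 by field.
have -> : X / 2 + 3 + k%:R - 1 = X / 2 + 2 + k%:R by field.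
have e1 : poch (X + 1) (3 * k.+1) = poch (X + 1) (2 * k).+2 * poch (X + 1 + (2 * k).+2%:R) k.+1.
  by rewrite -pochD -nat_e3.
have e2 : poch (X + 3) (3 * k) =
    poch (X + 1) (2 * k).+1 * poch (X + 2 + (2 * k)%:R) k.+1 / ((X + 1) * (X + 2)).
  apply: (canRL (mulfK (mulf_neq0 X1 X2))).
  have -> : X + 2 + (2 * k)%:R = X + 1 + (2 * k).+1%:R by rewrite -natr1; ring.
  rewrite -pochD nat_e1.
  rewrite !pochSl; have -> : X + 1 + 1 = X + 2 by ring.
  by have -> : X + 2 + 1 = X + 3; ring.
have e3 : poch (X / 2) (3 * k.+1) = X / 2 * poch (X / 2 + 1) (2 * k).+1 * poch (X / 2 + 2 + (2 * k)%:R) k.+1.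
  have -> : X / 2 + 2 + (2 * k)%:R = X / 2 + 1 + (2 * k).+1%:R by rewrite -natr1; ring.
  by rewrite -mulrA -pochD -pochSl -nat_e5.
have e4 : poch (X / 2 + 1) (2 * k).+2 = poch (X / 2 + 1) (2 * k).+1 * (X / 2 + 2 + (2 * k)%:R).
  by rewrite pochS; congr (_ * _); rewrite -natr1; ring.
have e0 j : poch (X / 2 + 3) j * ((X / 2 + 1) * (X / 2 + 2)) = poch (X / 2 + 1) j.+2.
  rewrite !pochSl; have -> : X / 2 + 1 + 1 = X / 2 + 2 by ring.
  by have -> : X / 2 + 2 + 1 = X / 2 + 3; ring.
have e5 : poch (X / 2 + 4) (3 * k) = poch (X / 2 + 1) (2 * k).+1 * (X / 2 + 2 + (2 * k)%:R) *
   poch (X / 2 + 1 + (2 * k).+2%:R) k.+1 / ((X / 2 + 1) * (X / 2 + 2) * (X / 2 + 3)).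
  rewrite -e4; apply: (canRL (mulfK (mulf_neq0 (mulf_neq0 x1 x2) x3))).
  rewrite -pochD nat_e4.
  rewrite -e0 pochSl; have -> : X / 2 + 3 + 1 = X / 2 + 4 by ring.
  ring.
have e6 : poch (X / 2 + 3) (2 * k) = poch (X / 2 + 1) (2 * k).+1 * (X / 2 + 2 + (2 * k)%:R) /
    ((X / 2 + 1) * (X / 2 + 2)).
  by rewrite -e4; apply: (canRL (mulfK (mulf_neq0 x1 x2))).
have e7 : poch (X / 2 + 2 + k%:R) k.+1 = poch (X / 2 + 2 + k%:R) k * (X / 2 + 2 + (2 * k)%:R).
  by rewrite pochS; congr (_ * _); rewrite natrM; ring.
rewrite e1 e2 e3 e4 e5 e6 e7 /even_value_sq1 /even_value_sq /even_value1 [27 ^+ k.+1]exprS.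
have f0 := exp27_neq0 F k; have f1 := fact_neq0 F (2 * k).+1; have f2 := fact_neq0 F (2 * k).+2.
move: (27 ^+ k) f0 (poch (X / 2 + 1 + k%:R) k.+1) h4 (poch (X / 2 + 2 + k%:R) k) h5 => c f0 p4 h4 p5 h5.
move: (poch (X + 1) (2 * k).+2) h1 (poch (X / 2 + 1) (2 * k).+1) h3 (poch (X + 1) (2 * k).+1) h2 => p1 h1 p3 h3 p2 h2.
move: (poch _ k.+1) (poch _ k.+1) (poch _ k.+1) (poch _ k.+1) => q1 q2 q3 q4.
move: (2 * k).+2`!%:R f2 (2 * k).+1`!%:R f1 k`!%:R k.+1`!%:R (2 * k)%:R y0 => a1 f2 a2 f1 a3 a4 b y0.
have m2 (a : F) : a != 0 -> a * 2 != 0 by move=> a0; rewrite mulf_neq0 // pnatr_eq0.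
have x2' : X + 4 != 0.
  have -> : X + 4 = (X / 2 + 2) * 2 by field.
  exact: m2.
have x3' : X + 6 != 0.
  have -> : X + 6 = (X / 2 + 3) * 2 by field.
  exact: m2.
have y0' : X + 4 + b * 2 != 0.
  have -> : X + 4 + b * 2 = (X / 2 + 2 + b) * 2 by field.
  exact: m2.
by field; rewrite y0' h1 h2 h3 h4 h5 f0 f1 f2 X0 X1 X2 x2' x3'.
Qed.
End Terms.

(** * Evaluation at negative integers *)

Lemma uphalf_split a : (a = uphalf a + a./2)%N.
Proof. by rewrite uphalf_half -addnA addnn odd_double_half. Qed.

Lemma uphalf_bounds a : (a./2 <= uphalf a <= (a./2).+1)%N.
Proof. rewrite uphalf_half; case: odd; rewrite ?leqnn ?leqnSn //. Qed.

Section Neg.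
Variables (F : numFieldType) (z : F) (n : nat).
Hypothesis zE : z ^+ 2 = z - 1.
Local Notation X := (- n.+1%:R : F).

Lemma nz_pochX1 k : (k <= n)%N -> poch (X + 1) k != 0.
Proof.
by move=> kn; apply: poch_neq0 => i ik; apply: nzX1; apply: leq_trans kn.
Qed.

Lemma nz_pochX2 (x : F) p k : x = X / 2 + p%:R -> ((p + k).*2 <= n.+1)%N -> poch x k != 0.
Proof.
move=> -> kn; apply: poch_neq0 => i ik; rewrite -addrA -natrD; apply: nzX2.
apply: leq_trans kn; rewrite ltn_double; lia.
Qed.

Lemma nz_pochX3 (x : F) p k : x = X / 2 + 1 / 2 + p%:R -> ((p + k).*2 <= n)%N -> poch x k != 0.
Proof.
move=> -> kn; apply: poch_neq0 => i ik; rewrite -addrA -natrD; apply: nzX3.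
by rewrite ltnS; apply: leq_trans kn; rewrite ltn_double; lia.
Qed.

Lemma inv_u : (uz z)^-1 = 1 + z^-1.
Proof.
have z0 := z_neq0 zE; have z1 := z1_neq0 zE.
by rewrite /uz; field; rewrite z0 z1.
Qed.

(** The bound on n keeps the Pochhammer symbols in the denominators away from zero at
    X = -n-1. *)
Lemma third_neg w a : w * z = -1 -> (4 * a + 10 <= n)%N ->
  gdet w a X = (1 + w) ^+ a *
   (\prod_(k < uphalf a) (third_num0 X k / third_den0 X k) * \prod_(k < a./2) (third_num1 X k / third_den1 X k)).
Proof.
move=> wz an.
have b0 := uphalf_bounds a.
rewrite (gdet_hankc zE _ wz); last by lia.
move: (uphalf a) (a./2) b0 (uphalf_split a) => K K' b0 aK; subst a.
have Kn : (4 * K + 4 * K' + 10 <= n)%N by rewrite -mulnDr.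
rewrite (@prod_even_odd F K K' (fun i => (-27) ^+ i / (i`!%:R * poch (X + 1) i))) // hankc_odd // (det_gramW (wilson_case_odd n.+1 zE)); last first.
  move=> j jK; rewrite paS pbS pcS.
  have -> : X / 6 + (X / 6 + 1 / 3) + (X / 6 + 2 / 3) + 1 / 2 + j%:R = X / 2 + 1 / 2 + j.+1%:R :> F.
    by rewrite -natr1; field.
  by apply: nzX3; rewrite -addnn; lia.
rewrite (det_gramW1 (wilson_case_odd n.+1 zE)); last first.
  move=> j jK; rewrite paS pbS pcS.
  have -> : X / 6 + (X / 6 + 1 / 3) + (X / 6 + 2 / 3) + 1 / 2 + j%:R = X / 2 + 1 / 2 + j.+1%:R :> F.
    by rewrite -natr1; field.
  by apply: nzX3; rewrite -addnn; lia.
have X0 : X != 0 by apply: nzX.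
have r : gramW z n.+1 (-1) id 1 0 = - ((X + 1) * (X + 2) / 27) * gramW z n.+1 (-1) id 0 0.
  have := gramWl (wilson_case_odd n.+1 zE) 0 0; rewrite paS pbS pcS !addr0.
  have s0 : X / 2 + 1 / 2 + 1%:R != 0 by apply: nzX3; lia.
  have -> : X / 6 + (X / 6 + 1 / 3) + (X / 6 + 2 / 3) + 1 / 2 = X / 2 + 1 / 2 + 1%:R :> F by field.
  move=> e; apply: (mulfI s0); rewrite e.
  by move: (X : F) (gramW _ _ _ _ _ _) => Y g; field.
have f00 : 3 / (X * uz z) * gramW z n.+1 (-1) id 0 0 = 1 + w.
  rewrite odd_base // invfM inv_u.
  have z0 := z_neq0 zE; have z1 := z1_neq0 zE.
  have -> : w = - z^-1 by apply: (mulIf z0); rewrite wz mulNr mulVf.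
  rewrite /vz /uz; move: X0; rewrite oppr_eq0; move: n.+1%:R => y X0.
  transitivity ((1 + z^-1) * ((1 + z)^-1 * (z - 1))); first by field; rewrite X0 z0 z1.
  by field; rewrite z0 z1.
rewrite r paS pbS pcS.
move: (3 / _) f00 => A f00.
have t0 : \prod_(k < K) (third_num0 X k / third_den0 X k) =
   \prod_(k < K) ((-27) ^+ (2 * k) / ((2 * k)`!%:R * poch (X + 1) (2 * k))) *
   \prod_(k < K) wprod (X / 6) (X / 6 + 1 / 3) (X / 6 + 2 / 3) (1 / 2) k.
  rewrite -big_split; apply: eq_bigr => k _ /=; have kK := ltn_ord k.
  rewrite third_term0 //.
  - by apply: nz_pochX1 => //; lia.
  - by apply: (@nz_pochX3 _ 1); [field | rewrite -addnn; lia].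
  - by apply: (@nz_pochX3 _ k); [ | rewrite -addnn; lia].
have t1 : \prod_(k < K') (third_num1 X k / third_den1 X k) =
   \prod_(k < K') ((-27) ^+ (2 * k + 1) / ((2 * k + 1)`!%:R * poch (X + 1) (2 * k + 1))) *
   ((- ((X + 1) * (X + 2) / 27)) ^+ K' *
   \prod_(k < K') wprod (X / 6 + 1) (X / 6 + 1 / 3) (X / 6 + 2 / 3) (1 / 2) k).
  have -> : (- ((X + 1) * (X + 2) / 27)) ^+ K' = \prod_(k < K') (- ((X + 1) * (X + 2) / 27)).
    by rewrite prodr_const card_ord.
  rewrite -!big_split; apply: eq_bigr => k _ /=; have kK := ltn_ord k.
  rewrite addn1 third_term1 //.
  - by apply: nz_pochX1 => //; lia.
  - by apply: (@nz_pochX3 _ 2); [field | rewrite -addnn; lia].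
  - by apply: (@nz_pochX3 _ k.+1); [rewrite -natr1; field | rewrite -addnn; lia].
rewrite t0 t1 -f00 !exprD; move: (gramW _ _ _ _ _ _) (- (_ / 27)) {f00} => B C.
rewrite !exprMn; ring.
Qed.

(** The nonzero entries have i + j odd, so conjugation with the signs (-1)^i negates the
    matrix. *)
Lemma hank_odd0 a : odd a -> hank z n (-1) a = 0.
Proof.
move=> oa; apply: eq_opp_eq0.
have {1}-> : hank z n (-1) a = \det (\matrix_(i < a, j < a) ((-1) ^+ i * (-1) ^+ j *
    (\matrix_(i < a, j < a) bfun z n (-1) (fun t => t ^+ i * t ^+ j)) i j)).
  rewrite (@det_scale _ a (fun i => (-1) ^+ i) (fun i => (-1) ^+ i)) -big_split /=.
  by rewrite big1 ?mul1r // => i _; rewrite -expr2 sqrr_sign.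
transitivity ((-1) ^+ a * hank z n (-1) a); last by rewrite -signr_odd oa expr1 mulN1r.
rewrite /hank -detZ; congr (\det _).
apply/matrixP => i j; rewrite !mxE.
case: (boolP (odd (i + j))) => oij.
  by rewrite -exprD -signr_odd oij expr1.
rewrite bfun_odd0 ?mulr0 // => t.
by rewrite -!exprD exprNn -signr_odd (negbTE oij) mul1r.
Qed.

Lemma minus1_neg_odd a : odd a -> (a <= n)%N -> gdet (-1) a X = 0.
Proof.
by move=> oa an; rewrite (gdet_hank zE) ?leqW // hank_odd0 // mulr0.
Qed.

Lemma minus1_neg K : (8 * K + 10 <= n)%N ->
  gdet (-1) (K + K) X =
    \prod_(k < K) (- (neg_num X k / neg_den X k) ^+ 2 / neg_den_fact X k).
Proof.
move=> Kn.
have l1 : (K + K <= n.+1)%N by lia.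
have l2 j : (j < 2 * K)%N -> ((j + 2).*2 <= n)%N by rewrite -addnn; lia.
have l3 k : (k < K)%N -> (2 * k <= n)%N by lia.
have l4 k : (k < K)%N -> ((2 * k).+1 <= n)%N by lia.
have l5 k : (k < K)%N -> ((2 + 2 * k).*2 <= n.+1)%N by rewrite -addnn; lia.
have l6 k : (k < K)%N -> ((k.+1 + k).*2 <= n.+1)%N by rewrite -addnn; lia.
have paE : pa F n = (X + 1) / 6 by rewrite /pa -natr1; field.
have pbE : pb F n = (X + 1) / 6 + 1 / 3 by rewrite /pb paE.
have pcE : pc F n = (X + 1) / 6 + 2 / 3 by rewrite /pc paE.
rewrite (gdet_hank zE) // [1 + X]addrC.
rewrite (@prod_even_odd F K K (fun i => (-27) ^+ i / (i`!%:R * poch (X + 1) i))) ?leqnn ?leqnSn //.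
rewrite hank_odd // (det_gramW (wilson_case_odd n zE)); last first.
  move=> j jK; rewrite paE pbE pcE.
  have -> : (X + 1) / 6 + ((X + 1) / 6 + 1 / 3) + ((X + 1) / 6 + 2 / 3) + 1 / 2 + j%:R = X / 2 + (j + 2)%:R :> F.
    by rewrite natrD; field.
  by apply: nzX2; apply: leq_trans (l2 _ jK) _.
rewrite paE pbE pcE exprMn -exprM mulnC exprM.
have -> : gramW z n (-1) id 0 0 ^+ 2 = - ((X + 1) ^+ 2 / 27).
  rewrite odd_base //; have -> : X + 1 = - n%:R :> F by rewrite -natr1; ring.
  have z0 := z_neq0 zE; have z1 := z1_neq0 zE.
  have e : (1 + z) ^+ 2 = 3 * z by rewrite (_ : _ ^+ 2 = z ^+ 2 + 2 * z + 1); [rewrite zE|]; ring.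
  have e' : (1 - z) ^+ 2 = - z by rewrite (_ : _ ^+ 2 = z ^+ 2 - 2 * z + 1); [rewrite zE|]; ring.
  rewrite /vz /uz; move: n%:R => y.
  transitivity (y ^+ 2 * ((1 - z) ^+ 2 / (1 + z) ^+ 2) / 9); first by field; rewrite z1.
  by rewrite e e'; field; rewrite z0.
have -> : (-1) ^+ K = \prod_(k < K) (-1) :> F by rewrite prodr_const card_ord.
set B := - (_ / 27).
have -> : B ^+ K = \prod_(k < K) B by rewrite prodr_const card_ord.
rewrite -prodrXl -!big_split; apply: eq_bigr => k _ /=; have kK := ltn_ord k.
rewrite addn1 -neg_term.
- by rewrite /B; ring.
- by apply: nz_pochX1; apply: l3.
- by apply: nz_pochX1; apply: l4.
- by apply: (@nz_pochX2 _ 2); [ | apply: l5].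
- by apply: (@nz_pochX2 _ k.+1); [rewrite -natr1; ring | apply: l6].
Qed.

Lemma sixth_neg w a : w * z = 1 -> (4 * a + 20 <= n)%N ->
  gdet w a X = (1 + w) ^+ a *
   (\prod_(k < uphalf a) (sixth_num0 X k / sixth_den0 X k) * \prod_(k < a./2) (sixth_num1 X k / sixth_den1 X k)).
Proof.
move=> wz an.
have l0 : (a <= n.+1)%N by lia.
have l1 : (0 < n)%N by lia.
have l2 : (1 < n)%N by lia.
have l3 : (2 < n.+1)%N by lia.
have l4 : (4 < n.+1)%N by lia.
have l5 : (6 < n.+1)%N by lia.
rewrite (gdet_hankc zE _ wz) //.
have X0 : X != 0 by apply: nzX.
have X1 : X + 1 != 0 by have := @nzX1 F n 0 l1; rewrite addr0.
have X2 : X + 2 != 0.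
  have -> : X + 2 = X + 1 + 1%:R by ring.
  exact: nzX1.
have x1 : X / 2 + 1 != 0 by apply: (@nzX2 F n 1).
have x2 : X / 2 + 2 != 0 by apply: (@nzX2 F n 2).
have x3 : X / 2 + 3 != 0 by apply: (@nzX2 F n 3).
have sE (d : F) : X / 6 + (X / 6 + 1 / 3) + (X / 6 + 2 / 3) + d = X / 2 + 1 + d by field.
have s0 : X / 6 + (X / 6 + 1 / 3) + (X / 6 + 2 / 3) = X / 2 + 1 by field.
have E00' := even_base n.+1 zE.
have E10' : gramW z n.+1 1 (fun=> 1) 1 0 = even_value1 X.
  have c0 : pa F n.+1 + pb F n.+1 + pc F n.+1 != 0 by rewrite paS pbS pcS s0.
  rewrite (even_base1 zE c0) paS pbS pcS s0 /even_value1.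
  have -> : X / 6 + (X / 6 + 1 / 3) = (X + 1) / 3 by field.
  by have -> : X / 6 + (X / 6 + 2 / 3) = (X + 2) / 3 by field.
have O00' : gramW z n.+1 1 (fun t => t ^+ 2) 0 0 = even_value_sq X.
  by rewrite even_base_sq E10' E00' paS.
have O10' : gramW z n.+1 1 (fun t => t ^+ 2) 1 0 = even_value_sq1 X.
  have := gramWl (wilson_case_even1 n.+1 zE) 0 0; rewrite paS pbS pcS !addr0 sE O00'.
  have -> : X / 2 + 1 + 1 = X / 2 + 2 by ring.
  move=> e; apply: (mulfI x2); rewrite e /even_value_sq1.
  by move: (X : F) (X / 2 + 2) x2 => Y D y2; field.
have nzE j : ((j.+1).*2 < n.+1)%N -> pa F n.+1 + pb F n.+1 + pc F n.+1 + 0 + j%:R != 0.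
  move=> jn; rewrite paS pbS pcS sE addr0.
  have -> : X / 2 + 1 + j%:R = X / 2 + j.+1%:R by rewrite -natr1; ring.
  exact: nzX2.
have nzO j : ((j.+2).*2 < n.+1)%N -> pa F n.+1 + pb F n.+1 + pc F n.+1 + 1 + j%:R != 0.
  move=> jn; rewrite paS pbS pcS sE.
  have -> : X / 2 + 1 + 1 + j%:R = X / 2 + j.+2%:R by rewrite -!natr1; ring.
  exact: nzX2.
have wE : (uz z)^-1 = 1 + w.
  rewrite inv_u; congr (_ + _); have z0 := z_neq0 zE.
  by apply: (mulIf z0); rewrite wz mulVf.
have aE : a = ((uphalf a) + a./2)%N := uphalf_split a.
have := uphalf_bounds a.
move: (uphalf a) (a./2) aE => K K' aE; subst a => /andP[KK KK'].
have e26 k : (2 * k.+1 = (2 * k).+2)%N by rewrite mulnS.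
have l6 k : (k < K)%N -> ((2 * k).+1 <= n)%N by lia.
have l6' k : (k < K')%N -> ((2 * k).+2 <= n)%N by lia.
have l7 k : (k < K)%N -> ((1 + k + k).*2.+4 <= n.+1)%N by rewrite -addnn; lia.
have l7' k : (k < K')%N -> ((1 + k + k).*2.+4.+4 <= n.+1)%N by rewrite -addnn; lia.
have l8 j k : (j < 2 * k)%N -> (k <= K)%N -> (j.+2.*2 < n.+1)%N by rewrite -addnn; lia.
have l9 j : (j <= 2 * K)%N -> (j.+2.*2 < n.+1)%N by rewrite -addnn; lia.
rewrite (@prod_even_odd F K K' (fun i => (-27) ^+ i / (i`!%:R * poch (X + 1) i))) ?KK //.
have [eK|oK] : K' = K \/ K = K'.+1 by lia.
  subst K'.
  rewrite hankc_even0 // (det_gramW (wilson_case_even1 n.+1 zE)); last first.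
    by move=> j jK; apply: nzO; apply: (l8 _ K).
  rewrite (det_gramW1 (wilson_case_even0 n.+1 zE)); last first.
    by move=> j jK; apply: nzE; apply: leq_trans (l9 _ jK); rewrite ltnS leq_double.
  rewrite E10' O00' paS pbS pcS.
  have e : (3 / (X * uz z)) ^+ (K + K) * (-1) ^+ K * even_value_sq X ^+ K * even_value1 X ^+ K =
     (1 + w) ^+ (K + K) * \prod_(k < K) (9 / X ^+ 2 * (-1) * (even_value_sq X * even_value1 X)).
    rewrite prodr_const card_ord !addnn -!mul2n !exprM -!exprMn; congr (_ ^+ _).
    rewrite -wE exprVn; have u0 : uz z != 0.
      by rewrite /uz mulf_neq0 ?invr_eq0 ?(z1_neq0 zE) ?(z_neq0 zE).
    by move: (X) X0 (even_value_sq _) (even_value1 _) => Y Y0 o e; field; rewrite Y0 u0.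
  set P0 := \prod_(k < K) _; set P1 := \prod_(k < K) _.
  set W0 := \prod_(k < K) _; set W1 := \prod_(k < K) _.
  transitivity ((3 / (X * uz z)) ^+ (K + K) * (-1) ^+ K * even_value_sq X ^+ K * even_value1 X ^+ K * (P0 * P1 * W0 * W1)).
    by ring.
  rewrite e -!mulrA; congr (_ * _); rewrite -!big_split; apply: eq_bigr => k _ /=.
  have kK := ltn_ord k.
  rewrite addn1 -sixth_term_pair //; first by ring.
  - have -> : X / 2 + 1 + (2 * k)%:R = X / 2 + (2 * k).+1%:R by rewrite -natr1; ring.
    by apply: nzX2; apply: leq_trans (l7 _ kK); clear; lia.
  - by apply: nz_pochX1; apply: ltnW; apply: l6.
  - by apply: nz_pochX1; apply: l6.
  - apply: (@nz_pochX2 _ 2) => //; apply: leq_trans (l7 _ kK); clear; lia.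
  - apply: (@nz_pochX2 _ k.+1); first by rewrite -natr1; ring.
    by apply: leq_trans (l7 _ kK); clear; lia.
subst K.
have pa0 : pa F n.+1 != 0 by rewrite paS mulf_neq0 // invr_eq0 pnatr_eq0.
rewrite hankc_even1 // (det_gramW (wilson_case_even0 n.+1 zE)); last first.
  move=> j jK; apply: nzE; apply: leq_trans (l8 _ K'.+1 jK (leqnn _)).
  by rewrite ltnS leq_double.
rewrite (det_gramW1 (wilson_case_even1 n.+1 zE)); last first.
  by move=> j jK; apply: nzO; apply: l9; apply: leq_trans jK _; rewrite e26 ltnW.
rewrite O10' E00' paS pbS pcS.
have e : (3 / (X * uz z)) ^+ (K'.+1 + K') * ((-1) ^+ K' * (X / 6)) * 2 ^+ K'.+1 * even_value_sq1 X ^+ K' =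
     (1 + w) ^+ (K'.+1 + K') * \prod_(k < K') (- (18 / X ^+ 2) * even_value_sq1 X).
  rewrite prodr_const card_ord addSn addnn -mul2n ![_ ^+ (_ * _).+1]exprS !exprM.
  rewrite [2 ^+ K'.+1]exprS.
  have u0 : uz z != 0.
    by rewrite /uz mulf_neq0 ?invr_eq0 ?(z1_neq0 zE) ?(z_neq0 zE).
  transitivity (3 / (X * uz z) * (X / 6) * 2 * (((3 / (X * uz z)) ^+ 2) ^+ K' * (-1) ^+ K' * 2 ^+ K' * even_value_sq1 X ^+ K')).
    by ring.
  rewrite -[RHS]mulrA -!exprMn -wE exprVn.
  move: (X) X0 (even_value_sq1 _) => Y Y0 o.
  have -> : 3 / (Y * uz z) * (Y / 6) * 2 = (uz z)^-1 by field; rewrite Y0 u0.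
  by congr (_ * _ ^+ _); field; rewrite Y0 u0.
set P0 := \prod_(k < K'.+1) _; set P1 := \prod_(k < K') _.
set W0 := \prod_(k < K'.+1) _; set W1 := \prod_(k < K') _.
transitivity ((3 / (X * uz z)) ^+ (K'.+1 + K') * ((-1) ^+ K' * (X / 6)) * 2 ^+ K'.+1 * even_value_sq1 X ^+ K' * (P0 * P1 * W0 * W1)).
  by ring.
rewrite e -!mulrA; congr (_ * _).
have q0 : sixth_num0 X 0 / sixth_den0 X 0 = 1 by rewrite /sixth_num0 /sixth_den0 !poch0 !mulr1 divr1.
have p0 : (-27) ^+ (2 * 0) / ((2 * 0)`!%:R * poch (X + 1) (2 * 0)) = 1 by rewrite muln0 poch0 mulr1 expr0 divr1.
have w0 : wprod (X / 6) (X / 6 + 1 / 3) (X / 6 + 2 / 3) 0 0 = 1.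
  by rewrite /wprod muln0 !poch0 !mulr1 divr1.
rewrite /P0 /W0 !big_ord_recl /= /bump /= q0 p0 w0 !(mul1r (\prod_(_ < _) _)).
rewrite -!big_split; apply: eq_bigr => k _ /=.
have kK := ltn_ord k; have {}l7' := l7' _ kK; have {}l6' := l6' _ kK.
rewrite add1n addn1 e26 -sixth_term_shifted_pair //; first by ring.
- have -> : X / 2 + 2 + (2 * k)%:R = X / 2 + (2 * k).+2%:R by rewrite -!natr1; ring.
  by apply: nzX2; move: l7'; clear; lia.
- by apply: nz_pochX1.
- by apply: nz_pochX1; apply: ltnW.
- by apply: (@nz_pochX2 _ 1) => //; move: l7'; clear; lia.
- apply: (@nz_pochX2 _ k.+1); first by rewrite -[k.+1%:R]natr1; ring.
  by move: l7'; clear; lia.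
- apply: (@nz_pochX2 _ k.+2); first by rewrite -!natr1; ring.
  by move: l7'; clear; lia.
Qed.

End Neg.

(** * Extension to all arguments by polynomiality *)

Section PolyFun.
Variable F : numFieldType.
Implicit Types f g : F -> F.

Definition polyfun f := exists p : {poly F}, forall x, f x = p.[x].

Lemma polyfun_cst c : polyfun (fun=> c).
Proof. by exists c%:P => x; rewrite hornerC. Qed.

Lemma polyfun_id : polyfun id.
Proof. by exists 'X => x; rewrite hornerX. Qed.

Lemma polyfunD f g : polyfun f -> polyfun g -> polyfun (fun x => f x + g x).
Proof. by move=> [p pE] [q qE]; exists (p + q) => x; rewrite hornerD pE qE. Qed.

Lemma polyfunM f g : polyfun f -> polyfun g -> polyfun (fun x => f x * g x).
Proof. by move=> [p pE] [q qE]; exists (p * q) => x; rewrite hornerM pE qE. Qed.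

Lemma polyfunX f n : polyfun f -> polyfun (fun x => f x ^+ n).
Proof. by move=> [p pE]; exists (p ^+ n) => x; rewrite horner_exp pE. Qed.

Lemma polyfunN f : polyfun f -> polyfun (fun x => - f x).
Proof. by move=> [p pE]; exists (- p) => x; rewrite hornerN pE. Qed.

Lemma polyfun_sum (I : finType) (P : pred I) (h : I -> F -> F) :
  (forall i, polyfun (h i)) -> polyfun (fun x => \sum_(i | P i) h i x).
Proof.
move=> hp; have [p pE] := fin_all_exists hp.
by exists (\sum_(i | P i) p i) => x; rewrite horner_sum; apply: eq_bigr => i _; rewrite pE.
Qed.

Lemma polyfun_prod (I : finType) (P : pred I) (h : I -> F -> F) :
  (forall i, polyfun (h i)) -> polyfun (fun x => \prod_(i | P i) h i x).
Proof.
move=> hp; have [p pE] := fin_all_exists hp.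
by exists (\prod_(i | P i) p i) => x; rewrite horner_prod; apply: eq_bigr => i _; rewrite pE.
Qed.

Lemma polyfun_poch f k : polyfun f -> polyfun (fun x => poch (f x) k).
Proof.
move=> pf; apply: polyfun_prod => i; apply: polyfunD => //; exact: polyfun_cst.
Qed.

(** A nonzero polynomial has finitely many roots. *)
Lemma polyfun_eq f g N : polyfun f -> polyfun g ->
  (forall n, (N <= n)%N -> f (- n.+1%:R) = g (- n.+1%:R)) -> f =1 g.
Proof.
move=> [p pE] [q qE] fg x; rewrite pE qE.
have [->//|pq] := eqVneq p q; exfalso.
have pq0 : p - q != 0 by rewrite subr_eq0.
pose s : seq F := [seq - (n + N).+1%:R | n <- iota 0 (size (p - q))].
have := max_poly_roots (rs := s) pq0; rewrite size_map size_iota ltnn => h.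
suff : false by []; apply: h.
  apply/allP => y /mapP[n _ ->]; rewrite /root hornerD hornerN -pE -qE fg ?subrr //.
  exact: leq_addl.
rewrite map_inj_uniq ?iota_uniq // => n1 n2 /oppr_inj /eqP.
by rewrite eqr_nat eqSS eqn_add2r => /eqP.
Qed.

Lemma polyfun_gdet w a : polyfun (gdet w a).
Proof.
have pm (i j : 'I_a) : polyfun (fun X => (\matrix_(i < a, j < a)
    ((i == j)%:R + w * (poch (X + 1 + i%:R) j / j`!%:R))) i j).
  have [p pE] : polyfun (fun X => (i == j)%:R + w * (poch (X + 1 + i%:R) j / j`!%:R)).
    apply: polyfunD; first exact: polyfun_cst.
    apply: polyfunM; first exact: polyfun_cst.
    apply: polyfunM; last exact: polyfun_cst.
    apply: polyfun_poch; apply: polyfunD; last exact: polyfun_cst.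
    by apply: polyfunD; [exact: polyfun_id | exact: polyfun_cst].
  by exists p => x; rewrite -pE mxE.
apply: polyfun_sum => s; apply: polyfunM; first exact: polyfun_cst.
by apply: polyfun_prod => i; apply: pm.
Qed.

End PolyFun.

Ltac polyfun_tac := repeat first
  [ exact: polyfun_cst | exact: polyfun_id | exact: polyfun_gdet
  | apply: polyfun_prod => ? | apply: polyfun_poch
  | apply: polyfunX | apply: polyfunN
  | apply: polyfunD | apply: polyfunM ].

Section Closed.
Variables (F : numFieldType).
Hypothesis sixth_root : exists z : F, z ^+ 2 = z - 1.

Lemma nat_half_gt0 (m : nat) (p : F) k : 0 < p -> poch (m%:R / 2 + p) k != 0.
Proof.
move=> p0; apply: poch_neq0 => j _; rewrite gt_eqF // ltr_wpDr ?ler0n //.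
by rewrite ltr_wpDl // divr_ge0 ?ler0n.
Qed.

(** Clearing denominators makes both sides polynomial in X; they agree at all large
    negative integers, hence at m, where the denominators do not vanish. *)
Lemma closed_third (w : F) z a (m : nat) : z ^+ 2 = z - 1 -> w * z = -1 ->
  gdet w a m%:R = (1 + w) ^+ a *
   (\prod_(k < uphalf a) (third_num0 m%:R k / third_den0 m%:R k) * \prod_(k < a./2) (third_num1 m%:R k / third_den1 m%:R k)).
Proof.
move=> zE wz.
pose f (X : F) := gdet w a X * (\prod_(k < uphalf a) third_den0 X k * \prod_(k < a./2) third_den1 X k).
pose g (X : F) := (1 + w) ^+ a * (\prod_(k < uphalf a) third_num0 X k * \prod_(k < a./2) third_num1 X k).
have pf : polyfun f by rewrite /f /third_den0 /third_den1; polyfun_tac.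
have pg : polyfun g by rewrite /g /third_num0 /third_num1; polyfun_tac.
(* agreement at the integers -n-1 with n large enough for [third_neg] *)
have fg : f =1 g.
  apply: (polyfun_eq (N := (4 * a + 10)%N)) => // n nN.
  have l1 (k : 'I_(uphalf a)) : ((k + k).*2 <= n)%N.
    by case: k => k /= kK; rewrite uphalf_half -addnn in kK *; lia.
  have l2 (k : 'I_(a./2)) : ((k.+1 + k).*2 <= n)%N.
    by case: k => k /= kK; rewrite -addnn; lia.
  rewrite /f /g (third_neg zE wz nN) -mulrA mulrACA -!big_split /=; congr (_ * (_ * _)).
    apply: eq_bigr => k _; rewrite divfK // /third_den0 mulf_neq0 ?fact_neq0 //.
    exact: (@nz_pochX3 _ _ _ k).
  apply: eq_bigr => k _; rewrite divfK // /third_den1 mulf_neq0 ?fact_neq0 //.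
  by apply: (@nz_pochX3 _ _ _ k.+1) => //; rewrite -[k.+1%:R]natr1; field.
have := fg m%:R; rewrite /f /g.
set d0 := \prod_(k < uphalf a) _; set d1 := \prod_(k < a./2) _.
have d00 : d0 != 0.
  apply/prodf_neq0 => k _; rewrite /third_den0 mulf_neq0 ?fact_neq0 // -addrA nat_half_gt0 //.
  by rewrite ltr_wpDr ?ler0n // divr_gt0.
have d10 : d1 != 0.
  apply/prodf_neq0 => k _; rewrite /third_den1 mulf_neq0 ?fact_neq0 // -addrA nat_half_gt0 //.
  by rewrite ltr_wpDr ?ler0n // divr_gt0.
move=> e; rewrite !prodf_div mulf_div mulrA -e mulfK // mulf_neq0 //.
Qed.

Lemma closed_sixth (w : F) z a (m : nat) : z ^+ 2 = z - 1 -> w * z = 1 ->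
  gdet w a m%:R = (1 + w) ^+ a *
   (\prod_(k < uphalf a) (sixth_num0 m%:R k / sixth_den0 m%:R k) * \prod_(k < a./2) (sixth_num1 m%:R k / sixth_den1 m%:R k)).
Proof.
move=> zE wz.
pose f (X : F) := gdet w a X * (\prod_(k < uphalf a) sixth_den0 X k * \prod_(k < a./2) sixth_den1 X k).
pose g (X : F) := (1 + w) ^+ a * (\prod_(k < uphalf a) sixth_num0 X k * \prod_(k < a./2) sixth_num1 X k).
have pf : polyfun f by rewrite /f /sixth_den0 /sixth_den1; polyfun_tac.
have pg : polyfun g by rewrite /g /sixth_num0 /sixth_num1; polyfun_tac.
have fg : f =1 g.
  apply: (polyfun_eq (N := (4 * a + 20)%N)) => // n nN.
  have l1 (k : 'I_(uphalf a)) : ((k.+1 + k).*2 <= n.+1)%N.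
    by case: k => k /= kK; rewrite uphalf_half -addnn in kK *; lia.
  have l2 (k : 'I_(a./2)) : ((k.+1 + k.+1).*2 <= n.+1)%N.
    by case: k => k /= kK; rewrite -addnn; lia.
  rewrite /f /g (sixth_neg zE wz nN) -mulrA mulrACA -!big_split /=; congr (_ * (_ * _)).
    apply: eq_bigr => k _; rewrite divfK // /sixth_den0 mulf_neq0 ?fact_neq0 //.
    by apply: (@nz_pochX2 _ _ _ k.+1) => //; rewrite -[k.+1%:R]natr1; ring.
  apply: eq_bigr => k _; rewrite divfK // /sixth_den1 mulf_neq0 ?fact_neq0 //.
  by apply: (@nz_pochX2 _ _ _ k.+1) => //; rewrite -[k.+1%:R]natr1; ring.
have := fg m%:R; rewrite /f /g.
set d0 := \prod_(k < uphalf a) _; set d1 := \prod_(k < a./2) _.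
have d00 : d0 != 0.
  apply/prodf_neq0 => k _; rewrite /sixth_den0 mulf_neq0 ?fact_neq0 // -addrA nat_half_gt0 //.
  by rewrite ltr_wpDr ?ler0n.
have d10 : d1 != 0.
  apply/prodf_neq0 => k _; rewrite /sixth_den1 mulf_neq0 ?fact_neq0 // -addrA nat_half_gt0 //.
  by rewrite ltr_wpDr ?ler0n.
move=> e; rewrite !prodf_div mulf_div mulrA -e mulfK // mulf_neq0 //.
Qed.

Lemma closed_minus1_odd a (m : nat) : odd a -> gdet (-1) a (m%:R : F) = 0.
Proof.
move=> oa; have [z zE] := sixth_root.
apply: (polyfun_eq (N := a) (polyfun_gdet (-1) a) (polyfun_cst 0)) => n an.
exact: (minus1_neg_odd zE).
Qed.

Lemma closed_minus1 K (m : nat) : gdet (-1) (K + K) (m%:R : F) =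
  \prod_(k < K) (- (neg_num m%:R k / neg_den m%:R k) ^+ 2 / neg_den_fact m%:R k).
Proof.
have [z zE] := sixth_root.
pose f (X : F) := gdet (-1) (K + K) X * \prod_(k < K) (neg_den X k ^+ 2 * neg_den_fact X k).
pose g (X : F) := \prod_(k < K) (- neg_num X k ^+ 2).
have pf : polyfun f by rewrite /f /neg_den /neg_den_fact; polyfun_tac.
have pg : polyfun g by rewrite /g /neg_num; polyfun_tac.
have fg : f =1 g.
  apply: (polyfun_eq (N := (8 * K + 10)%N)) => // n nN.
  rewrite /f /g (minus1_neg zE nN) -big_split; apply: eq_bigr => k _ /=.
  have l1 : ((k.+1 + k).*2 <= n.+1)%N by case: k => k /= kK; rewrite -addnn; lia.
  have l2 : ((2 * k).+1 <= n)%N by have := ltn_ord k; lia.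
  have h1 : neg_den (- n.+1%:R : F) k != 0.
    rewrite /neg_den; apply: (@nz_pochX2 F n _ k.+1) => //.
    by rewrite -[k.+1%:R]natr1; ring.
  have h2 : neg_den_fact (- n.+1%:R : F) k != 0.
    rewrite /neg_den_fact !mulf_neq0 ?fact_neq0 //; last exact: nz_pochX1.
    by apply: nz_pochX1; apply: ltnW.
  move: (neg_den _ _) h1 (neg_den_fact _ _) h2 (neg_num _ _) => d1 h1 d2 h2 d.
  by field; rewrite h1 h2.
have := fg m%:R; rewrite /f /g => e.
have d0 : \prod_(k < K) (neg_den (m%:R : F) k ^+ 2 * neg_den_fact m%:R k) != 0.
  apply/prodf_neq0 => k _; rewrite mulf_neq0 ?expf_neq0 //.
    rewrite /neg_den -addrA nat_half_gt0 //.
    by rewrite ltr_wpDr ?ler0n.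
  rewrite /neg_den_fact !mulf_neq0 ?fact_neq0 //; apply: poch_neq0 => j _;
    by rewrite natr1 -natrD pnatr_eq0.
apply: (mulIf d0); rewrite e -big_split; apply: eq_bigr => k _ /=.
move/prodf_neq0/(_ k isT): d0; rewrite mulf_eq0 negb_or expf_eq0 /= => /andP[h1 h2].
move: (neg_den _ _) h1 (neg_den_fact _ _) h2 (neg_num _ _) => d1 h1 d2 h2 d.
by field; rewrite h1 h2.
Qed.

End Closed.

(** * The products on the right-hand side *)

Section Products.
Variable F : numFieldType.
Implicit Types (x : F) (a k : nat).

(** The products of the statement in the form prod_i T(x + 3i, a - 4i).  The subtraction
    is truncated, and the factors T _ 0 are 1. *)
Definition shprod (T : F -> nat -> F) x a := \prod_(i < a) T (x + (3 * i)%:R) (a - 4 * i)%N.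

Lemma shprodS T x a : (forall y, T y 0%N = 1) ->
  shprod T x (a + 4) = T x (a + 4)%N * shprod T (x + 3) a.
Proof.
move=> T0; rewrite /shprod addnS big_ord_recl muln0 addr0 subn0; congr (_ * _).
rewrite (eq_bigr (fun i : 'I_(a + 3) => T (x + 3 + (3 * i)%:R) (a - 4 * i)%N)); last first.
  move=> i _; rewrite /= /bump /=; congr (T _ _); last by lia.
  by rewrite mulnDr natrD addrA.
rewrite big_split_ord /= [X in _ * X]big1 ?mulr1 // => i _.
by rewrite (_ : (a - 4 * (a + i) = 0)%N) ?T0 //; lia.
Qed.

(** From R(a, x) = T(a, x) R(a-4, x+3), the quotient R(a+1, x)/R(a, x) at a + 4 is
    the quotient at (a, x+3) times T(a+5, x)/T(a+4, x). *)
Lemma shprod_ratio T (r : F -> nat -> F) (s : nat) :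
  (forall y, T y 0%N = 1) ->
  (forall x a, 0 <= x -> T x a != 0) ->
  (forall x, 0 <= x -> shprod T x s.+1 = shprod T x s * r x 0%N) ->
  (forall x, 0 <= x -> shprod T x (2 + s).+1 = shprod T x (2 + s) * r x 1%N) ->
  (forall x k, 0 <= x -> r x k.+2 * T x (2 * k + s + 4)%N = r (x + 3) k * T x (2 * k + s + 5)%N) ->
  forall k x, 0 <= x -> shprod T x (2 * k + s).+1 = shprod T x (2 * k + s) * r x k.
Proof.
move=> T0 Tn0 h0 h1 hr; elim/nat_ind2 => [x x0|x x0|k IH _ x x0].
- by rewrite muln0 add0n; apply: h0.
- by rewrite muln1; apply: h1.
have -> : (2 * k.+2 + s = 2 * k + s + 4)%N by lia.
have -> : ((2 * k + s + 4).+1 = (2 * k + s).+1 + 4)%N by lia.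
rewrite !shprodS // IH ?addr_ge0 ?ler0n //.
have -> : ((2 * k + s).+1 + 4 = 2 * k + s + 5)%N by lia.
rewrite mulrCA -[RHS]mulrA [_ (x + 3) _ * r x _]mulrC.
by rewrite [RHS]mulrA [T x _ * r _ _]mulrC hr //; ring.
Qed.

Definition third_factor x a := poch (x + 1) a./2 * poch (x + 3) (a - 3)./2
  * poch (x + a%:R + 1 / 2) (a - 1)./2 * poch (x + a%:R - 1 / 2) (a - 2)./2.
Definition sixth_factor x a := poch (x + 3 / 2) (a - 1)./2 * poch (x + 5 / 2) (a - 2)./2
  * poch (x + a%:R) a./2 * poch (x + a%:R) (a - 3)./2.

Lemma third_factor_0 x : third_factor x 0 = 1.
Proof. by rewrite /third_factor !poch0 !mulr1. Qed.

Lemma sixth_factor_0 x : sixth_factor x 0 = 1.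
Proof. by rewrite /sixth_factor !poch0 !mulr1. Qed.

Lemma poch_pos_neq0 x k : 0 < x -> poch x k != 0.
Proof. by move=> x0; apply: poch_neq0 => j _; rewrite gt_eqF // ltr_wpDr. Qed.

Lemma gt0_add (x y : F) : 0 <= x -> 0 < y -> 0 < x + y.
Proof. exact: ltr_wpDl. Qed.

Lemma third_factor_neq0 x a : 0 <= x -> third_factor x a != 0.
Proof.
move=> x0; rewrite /third_factor !mulf_neq0 //; try by apply: poch_pos_neq0; rewrite ?gt0_add ?divr_gt0 ?addr_ge0 ?ler0n.
case: a => [|a]; first by rewrite poch0 oner_neq0.
apply: poch_pos_neq0; have -> : x + a.+1%:R - 1 / 2 = x + a%:R + 1 / 2 by rewrite -natr1; field.
by rewrite gt0_add ?divr_gt0 ?addr_ge0 ?ler0n.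
Qed.

Lemma sixth_factor_neq0 x a : 0 <= x -> sixth_factor x a != 0.
Proof.
move=> x0; rewrite /sixth_factor !mulf_neq0 //; try by apply: poch_pos_neq0; rewrite ?gt0_add ?divr_gt0 ?addr_ge0 ?ler0n.
  case: a => [|a]; first by rewrite poch0 oner_neq0.
  by apply: poch_pos_neq0; rewrite gt0_add ?ltr0n.
case: a => [|a]; first by rewrite poch0 oner_neq0.
by apply: poch_pos_neq0; rewrite gt0_add ?ltr0n.
Qed.

(** The quotient R(a+1, x) / R(a, x) at a = 2k; the definition with odd in its name is the
    one at a = 2k + 1, and likewise for the sixth roots. *)
Definition third_ratio_even x k := poch (2 * x + 1 + (2 * k)%:R) k * poch (x + 3 / 2 + (2 * k)%:R) k /
  (2 ^+ k * poch (x + 1 / 2 + k%:R) k).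
Definition third_ratio_odd x k := poch (2 * x + 2 + (2 * k)%:R) k.+1 * poch (x + 5 / 2 + (2 * k)%:R) k /
  (2 ^+ k.+1 * poch (x + 3 / 2 + k%:R) k).
Definition sixth_ratio_even x k := poch (2 * x + 1 + (2 * k)%:R) k * poch (x + 1 + (2 * k)%:R) k /
  (2 ^+ k * poch (x + 1 + k%:R) k).
Definition sixth_ratio_odd x k := poch (2 * x + 2 + (2 * k)%:R) k.+1 * poch (x + 2 + (2 * k)%:R) k.+1 /
  (2 ^+ k.+1 * poch (x + 1 + k%:R) k.+1).

Lemma third_ratio_even_step x k : 0 <= x ->
  third_ratio_even x k.+2 * third_factor x (2 * k + 4)%N = third_ratio_even (x + 3) k * third_factor x (2 * k + 5)%N.
Proof.
move=> x0.
have E0 : ((2 * k + 4)./2 = k.+2)%N by lia.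
have E1 : ((2 * k + 4 - 3)./2 = k)%N by lia.
have E2 : ((2 * k + 4 - 1)./2 = k.+1)%N by lia.
have E3 : ((2 * k + 4 - 2)./2 = k.+1)%N by lia.
have E4 : ((2 * k + 5)./2 = k.+2)%N by lia.
have E5 : ((2 * k + 5 - 3)./2 = k.+1)%N by lia.
have E6 : ((2 * k + 5 - 1)./2 = k.+2)%N by lia.
have E7 : ((2 * k + 5 - 2)./2 = k.+1)%N by lia.
rewrite /third_factor /third_ratio_even E0 E1 E2 E3 E4 E5 E6 E7.
have -> : (2 * k.+2)%:R = 2 * (k%:R + 2) :> F by rewrite natrM -[k.+2]addn2 natrD.
have -> : (2 * k + 4)%:R = 2 * k%:R + 4 :> F by rewrite natrD natrM.
have -> : (2 * k + 5)%:R = 2 * k%:R + 5 :> F by rewrite natrD natrM.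
have -> : k.+2%:R = k%:R + 2 :> F by rewrite -addn2 natrD.
rewrite [(2 * k)%:R]natrM.
set K : F := k%:R.
have K0 : 0 <= K by rewrite ler0n.
have P (y : F) : 0 < y -> 0 < x + K + y by move=> y0; rewrite gt0_add // addr_ge0.
have P2 (y : F) : 0 < y -> 0 < x + 2 * K + y.
  by move=> y0; rewrite gt0_add // addr_ge0 // mulr_ge0.
have N (y : F) : 0 < y -> y != 0 by move=> y0; rewrite gt_eqF.
have -> : 2 * x + 1 + 2 * (K + 2) = 2 * x + 5 + 2 * K by field.
have -> : x + 3 / 2 + 2 * (K + 2) = x + 2 * K + 11 / 2 by field.
have -> : x + 1 / 2 + (K + 2) = x + K + 5 / 2 by field.
have -> : x + (2 * K + 4) + 1 / 2 = x + 2 * K + 9 / 2 by field.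
have -> : x + (2 * K + 4) - 1 / 2 = x + 2 * K + 7 / 2 by field.
have -> : 2 * (x + 3) + 1 + 2 * K = 2 * x + 5 + 2 * K + 1 + 1 by field.
have -> : x + 3 + 3 / 2 + 2 * K = x + 2 * K + 7 / 2 + 1 by field.
have -> : x + 3 + 1 / 2 + K = x + K + 5 / 2 + 1 by field.
have -> : x + (2 * K + 5) + 1 / 2 = x + 2 * K + 11 / 2 by field.
have -> : x + (2 * K + 5) - 1 / 2 = x + 2 * K + 9 / 2 by field.
rewrite [poch (2 * x + 5 + 2 * K) k.+2]pochSl [poch (2 * x + 5 + 2 * K + 1) k.+1]pochSl.
rewrite [poch (x + K + 5 / 2) k.+2]pochSl [poch (x + K + 5 / 2 + 1) k.+1]pochS.
rewrite [poch (x + 2 * K + 7 / 2) k.+1]pochSl [poch (x + 3) k.+1]pochS !exprS.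
rewrite (_ : x + K + 5 / 2 + 1 + k%:R = x + 2 * K + 7 / 2); last by rewrite /K; field.
have n1 : poch (x + K + 5 / 2 + 1) k != 0 by apply: poch_pos_neq0; rewrite -addrA P // addr_gt0 // divr_gt0.
have n4 : (2 ^+ k : F) != 0 by rewrite expf_neq0 // pnatr_eq0.
rewrite -/K.
move: (2 ^+ k) n4 (poch (x + K + 5 / 2 + 1) k) n1 => t n4 p n1.
have m2 : 2 != 0 :> F by rewrite pnatr_eq0.
have n5 : (x + 2 * k%:R) * 2 + 7 != 0.
  rewrite (_ : (x + 2 * k%:R) * 2 + 7 = (x + 2 * k%:R + 7 / 2) * 2); last by field.
  by rewrite mulf_neq0 // N // (P2 (7 / 2)) // divr_gt0.
have n6 : (x + k%:R) * 2 + 5 != 0.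
  rewrite (_ : (x + k%:R) * 2 + 5 = (x + k%:R + 5 / 2) * 2); last by field.
  by rewrite mulf_neq0 // N // (P (5 / 2)) // divr_gt0.
by field; rewrite n1 n4 n5 n6.
Qed.

Lemma third_ratio_odd_step x k : 0 <= x ->
  third_ratio_odd x k.+2 * third_factor x (2 * k + 5)%N = third_ratio_odd (x + 3) k * third_factor x (2 * k + 6)%N.
Proof.
move=> x0.
have E0 : ((2 * k + 5)./2 = k.+2)%N by lia.
have E1 : ((2 * k + 5 - 3)./2 = k.+1)%N by lia.
have E2 : ((2 * k + 5 - 1)./2 = k.+2)%N by lia.
have E3 : ((2 * k + 5 - 2)./2 = k.+1)%N by lia.
have E4 : ((2 * k + 6)./2 = k.+3)%N by lia.
have E5 : ((2 * k + 6 - 3)./2 = k.+1)%N by lia.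
have E6 : ((2 * k + 6 - 1)./2 = k.+2)%N by lia.
have E7 : ((2 * k + 6 - 2)./2 = k.+2)%N by lia.
rewrite /third_factor /third_ratio_odd E0 E1 E2 E3 E4 E5 E6 E7.
have -> : (2 * k.+2)%:R = 2 * (k%:R + 2) :> F by rewrite natrM -[k.+2]addn2 natrD.
have -> : (2 * k + 5)%:R = 2 * k%:R + 5 :> F by rewrite natrD natrM.
have -> : (2 * k + 6)%:R = 2 * k%:R + 6 :> F by rewrite natrD natrM.
have -> : k.+2%:R = k%:R + 2 :> F by rewrite -addn2 natrD.
rewrite [(2 * k)%:R]natrM.
set K : F := k%:R.
have K0 : 0 <= K by rewrite ler0n.
have P (y : F) : 0 < y -> 0 < x + K + y by move=> y0; rewrite gt0_add // addr_ge0.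
have P2 (y : F) : 0 < y -> 0 < x + 2 * K + y.
  by move=> y0; rewrite gt0_add // addr_ge0 // mulr_ge0.
have N (y : F) : 0 < y -> y != 0 by move=> y0; rewrite gt_eqF.
have -> : 2 * x + 2 + 2 * (K + 2) = 2 * x + 6 + 2 * K by field.
have -> : x + 5 / 2 + 2 * (K + 2) = x + 2 * K + 13 / 2 by field.
have -> : x + 3 / 2 + (K + 2) = x + K + 7 / 2 by field.
have -> : x + (2 * K + 5) + 1 / 2 = x + 2 * K + 11 / 2 by field.
have -> : x + (2 * K + 5) - 1 / 2 = x + 2 * K + 9 / 2 by field.
have -> : 2 * (x + 3) + 2 + 2 * K = 2 * x + 6 + 2 * K + 1 + 1 by field.
have -> : x + 3 + 5 / 2 + 2 * K = x + 2 * K + 9 / 2 + 1 by field.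
have -> : x + 3 + 3 / 2 + K = x + K + 7 / 2 + 1 by field.
have -> : x + (2 * K + 6) + 1 / 2 = x + 2 * K + 13 / 2 by field.
have -> : x + (2 * K + 6) - 1 / 2 = x + 2 * K + 11 / 2 by field.
rewrite [poch (2 * x + 6 + 2 * K) k.+3]pochSl [poch (2 * x + 6 + 2 * K + 1) k.+2]pochSl.
rewrite [poch (x + K + 7 / 2) k.+2]pochSl [poch (x + K + 7 / 2 + 1) k.+1]pochS.
rewrite [poch (x + 2 * K + 9 / 2) k.+1]pochSl [poch (x + 1) k.+3]pochS !exprS.
rewrite (_ : x + K + 7 / 2 + 1 + k%:R = x + 2 * K + 9 / 2); last by rewrite /K; field.
have -> : k.+2%:R = K + 2 :> F by rewrite -addn2 natrD.
have n1 : poch (x + K + 7 / 2 + 1) k != 0 by apply: poch_pos_neq0; rewrite -addrA P // addr_gt0 // divr_gt0.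
have n4 : (2 ^+ k : F) != 0 by rewrite expf_neq0 // pnatr_eq0.
rewrite -/K.
move: (2 ^+ k) n4 (poch (x + K + 7 / 2 + 1) k) n1 => t n4 p n1.
have m2 : 2 != 0 :> F by rewrite pnatr_eq0.
have n5 : (x + 2 * k%:R) * 2 + 9 != 0.
  rewrite (_ : (x + 2 * k%:R) * 2 + 9 = (x + 2 * k%:R + 9 / 2) * 2); last by field.
  by rewrite mulf_neq0 // N // (P2 (9 / 2)) // divr_gt0.
have n6 : (x + k%:R) * 2 + 7 != 0.
  rewrite (_ : (x + k%:R) * 2 + 7 = (x + k%:R + 7 / 2) * 2); last by field.
  by rewrite mulf_neq0 // N // (P (7 / 2)) // divr_gt0.
by field; rewrite n1 n4 n5 n6.
Qed.

Lemma sixth_ratio_even_step x k : 0 <= x ->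
  sixth_ratio_even x k.+2 * sixth_factor x (2 * k + 4)%N = sixth_ratio_even (x + 3) k * sixth_factor x (2 * k + 5)%N.
Proof.
move=> x0.
have E0 : ((2 * k + 4 - 1)./2 = k.+1)%N by lia.
have E1 : ((2 * k + 4 - 2)./2 = k.+1)%N by lia.
have E2 : ((2 * k + 4)./2 = k.+2)%N by lia.
have E3 : ((2 * k + 4 - 3)./2 = k)%N by lia.
have E4 : ((2 * k + 5 - 1)./2 = k.+2)%N by lia.
have E5 : ((2 * k + 5 - 2)./2 = k.+1)%N by lia.
have E6 : ((2 * k + 5)./2 = k.+2)%N by lia.
have E7 : ((2 * k + 5 - 3)./2 = k.+1)%N by lia.
rewrite /sixth_factor /sixth_ratio_even E0 E1 E2 E3 E4 E5 E6 E7.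
have -> : (2 * k.+2)%:R = 2 * (k%:R + 2) :> F by rewrite natrM -[k.+2]addn2 natrD.
have -> : (2 * k + 4)%:R = 2 * k%:R + 4 :> F by rewrite natrD natrM.
have -> : (2 * k + 5)%:R = 2 * k%:R + 5 :> F by rewrite natrD natrM.
have -> : k.+2%:R = k%:R + 2 :> F by rewrite -addn2 natrD.
rewrite [(2 * k)%:R]natrM.
set K : F := k%:R.
have K0 : 0 <= K by rewrite ler0n.
have P (y : F) : 0 < y -> 0 < x + K + y by move=> y0; rewrite gt0_add // addr_ge0.
have P2 (y : F) : 0 < y -> 0 < x + 2 * K + y.
  by move=> y0; rewrite gt0_add // addr_ge0 // mulr_ge0.
have N (y : F) : 0 < y -> y != 0 by move=> y0; rewrite gt_eqF.
have -> : 2 * x + 1 + 2 * (K + 2) = 2 * x + 5 + 2 * K by field.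
have -> : x + 1 + 2 * (K + 2) = x + 2 * K + 4 + 1 by field.
have -> : x + 1 + (K + 2) = x + K + 3 by field.
have -> : x + (2 * K + 4) = x + 2 * K + 4 by field.
have -> : 2 * (x + 3) + 1 + 2 * K = 2 * x + 5 + 2 * K + 1 + 1 by field.
have -> : x + 3 + 1 + 2 * K = x + 2 * K + 4 by field.
have -> : x + 3 + 1 + K = x + K + 3 + 1 by field.
have -> : x + (2 * K + 5) = x + 2 * K + 4 + 1 by field.
rewrite [poch (2 * x + 5 + 2 * K) k.+2]pochSl [poch (2 * x + 5 + 2 * K + 1) k.+1]pochSl.
rewrite [poch (x + K + 3) k.+2]pochSl [poch (x + K + 3 + 1) k.+1]pochS.
rewrite [poch (x + 2 * K + 4) k.+2]pochSl [poch (x + 3 / 2) k.+2]pochS !exprS.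
rewrite (_ : x + K + 3 + 1 + k%:R = x + 2 * K + 4); last by rewrite /K; field.
rewrite -[k.+1%:R]natr1.
have n1 : poch (x + K + 3 + 1) k != 0 by apply: poch_pos_neq0; rewrite -addrA P // addr_gt0.
have n4 : (2 ^+ k : F) != 0 by rewrite expf_neq0 // pnatr_eq0.
rewrite -/K.
move: (2 ^+ k) n4 (poch (x + K + 3 + 1) k) n1 => t n4 p n1.
have n5 : x + 2 * k%:R + 4 != 0 by rewrite N // P2.
have n6 : x + k%:R + 3 != 0 by rewrite N // P.
by field; rewrite n1 n4 n5 n6.
Qed.

Lemma sixth_ratio_odd_step x k : 0 <= x ->
  sixth_ratio_odd x k.+2 * sixth_factor x (2 * k + 5)%N = sixth_ratio_odd (x + 3) k * sixth_factor x (2 * k + 6)%N.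
Proof.
move=> x0.
have E0 : ((2 * k + 5 - 1)./2 = k.+2)%N by lia.
have E1 : ((2 * k + 5 - 2)./2 = k.+1)%N by lia.
have E2 : ((2 * k + 5)./2 = k.+2)%N by lia.
have E3 : ((2 * k + 5 - 3)./2 = k.+1)%N by lia.
have E4 : ((2 * k + 6 - 1)./2 = k.+2)%N by lia.
have E5 : ((2 * k + 6 - 2)./2 = k.+2)%N by lia.
have E6 : ((2 * k + 6)./2 = k.+3)%N by lia.
have E7 : ((2 * k + 6 - 3)./2 = k.+1)%N by lia.
rewrite /sixth_factor /sixth_ratio_odd E0 E1 E2 E3 E4 E5 E6 E7.
have -> : (2 * k.+2)%:R = 2 * (k%:R + 2) :> F by rewrite natrM -[k.+2]addn2 natrD.
have -> : (2 * k + 5)%:R = 2 * k%:R + 5 :> F by rewrite natrD natrM.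
have -> : (2 * k + 6)%:R = 2 * k%:R + 6 :> F by rewrite natrD natrM.
have -> : k.+2%:R = k%:R + 2 :> F by rewrite -addn2 natrD.
rewrite [(2 * k)%:R]natrM.
set K : F := k%:R.
have K0 : 0 <= K by rewrite ler0n.
have P (y : F) : 0 < y -> 0 < x + K + y by move=> y0; rewrite gt0_add // addr_ge0.
have P2 (y : F) : 0 < y -> 0 < x + 2 * K + y.
  by move=> y0; rewrite gt0_add // addr_ge0 // mulr_ge0.
have N (y : F) : 0 < y -> y != 0 by move=> y0; rewrite gt_eqF.
have -> : 2 * x + 2 + 2 * (K + 2) = 2 * x + 6 + 2 * K by field.
have -> : x + 2 + 2 * (K + 2) = x + 2 * K + 5 + 1 by field.
have -> : x + 1 + (K + 2) = x + K + 3 by field.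
have -> : x + (2 * K + 5) = x + 2 * K + 5 by field.
have -> : 2 * (x + 3) + 2 + 2 * K = 2 * x + 6 + 2 * K + 1 + 1 by field.
have -> : x + 3 + 2 + 2 * K = x + 2 * K + 5 by field.
have -> : x + 3 + 1 + K = x + K + 3 + 1 by field.
have -> : x + (2 * K + 6) = x + 2 * K + 5 + 1 by field.
rewrite [poch (2 * x + 6 + 2 * K) k.+3]pochSl [poch (2 * x + 6 + 2 * K + 1) k.+2]pochSl.
rewrite [poch (x + K + 3) k.+3]pochSl [poch (x + K + 3 + 1) k.+2]pochS.
rewrite [poch (x + 2 * K + 5) k.+2]pochSl [poch (x + 5 / 2) k.+2]pochS !exprS.
rewrite -[k.+1%:R]natr1.
rewrite (_ : x + K + 3 + 1 + (k%:R + 1) = x + 2 * K + 5); last by rewrite /K; field.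
have n1 : poch (x + K + 3 + 1) k.+1 != 0 by apply: poch_pos_neq0; rewrite -addrA P // addr_gt0.
have n4 : (2 ^+ k : F) != 0 by rewrite expf_neq0 // pnatr_eq0.
rewrite -/K.
move: (2 ^+ k) n4 (poch (x + K + 3 + 1) k.+1) n1 => t n4 p n1.
have n5 : x + 2 * k%:R + 5 != 0 by rewrite N // P2.
have n6 : x + k%:R + 3 != 0 by rewrite N // P.
by field; rewrite n1 n4 n5 n6.
Qed.

Lemma shprod_small T x a : (forall y, T y 0%N = 1) -> (a <= 4)%N -> shprod T x a = T x a.
Proof.
move=> T0; case: a => [|a] a4; first by rewrite /shprod big_ord0 T0.
rewrite /shprod big_ord_recl muln0 addr0 subn0 big1 ?mulr1 // => i _.
by rewrite /= /bump /= (_ : (a.+1 - 4 * (1 + i) = 0)%N) ?T0 //; lia.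
Qed.

Lemma poch1 x : poch x 1 = x. Proof. by rewrite pochS poch0 mul1r addr0. Qed.

Lemma poch2 x : poch x 2 = x * (x + 1). Proof. by rewrite pochS poch1. Qed.

Lemma third_factor_1 x : third_factor x 1 = 1.
Proof. by rewrite /third_factor (_ : (1./2 = 0)%N) // !poch0 !mulr1. Qed.

Lemma third_factor_2 x : third_factor x 2 = x + 1.
Proof. by rewrite /third_factor (_ : (2./2 = 1)%N) // !poch0 poch1 !mulr1. Qed.

Lemma third_factor_3 x : third_factor x 3 = (x + 1) * (x + 7 / 2).
Proof.
rewrite /third_factor (_ : (3./2 = 1)%N) // (_ : ((3 - 1)./2 = 1)%N) // !poch0 !poch1 !mulr1.
by field.
Qed.

Lemma third_factor_4 x : third_factor x 4 = (x + 1) * (x + 2) * (x + 9 / 2) * (x + 7 / 2).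
Proof.
rewrite /third_factor (_ : (4./2 = 2)%N) // (_ : ((4 - 1)./2 = 1)%N) // (_ : ((4 - 2)./2 = 1)%N) //.
by rewrite poch0 !poch1 poch2; field.
Qed.

Lemma sixth_factor_1 x : sixth_factor x 1 = 1.
Proof. by rewrite /sixth_factor (_ : (1./2 = 0)%N) // !poch0 !mulr1. Qed.

Lemma sixth_factor_2 x : sixth_factor x 2 = x + 2.
Proof. by rewrite /sixth_factor (_ : (2./2 = 1)%N) // !poch0 poch1 !mulr1 !mul1r. Qed.

Lemma sixth_factor_3 x : sixth_factor x 3 = (x + 3 / 2) * (x + 3).
Proof.
by rewrite /sixth_factor (_ : (3./2 = 1)%N) // (_ : ((3 - 1)./2 = 1)%N) // !poch0 !poch1 !mulr1.
Qed.

Lemma sixth_factor_4 x : sixth_factor x 4 = (x + 3 / 2) * (x + 5 / 2) * (x + 4) * (x + 5).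
Proof.
rewrite /sixth_factor (_ : (4./2 = 2)%N) // (_ : ((4 - 1)./2 = 1)%N) // (_ : ((4 - 2)./2 = 1)%N) //.
by rewrite poch0 !poch1 poch2; ring.
Qed.

Lemma gt0_neq0 (y : F) : 0 < y -> y != 0. Proof. by move=> y0; rewrite gt_eqF. Qed.

Lemma shprod_third_even k x : 0 <= x -> shprod third_factor x (2 * k).+1 = shprod third_factor x (2 * k) * third_ratio_even x k.
Proof.
move=> x0; rewrite -[(2 * k)%N]addn0; move: k x x0; apply: (@shprod_ratio third_factor third_ratio_even 0 third_factor_0 third_factor_neq0).
- by move=> y _; rewrite !(shprod_small _ third_factor_0) // third_factor_0 third_factor_1 /third_ratio_even muln0 !poch0 expr0; field.
- move=> y y0; rewrite !(shprod_small _ third_factor_0) // third_factor_2 third_factor_3.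
  rewrite /third_ratio_even muln1 !poch1 expr1; field.
  by rewrite gt0_neq0 // -addrA gt0_add ?addr_gt0 // mulr_ge0.
by move=> y j y0; rewrite !addn0; apply: third_ratio_even_step.
Qed.

Lemma shprod_third_odd k x : 0 <= x -> shprod third_factor x (2 * k).+2 = shprod third_factor x (2 * k).+1 * third_ratio_odd x k.
Proof.
move=> x0; rewrite -[(2 * k).+1]addn1; move: k x x0; apply: (@shprod_ratio third_factor third_ratio_odd 1 third_factor_0 third_factor_neq0).
- move=> y _; rewrite !(shprod_small _ third_factor_0) // third_factor_2 third_factor_1.
  by rewrite /third_ratio_odd muln0 !poch0 !poch1 expr1; field.
- move=> y y0; rewrite !(shprod_small _ third_factor_0) // third_factor_4 third_factor_3.
  rewrite /third_ratio_odd muln1 !poch2 !poch1; field.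
  by rewrite gt0_neq0 // -addrA gt0_add ?addr_gt0 // mulr_ge0.
by move=> y j y0; rewrite -!(addnA (2 * j)%N); apply: third_ratio_odd_step.
Qed.

Lemma shprod_sixth_even k x : 0 <= x -> shprod sixth_factor x (2 * k).+1 = shprod sixth_factor x (2 * k) * sixth_ratio_even x k.
Proof.
move=> x0; rewrite -[(2 * k)%N]addn0; move: k x x0; apply: (@shprod_ratio sixth_factor sixth_ratio_even 0 sixth_factor_0 sixth_factor_neq0).
- by move=> y _; rewrite !(shprod_small _ sixth_factor_0) // sixth_factor_0 sixth_factor_1 /sixth_ratio_even muln0 !poch0 expr0; field.
- move=> y y0; rewrite !(shprod_small _ sixth_factor_0) // sixth_factor_2 sixth_factor_3.
  rewrite /sixth_ratio_even muln1 !poch1 expr1; field.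
  by rewrite gt0_neq0 // -addrA gt0_add ?addr_gt0 // mulr_ge0.
by move=> y j y0; rewrite !addn0; apply: sixth_ratio_even_step.
Qed.

Lemma shprod_sixth_odd k x : 0 <= x -> shprod sixth_factor x (2 * k).+2 = shprod sixth_factor x (2 * k).+1 * sixth_ratio_odd x k.
Proof.
move=> x0; rewrite -[(2 * k).+1]addn1; move: k x x0; apply: (@shprod_ratio sixth_factor sixth_ratio_odd 1 sixth_factor_0 sixth_factor_neq0).
- move=> y y0; rewrite !(shprod_small _ sixth_factor_0) // sixth_factor_2 sixth_factor_1.
  rewrite /sixth_ratio_odd muln0 !poch1 expr1; field.
  by rewrite gt0_neq0 // gt0_add.
- move=> y y0; rewrite !(shprod_small _ sixth_factor_0) // sixth_factor_4 sixth_factor_3.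
  rewrite /sixth_ratio_odd muln1 !poch2; field.
  by rewrite !gt0_neq0 // -?addrA gt0_add ?addr_gt0.
by move=> y j y0; rewrite -!(addnA (2 * j)%N); apply: sixth_ratio_odd_step.
Qed.

Lemma odd_dfactS k : odd_dfact k.+1 = (odd_dfact k * (2 * k).+1)%N.
Proof.
rewrite /odd_dfact big_nat_recr //=; congr (_ * _)%N; lia.
Qed.

Lemma fact_double k : ((2 * k)`! = 2 ^ k * k`! * odd_dfact k)%N.
Proof.
elim: k => [|k IH]; first by rewrite /odd_dfact big_geq.
rewrite mulnS !factS IH odd_dfactS expnS; lia.
Qed.

Lemma odd_dfact_neq0 k : (odd_dfact k)%:R != 0 :> F.
Proof.
have := fact_neq0 F (2 * k); rewrite fact_double natrM mulf_eq0 negb_or.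
by case/andP.
Qed.

Definition dfact_den a : F := (\prod_(1 <= i < (a./2).+1) (odd_dfact i)%:R)
        * (\prod_(1 <= i < ((a - 1)./2).+1) (odd_dfact i)%:R).

Lemma dfact_den_even k : dfact_den (2 * k).+1 = dfact_den (2 * k) * (odd_dfact k)%:R.
Proof.
rewrite /dfact_den subn1 /=.
have -> : ((2 * k)./2 = k)%N by lia.
have -> : (uphalf (2 * k) = k)%N by lia.
rewrite -mulrA; congr (_ * _).
case: k => [|k]; first by rewrite !big_geq // /odd_dfact big_geq // mulr1.
have -> : ((2 * k.+1 - 1)./2 = k)%N by lia.
by rewrite big_nat_recr.
Qed.

Lemma dfact_den_odd k : dfact_den (2 * k).+2 = dfact_den (2 * k).+1 * (odd_dfact k.+1)%:R.
Proof.
rewrite /dfact_den !subn1 /=.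
have -> : ((2 * k)./2 = k)%N by lia.
have -> : (uphalf (2 * k) = k)%N by lia.
by rewrite big_nat_recr //= mulrAC.
Qed.

Lemma dfact_den_neq0 a : dfact_den a != 0.
Proof.
by rewrite /dfact_den mulf_neq0 // prodf_seq_neq0; apply/allP => i _; rewrite odd_dfact_neq0.
Qed.

Lemma half_prod_step (g0 g1 : nat -> F) k :
  (\prod_(i < uphalf (2 * k).+1) g0 i * \prod_(i < (2 * k).+1./2) g1 i =
   (\prod_(i < uphalf (2 * k)) g0 i * \prod_(i < (2 * k)./2) g1 i) * g0 k) *
  (\prod_(i < uphalf (2 * k).+2) g0 i * \prod_(i < (2 * k).+2./2) g1 i =
   (\prod_(i < uphalf (2 * k).+1) g0 i * \prod_(i < (2 * k).+1./2) g1 i) * g1 k).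
Proof.
have -> : (uphalf (2 * k).+1 = k.+1)%N by lia.
have -> : ((2 * k).+1./2 = k)%N by lia.
have -> : (uphalf (2 * k) = k)%N by lia.
have -> : ((2 * k)./2 = k)%N by lia.
have -> : (uphalf (2 * k).+2 = k.+1)%N by lia.
have -> : ((2 * k).+2./2 = k.+1)%N by lia.
by rewrite !big_ord_recr /=; split; [rewrite mulrAC | rewrite mulrA].
Qed.

(** The double factorials contribute one factor to each step from a to a + 1. *)
Lemma closed_product (P : nat -> F) (c : F) (r0 r1 g0 g1 : nat -> F) :
  P 0%N = 1 ->
  (forall k, P (2 * k).+1 = P (2 * k)%N * r0 k) ->
  (forall k, P (2 * k).+2 = P (2 * k).+1 * r1 k) ->
  (forall k, g0 k = r0 k / (odd_dfact k)%:R) ->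
  (forall k, g1 k = c * r1 k / (odd_dfact k.+1)%:R) ->
  forall a, c ^+ a./2 / dfact_den a * P a =
    \prod_(i < uphalf a) g0 i * \prod_(i < a./2) g1 i.
Proof.
move=> P0 Pe Po ge go.
have st k : (c ^+ (2 * k)./2 / dfact_den (2 * k) * P (2 * k)%N =
    \prod_(i < uphalf (2 * k)) g0 i * \prod_(i < (2 * k)./2) g1 i) ->
   (c ^+ (2 * k).+1./2 / dfact_den (2 * k).+1 * P (2 * k).+1 =
    \prod_(i < uphalf (2 * k).+1) g0 i * \prod_(i < (2 * k).+1./2) g1 i) /\
   (c ^+ (2 * k).+2./2 / dfact_den (2 * k).+2 * P (2 * k).+2 =
    \prod_(i < uphalf (2 * k).+2) g0 i * \prod_(i < (2 * k).+2./2) g1 i).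
  move=> IH.
  have h1 : c ^+ (2 * k).+1./2 / dfact_den (2 * k).+1 * P (2 * k).+1 =
    \prod_(i < uphalf (2 * k).+1) g0 i * \prod_(i < (2 * k).+1./2) g1 i.
    rewrite (half_prod_step g0 g1 k).1 -IH Pe dfact_den_even ge.
    have -> : ((2 * k).+1./2 = (2 * k)./2)%N by lia.
    have d0 := dfact_den_neq0 (2 * k); have o0 := odd_dfact_neq0 k.
    by field; rewrite d0 o0.
  split=> //; rewrite (half_prod_step g0 g1 k).2 -h1 Po dfact_den_odd go.
  have -> : ((2 * k).+2./2 = (2 * k).+1./2.+1)%N by lia.
  rewrite exprS; have d0 := dfact_den_neq0 (2 * k).+1; have o0 := odd_dfact_neq0 k.+1.
  by field; rewrite d0 o0.
have ev k : c ^+ (2 * k)./2 / dfact_den (2 * k) * P (2 * k)%N =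
    \prod_(i < uphalf (2 * k)) g0 i * \prod_(i < (2 * k)./2) g1 i.
  elim: k => [|k IH].
    by rewrite muln0 P0 /dfact_den !big_geq // !big_ord0 expr0 !mulr1 divr1.
  by rewrite mulnS add2n; apply: (st k IH).2.
move=> a; have [k [->|->]] : exists k, (a = 2 * k \/ a = (2 * k).+1)%N.
  by exists a./2; have := odd_double_half a; case: odd => /=; lia.
- exact: ev.
- exact: (st k (ev k)).1.
Qed.

Lemma third_product x a : 0 <= x -> 2 ^+ a./2 / dfact_den a * shprod third_factor x a =
  \prod_(k < uphalf a) (third_num0 (2 * x) k / third_den0 (2 * x) k) *
  \prod_(k < a./2) (third_num1 (2 * x) k / third_den1 (2 * x) k).
Proof.
move=> x0; apply: (@closed_product (shprod third_factor x) 2 (third_ratio_even x) (third_ratio_odd x)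
  (fun k => third_num0 (2 * x) k / third_den0 (2 * x) k) (fun k => third_num1 (2 * x) k / third_den1 (2 * x) k)).
- by rewrite /shprod big_ord0.
- by move=> k; apply: shprod_third_even.
- by move=> k; apply: shprod_third_odd.
- move=> k; rewrite /third_num0 /third_den0 /third_ratio_even fact_double !natrM natrX.
  have -> : 2 * x / 2 = x by field.
  have f0 := fact_neq0 F k; have o0 := odd_dfact_neq0 k.
  have t0 : 2 ^+ k != 0 :> F by rewrite expf_neq0 // pnatr_eq0.
  have p0 : poch (x + 1 / 2 + k%:R) k != 0.
    by apply: poch_pos_neq0; rewrite -addrA gt0_add // ltr_wpDr // divr_gt0.
  by move: (2 ^+ k) t0 (poch (x + 1 / 2 + k%:R) k) p0 => t t0 p p0; field; rewrite f0 o0 t0 p0.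
move=> k; rewrite /third_num1 /third_den1 /third_ratio_odd factS fact_double odd_dfactS !natrM natrX exprS.
have -> : 2 * x / 2 = x by field.
have f0 := fact_neq0 F k; have o0 := odd_dfact_neq0 k.
have t0 : 2 ^+ k != 0 :> F by rewrite expf_neq0 // pnatr_eq0.
have p0 : poch (x + 3 / 2 + k%:R) k != 0.
  by apply: poch_pos_neq0; rewrite -addrA gt0_add // ltr_wpDr // divr_gt0.
have s0 : (2 * k).+1%:R != 0 :> F by rewrite pnatr_eq0.
move: (2 ^+ k) t0 (poch (x + 3 / 2 + k%:R) k) p0 => t t0 p p0.
by move: (2 * k).+1%:R s0 => s s0; field; rewrite f0 o0 t0 p0 s0.
Qed.

Lemma sixth_product x a : 0 <= x -> (2 / 3) ^+ a./2 / dfact_den a * shprod sixth_factor x a =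
  \prod_(k < uphalf a) (sixth_num0 (2 * x) k / sixth_den0 (2 * x) k) *
  \prod_(k < a./2) (sixth_num1 (2 * x) k / sixth_den1 (2 * x) k).
Proof.
move=> x0; apply: (@closed_product (shprod sixth_factor x) (2 / 3) (sixth_ratio_even x) (sixth_ratio_odd x)
  (fun k => sixth_num0 (2 * x) k / sixth_den0 (2 * x) k) (fun k => sixth_num1 (2 * x) k / sixth_den1 (2 * x) k)).
- by rewrite /shprod big_ord0.
- by move=> k; apply: shprod_sixth_even.
- by move=> k; apply: shprod_sixth_odd.
- move=> k; rewrite /sixth_num0 /sixth_den0 /sixth_ratio_even fact_double !natrM natrX.
  have -> : 2 * x / 2 = x by field.
  have f0 := fact_neq0 F k; have o0 := odd_dfact_neq0 k.
  have t0 : 2 ^+ k != 0 :> F by rewrite expf_neq0 // pnatr_eq0.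
  have p0 : poch (x + 1 + k%:R) k != 0.
    by apply: poch_pos_neq0; rewrite -addrA gt0_add // ltr_wpDr.
  by move: (2 ^+ k) t0 (poch (x + 1 + k%:R) k) p0 => t t0 p p0; field; rewrite f0 o0 t0 p0.
move=> k; rewrite /sixth_num1 /sixth_den1 /sixth_ratio_odd factS fact_double odd_dfactS !natrM natrX exprS.
have -> : 2 * x / 2 = x by field.
have f0 := fact_neq0 F k; have o0 := odd_dfact_neq0 k.
have t0 : 2 ^+ k != 0 :> F by rewrite expf_neq0 // pnatr_eq0.
have p0 : poch (x + 1 + k%:R) k.+1 != 0.
  by apply: poch_pos_neq0; rewrite -addrA gt0_add // ltr_wpDr.
have s0 : (2 * k).+1%:R != 0 :> F by rewrite pnatr_eq0.
move: (2 ^+ k) t0 (poch (x + 1 + k%:R) k.+1) p0 => t t0 p p0.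
by move: (2 * k).+1%:R s0 => s s0; field; rewrite f0 o0 t0 p0 s0.
Qed.

End Products.

(** * Signs, multilinearity and weighted walks *)

(** Counted for functions with values in nat, because particles also occupy places
    outside the array. *)
Definition inversions n (f : 'I_n -> nat) : nat :=
  \sum_(i < n) \sum_(j < n | (i < j)%N) (f j < f i)%N.

(** The Vandermonde product of the values detects the parity of the inversions. *)
Lemma sgr_prod_sub n (f : 'I_n -> nat) : injective f ->
  Num.sg (\prod_(i < n) \prod_(j < n | (i < j)%N) ((f j)%:Z - (f i)%:Z)) =
  (-1) ^+ inversions f.
Proof.
move=> f_inj; rewrite (big_morph _ (@sgrM _) (@sgr1 _)).
rewrite /inversions expr_sum; apply: eq_bigr => i _.
rewrite (big_morph _ (@sgrM _) (@sgr1 _)) expr_sum; apply: eq_bigr => j ij.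
have /eqP fij : f j != f i by apply/eqP => /f_inj eij; rewrite eij ltnn in ij.
case: ltngtP fij => // h _.
  by rewrite ltr0_sg // subr_lt0 ltz_nat.
by rewrite gtr0_sg // subr_gt0 ltz_nat.
Qed.

Lemma odd_perm_inversions n (s : {perm 'I_n}) :
  odd_perm s = odd (inversions (fun i => val (s i))).
Proof.
pose v : 'rV[int]_n := \row_i (i : nat)%:Z.
pose vs : 'rV[int]_n := \row_i (s i : nat)%:Z.
have VE : Vandermonde n vs = col_perm s (Vandermonde n v).
  by apply/matrixP => i j; rewrite !mxE.
have := congr1 (fun M => \det M) VE.
rewrite /= col_permE det_mulmx det_perm odd_permV !det_Vandermonde => e.
have vE (f : 'I_n -> nat) : \prod_(i < n) \prod_(j < n | (i < j)%N)
    ((\row_i (f i)%:Z : 'rV[int]_n) 0 j - (\row_i (f i)%:Z : 'rV[int]_n) 0 i) =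
    \prod_(i < n) \prod_(j < n | (i < j)%N) ((f j)%:Z - (f i)%:Z).
  by apply: eq_bigr => i _; apply: eq_bigr => j _; rewrite !mxE.
rewrite /vs /v !vE in e.
move: e => /(congr1 Num.sg); rewrite sgrM !sgr_prod_sub; last 2 first.
- exact: val_inj.
- by move=> i j /val_inj /perm_inj.
have -> : inversions (fun i : 'I_n => val i) = 0%N.
  rewrite /inversions big1 // => i _; rewrite big1 // => j ij.
  by rewrite ltnNge ltnW.
rewrite expr0 mul1r sgrX sgrN1 -signr_odd => /eqP.
by rewrite -subr_eq0; case: odd; case: odd_perm.
Qed.

Lemma det_indicator (R : comNzRingType) n (f : 'I_n -> nat) :
  injective f -> (forall i, f i < n)%N ->
  \det (\matrix_(i < n, j < n) ((f i == j)%:R : R)) = (-1) ^+ inversions f.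
Proof.
move=> f_inj fn; pose g i := Ordinal (fn i).
have g_inj : injective g by move=> i j /(congr1 val) /f_inj.
pose s := perm g_inj.
have -> : \matrix_(i < n, j < n) ((f i == j)%:R : R) = perm_mx s.
  by apply/matrixP => i j; rewrite !mxE permE -val_eqE.
rewrite det_perm odd_perm_inversions signr_odd; congr (_ ^+ _).
by apply: eq_bigr => i _; apply: eq_bigr => j _; rewrite !permE.
Qed.

(** Multilinearity, with the summation index chosen independently in each row. *)
Lemma det_sum_rows (R : comNzRingType) n (I : finType) (c : 'I_n -> I -> R)
    (A : 'I_n -> I -> 'I_n -> R) :
  \det (\matrix_(i < n, j < n) \sum_(e : I) c i e * A i e j) =
  \sum_(E : {ffun 'I_n -> I}) (\prod_i c i (E i)) * \det (\matrix_(i < n, j < n) A i (E i) j).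
Proof.
rewrite /determinant.
under eq_bigr => s _.
  under eq_bigr => i _ do rewrite mxE.
  rewrite (bigA_distr_bigA (fun i e => c i e * A i e (fun_of_perm s i))) big_distrr /=.
  over.
rewrite exchange_big /=; apply: eq_bigr => E _; rewrite big_distrr /=; apply: eq_bigr => s _.
rewrite big_split /= mulrCA; congr (_ * (_ * _)).
by apply: eq_bigr => i _; rewrite mxE.
Qed.

Section Steps.
Variables (R : comNzRingType) (a : nat).

(** A walker inside the array is a particle that chooses its left or top neighbour; one
    outside is waiting to enter, hence its forced steps. *)
Fixpoint walks (r x j : nat) : R :=
  if r is r'.+1 then
    if (x < a)%N then walks r' x j + (if x is x'.+1 then walks r' x' j else 0)
    else walks r' x.-1 j
  else (x == j)%:R.

Lemma walks_inside r x j : (x < a)%N -> walks r x j = (j <= x)%:R * 'C(r, x - j)%:R.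
Proof.
elim: r x j => [|r IH] x j xa.
  rewrite /= bin0n subn_eq0; case: ltngtP => //=; rewrite ?mul0r ?mulr0 ?mul1r //.
rewrite /= xa IH //; case: x xa => [|x] xa.
  rewrite addr0 leqn0; case: j => [|j] /=; first by rewrite !subnn !bin0.
  by rewrite !mul0r.
rewrite IH; last exact: ltnW.
case: (ltngtP j x.+1) => jx.
- have jx' : (j <= x)%N by rewrite -ltnS.
  by rewrite jx' !mul1r subSn // binS natrD addrC addrC.
- by rewrite leqNgt (ltnW jx) /= !mul0r addr0.
- by rewrite jx ltnn !subnn !bin0 mul0r addr0.
Qed.

Lemma walks_outside r d x j : (0 < a)%N -> x = (a.-1 + d)%N ->
  walks (r + d) x j = walks r a.-1 j.
Proof.
move=> a0 ->; elim: d => [|d IH]; first by rewrite !addn0.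
rewrite addnS /= ltnNge (_ : (a <= a.-1 + d.+1)%N) /=; last by lia.
by rewrite addnS /= IH.
Qed.

Definition walk_step (x : nat) (e : bool) : nat := (x - e)%N.
Definition walk_ok (x : nat) (e : bool) : bool := if (x < a)%N then e ==> (0 < x)%N else e.

Lemma walksS r x j : walks r.+1 x j = \sum_(e : bool) (walk_ok x e)%:R * walks r (walk_step x e) j.
Proof.
rewrite big_bool /= /walk_ok /walk_step; case: (ltnP x a) => xa /=.
  rewrite subn0 mul1r addrC; congr (_ + _).
  by case: x {xa} => [|x] /=; rewrite ?mul0r // subn1 mul1r.
by rewrite mul0r addr0 mul1r subn1.
Qed.

Definition wdet r (f : 'I_a -> nat) := \det (\matrix_(i < a, j < a) walks r (f i) j).

Definition shift (f : 'I_a -> nat) (E : 'I_a -> bool) i := walk_step (f i) (E i).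
Definition okmove f E := [forall i, walk_ok (f i) (E i)] && injectiveb (shift f E).

(** Multilinear expansion of the last step.  The terms in which two walkers meet have
    two equal rows and vanish. *)
Lemma wdetS r f : wdet r.+1 f = \sum_(E : {ffun 'I_a -> bool} | okmove f E) wdet r (shift f E).
Proof.
rewrite /wdet.
have -> : \matrix_(i < a, j < a) walks r.+1 (f i) j =
   \matrix_(i < a, j < a) \sum_(e : bool) (walk_ok (f i) e)%:R * walks r (walk_step (f i) e) j.
  by apply/matrixP => i j; rewrite !mxE walksS.
rewrite (det_sum_rows (fun i e => (walk_ok (f i) e)%:R) (fun i e j => walks r (walk_step (f i) e) j)).
rewrite [RHS]big_mkcond; apply: eq_bigr => E _; rewrite /okmove.
case: forallP => /= [ok|nok].
  rewrite big1 => [|i _]; last by rewrite ok.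
  rewrite mul1r; case: injectiveP => [//|ninj].
  have /injectivePn[i [i' ii' e]] : ~~ injectiveb (shift f E) by apply/injectiveP.
  apply: (determinant_alternate ii') => j; rewrite !mxE.
  by rewrite /shift in e; rewrite e.
have /forallPn[i /negbTE h] : ~~ [forall i, walk_ok (f i) (E i)] by apply/forallP.
by rewrite (bigD1 i) //= h mul0r mul0r.
Qed.

(** Walkers that move by at most one place and do not collide keep their order. *)
Lemma shift_inversions f E : injective f -> okmove f E ->
  inversions (shift f E) = inversions f.
Proof.
move=> f_inj /andP[_ /injectiveP g_inj].
apply: eq_bigr => i _; apply: eq_bigr => j ij; congr (nat_of_bool _).
have fij : f i <> f j by move/f_inj => e; rewrite e ltnn in ij.
have gij : shift f E i <> shift f E j by move/g_inj => e; rewrite e ltnn in ij.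
move: gij; rewrite /shift /walk_step; case: (E i); case: (E j) => /=; lia.
Qed.

End Steps.

(** * Rows of choices as particle histories *)

Section Rows.
Variables (a : nat) (S0 : {set 'I_a}).

(** The values 0, 1, 2 stand for the left, bottom and top neighbour. *)
Definition row_choice : finType := {ffun 'I_a -> 'I_3}.
Implicit Types (rho : row_choice) (S : {set 'I_a}).

(** Whether the rotation brings a lozenge into the last place of a row: this happens
    when the triangle r of row 0, with [S0] its set of triangles not matched
    downwards, chooses its bottom neighbour. *)
Definition wraps r : bool := [exists q : 'I_a, (q == r :> nat) && (q \notin S0)].
Definition not_bottom rho : {set 'I_a} := [set q | val (rho q) != 1%N].
Definition legal rho : bool := [forall q : 'I_a, (val (rho q) == 2%N) ==> (0 < q)%N].

(** The number of triangles that choose the left-pointing triangle of place q, apart from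
    the one in the next row. *)
Definition load rho (b : bool) (q : 'I_a) : nat :=
  (val (rho q) == 0%N) + [exists q' : 'I_a, (q' == q.+1 :> nat) && (val (rho q') == 2%N)]
  + (b && (q.+1 == a)).

(** After the last row the value setT expresses that there is no further choice of a
    bottom neighbour. *)
Definition not_bottom_in r (rows : {ffun 'I_r -> row_choice}) (p : nat) : {set 'I_a} :=
  if insub p is Some p' then not_bottom (rows p') else setT.

(** The two conditions say that the chosen neighbours exist and that every left-pointing
    triangle is chosen exactly once. *)
Definition admissible r (rows : {ffun 'I_r -> row_choice}) : bool :=
  [forall p, legal (rows p)] &&
  [forall p : 'I_r, forall q, load (rows p) (wraps (r - p.+1)) q == (q \in not_bottom_in rows p.+1)].

Definition consrow r (rho : row_choice) (rs : {ffun 'I_r -> row_choice}) : {ffun 'I_r.+1 -> row_choice} :=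
  [ffun i => if unlift ord0 i is Some j then rs j else rho].

Lemma consrow0 r rho (rs : {ffun 'I_r -> row_choice}) : consrow rho rs ord0 = rho.
Proof. by rewrite ffunE unlift_none. Qed.

Lemma consrowS r rho (rs : {ffun 'I_r -> row_choice}) i : consrow rho rs (lift ord0 i) = rs i.
Proof. by rewrite ffunE liftK. Qed.

Lemma sum_consrow (R : nmodType) r (G : {ffun 'I_r.+1 -> row_choice} -> R) :
  \sum_(rows : {ffun 'I_r.+1 -> row_choice}) G rows =
  \sum_(rho : row_choice) \sum_(rs : {ffun 'I_r -> row_choice}) G (consrow rho rs).
Proof.
rewrite pair_big /= (reindex (fun p => consrow p.1 p.2)) //.
exists (fun rows : {ffun 'I_r.+1 -> row_choice} => (rows ord0, [ffun i => rows (lift ord0 i)])).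
  move=> [rho rs] _ /=; rewrite consrow0; congr (_, _); apply/ffunP => i.
  by rewrite ffunE consrowS.
move=> rows _; apply/ffunP => i; rewrite ffunE; case: unliftP => [j|] -> //.
by rewrite ffunE.
Qed.

Lemma not_bottom_in_cons0 r rho (rs : {ffun 'I_r -> row_choice}) : not_bottom_in (consrow rho rs) 0 = not_bottom rho.
Proof.
rewrite /not_bottom_in; case: insubP => [i _ i0|//]; congr (not_bottom _).
by rewrite (_ : i = ord0) ?consrow0 //; apply: val_inj.
Qed.

Lemma not_bottom_in_consS r rho (rs : {ffun 'I_r -> row_choice}) p : not_bottom_in (consrow rho rs) p.+1 = not_bottom_in rs p.
Proof.
rewrite /not_bottom_in; case: insubP => [i ir ip|ip].
  case: insubP => [j _ jp|]; last by rewrite -ltnS ir.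
  by rewrite (_ : i = lift ord0 j) ?consrowS //; apply: val_inj; rewrite ip /= jp.
by case: insubP => // j jr _; rewrite ltnS jr in ip.
Qed.

Lemma admissible_cons r rho (rs : {ffun 'I_r -> row_choice}) :
  admissible (consrow rho rs) = [&& legal rho,
    [forall q, load rho (wraps r) q == (q \in not_bottom_in rs 0)] & admissible rs].
Proof.
apply/andP/and3P => [[/forallP h1 /forallP h2]|[h1 h2 /andP[/forallP h3 /forallP h4]]].
  split.
  - by have := h1 ord0; rewrite consrow0.
  - have := h2 ord0; rewrite consrow0 subSS subn0 => /forallP h; apply/forallP => q.
    by have := h q; rewrite not_bottom_in_consS.
  apply/andP; split; apply/forallP => p.
    by have := h1 (lift ord0 p); rewrite consrowS.
  have /forallP h := h2 (lift ord0 p); apply/forallP => q.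
  by have := h q; rewrite consrowS not_bottom_in_consS /= /bump /= add1n subSS.
split; apply/forallP => p; case: (unliftP ord0 p) => [j|] ->; rewrite ?consrow0 ?consrowS //.
  apply/forallP => q; have /forallP/(_ q) := h4 j.
  by rewrite not_bottom_in_consS /= /bump /= add1n subSS.
apply/forallP => q; move/forallP/(_ q): h2; rewrite not_bottom_in_consS subSS subn0 //.
Qed.

Variable R : comNzRingType.

Definition cnt r S : R := \sum_(rows : {ffun 'I_r -> row_choice} | admissible rows && (not_bottom_in rows 0 == S)) 1.

Definition okrow r S rho := [&& legal rho, not_bottom rho == S & [forall q, (load rho (wraps r) q <= 1)%N]].
Definition nextset r rho : {set 'I_a} := [set q | load rho (wraps r) q == 1%N].

Lemma cntS r S : cnt r.+1 S = \sum_(rho | okrow r S rho) cnt r (nextset r rho).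
Proof.
rewrite /cnt big_mkcond sum_consrow [RHS]big_mkcond; apply: eq_bigr => rho _.
under eq_bigr => rs _ do rewrite admissible_cons not_bottom_in_cons0.
rewrite -big_mkcond /okrow.
case: (boolP (legal rho)) => /= hl; last by rewrite big1.
case: (boolP (not_bottom rho == S)) => /= hS; last by rewrite big1 // => rs; rewrite andbF.
case: forallP => h.
  apply: eq_bigl => rs; rewrite andbT andbC; congr (_ && _).
  apply/forallP/eqP => [e|-> q].
    apply/setP => q; rewrite inE; have /eqP -> := e q; by case: (q \in _).
  by rewrite inE; move: (h q); case: (load _ _ _) => [|[|]].
rewrite big1 // => rs; rewrite andbT => /andP[/forallP e _]; case: h => q.
by rewrite (eqP (e q)); case: (_ \in _).
Qed.

Lemma cnt0 S : cnt 0 S = (S == setT)%:R.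
Proof.
have g (rows : {ffun 'I_0 -> row_choice}) : admissible rows && (not_bottom_in rows 0 == S) = (S == setT).
  rewrite /admissible; have -> : not_bottom_in rows 0 = setT by rewrite /not_bottom_in insubF.
  rewrite eq_sym; case: (S == setT); rewrite ?andbF ?andbT //.
  by apply/andP; split; apply/forallP => -[].
rewrite /cnt (eq_bigl _ _ g); case: (S == setT) => /=; last by rewrite big_pred0.
by rewrite sumr_const card_ffun card_ord expn0.
Qed.

(** The particles inside the array form S.  The particle that will enter because of a
    place q outside S0 still has to walk r - q steps to reach the last place. *)
Definition represents r S (f : 'I_a -> nat) :=
  [/\ injective f,
      forall q : 'I_a, q \in S <-> exists i, f i = q &
      forall x, (a <= x)%N -> (exists i, f i = x) <->
         (exists q : 'I_a, [/\ q \notin S0, (q < r)%N & x = (a.-1 + (r - q))%N])].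

Section Step.
Variables (r : nat) (S : {set 'I_a}) (f : 'I_a -> nat).
Hypothesis rf : represents r.+1 S f.

Let f_inj : injective f. Proof. by case: rf. Qed.

Definition row_of (E : 'I_a -> bool) : row_choice :=
  [ffun q => if [pick i | f i == val q] is Some i then (if E i then inord 2 else ord0) else inord 1].
Definition move_of rho : {ffun 'I_a -> bool} :=
  [ffun i => if insub (f i) is Some q then val (rho (q : 'I_a)) == 2%N else true].

Lemma row_ofE E i (q : 'I_a) : f i = q -> val (row_of E q) = (if E i then 2 else 0)%N.
Proof.
move=> fi; rewrite ffunE; case: pickP => [j /eqP fj|/(_ i)]; last by rewrite fi eqxx.
have -> : j = i by apply: f_inj; rewrite fj fi.
by case: (E i) => //=; rewrite inordK.
Qed.

Lemma row_ofN E (q : 'I_a) : q \notin S -> val (row_of E q) = 1%N.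
Proof.
case: rf => _ fS _ /negP qS; rewrite ffunE; case: pickP => [i /eqP fi|_].
  by case: qS; apply/fS; exists i.
by rewrite /= inordK.
Qed.

Lemma wrapsE (q : 'I_a) : q.+1 = a -> wraps r <-> exists i, f i = a.
Proof.
move=> qa; case: rf => _ _ fv.
have := fv a (leqnn a) => -[h1 h2]; split.
  case/existsP => q' /andP[/eqP q'r q'S]; apply: h2; exists q'; split=> //.
    by rewrite q'r.
  by rewrite q'r; lia.
case/h1 => q' [q'S q'r e]; apply/existsP; exists q'; rewrite q'S andbT; apply/eqP; lia.
Qed.

(** The load counts the walkers that arrive at q: they stay, step down from q + 1, or
    enter the array. *)
Lemma load_row_of E (q : 'I_a) : (forall i, walk_ok a (f i) (E i)) ->
  load (row_of E) (wraps r) q = (\sum_(i < a) (shift f E i == q :> nat))%N.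
Proof.
move=> ok; case: (rf) => _ fS fv.
have -> : (\sum_(i < a) (shift f E i == q :> nat))%N =
   (\sum_(i < a) nat_of_bool ((f i == q :> nat) && ~~ E i) +
    \sum_(i < a) nat_of_bool [&& f i == q.+1 :> nat, E i & (f i < a)] +
    \sum_(i < a) nat_of_bool ((f i == a :> nat) && (q.+1 == a)))%N.
  rewrite -!big_split /=; apply: eq_bigr => i _; rewrite /shift /walk_step.
  have := ok i; rewrite /walk_ok; have qa := ltn_ord q.
  case: ltnP => fa; case: (E i) => //=; try (move=> f0); lia.
rewrite /load; congr (_ + _ + _)%N.
- case: (boolP (q \in S)) => [/fS[i fi]|qS].
    rewrite (row_ofE _ fi) (bigD1 i) //= fi eqxx big1 ?addn0 => [|j ji].
      by case: (E i).
    case: eqP => // fj; case/eqP: ji; apply: f_inj; by rewrite fj fi.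
  rewrite row_ofN // big1 // => i _; case: eqP => // fi.
  by case/negP: qS; apply/fS; exists i.
- case: (ltnP q.+1 a) => qa; last first.
    rewrite big1 => [|i _]; last by case: eqP => //= ->; rewrite [(_ < _)%N]ltnNge qa andbF.
    case: existsP => // -[q' /andP[/eqP e _]]; have := ltn_ord q'; rewrite e; lia.
  pose q1 := Ordinal qa.
  have -> : [exists q' : 'I_a, (q' == q.+1 :> nat) && (val (row_of E q') == 2%N)] =
     (val (row_of E q1) == 2%N).
    apply/existsP/idP => [[q' /andP[/eqP e h]]|h].
      by rewrite (_ : q1 = q') //; apply: val_inj.
    by exists q1; rewrite eqxx.
  case: (boolP (q1 \in S)) => [/fS[i fi]|qS].
    rewrite (row_ofE _ fi) (bigD1 i) //= fi eqxx big1 ?addn0 => [|j ji].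
      by rewrite /= qa; case: (E i).
    case: eqP => // fj; case/eqP: ji; apply: f_inj; by rewrite fj fi.
  rewrite row_ofN // big1 // => i _; case: eqP => // fi.
  by case/negP: qS; apply/fS; exists i.
case: (boolP (q.+1 == a)) => qa; last first.
  by rewrite andbF big1 // => i _; rewrite andbF.
rewrite andbT; case: (boolP (wraps r)) => [/(wrapsE (eqP qa))[i fi]|/negP ni].
  rewrite (bigD1 i) //= fi eqxx big1 // => j ji.
  case: eqP => // fj; case/eqP: ji; apply: f_inj; by rewrite fj fi.
rewrite big1 // => i _; rewrite andbT; case: eqP => // fi.
by case: ni; apply/(wrapsE (eqP qa)); exists i.
Qed.

Lemma row_of_move rho : okrow r.+1.-1 S rho -> row_of (move_of rho) = rho.
Proof.
case/and3P => _ /eqP nbS _; case: (rf) => _ fS _; apply/ffunP => q; apply: val_inj.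
case: (boolP (q \in S)) => [qS|qS].
  have /fS[i fi] := qS.
  rewrite (row_ofE _ fi) ffunE insubT ?fi ?ltn_ord // => qa.
  have -> : Sub (val q) qa = q by apply: val_inj.
  move: qS; rewrite -nbS inE.
  by case: (rho q) => -[|[|[|]]].
rewrite row_ofN //; move: qS; rewrite -nbS inE negbK => /eqP ->.
by [].
Qed.

(** The bound on the load excludes collisions; the absence of a top choice in place 0
    corresponds to the absence of steps below 0. *)
Lemma okmoveE (E : {ffun 'I_a -> bool}) :
  okrow r S (row_of E) && (move_of (row_of E) == E) = okmove f E.
Proof.
case: (rf) => _ fS fv; apply/andP/andP => [[/and3P[lg _ ld] /eqP me]|[/forallP ok /injectiveP inj]].
  have ok i : walk_ok a (f i) (E i).
    rewrite /walk_ok; case: ltnP => fa; last first.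
      by rewrite -me ffunE insubF // ltnNge fa.
    apply/implyP => Ei; move/forallP/(_ (Ordinal fa)): lg.
    by rewrite (@row_ofE E i) // Ei.
  split; first by apply/forallP.
  apply/injectiveP => i j e.
  case: (ltnP (shift f E i) a) => ha.
    move/forallP/(_ (Ordinal ha)): ld; rewrite load_row_of //.
    have [//|ij] := eqVneq i j.
    have ei : (shift f E i == Ordinal ha :> nat) by [].
    have ej : (shift f E j == Ordinal ha :> nat) by rewrite -e.
    by rewrite (bigD1 i) // (bigD1 j) 1?eq_sym // ei ej.
  have Ej : E j by move: ha; rewrite e /shift /walk_step; move: (ok j); rewrite /walk_ok; case: ltnP => //; lia.
  have Ei : E i by move: ha; rewrite /shift /walk_step; move: (ok i); rewrite /walk_ok; case: ltnP => //; lia.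
  apply: f_inj; move: e ha (ok i) (ok j); rewrite /shift /walk_step /walk_ok Ei Ej /=.
  by have ia := ltn_ord i; rewrite !subn1; case: ltnP; case: ltnP => //; lia.
split.
  apply/and3P; split.
  - apply/forallP => q; apply/implyP => /eqP h.
    case: (boolP (q \in S)) => [/fS[i fi]|qS]; last by rewrite row_ofN in h.
    move: (ok i) h; rewrite (row_ofE _ fi) /walk_ok fi ltn_ord; by case: (E i).
  - apply/eqP/setP => q; rewrite inE; case: (boolP (q \in S)) => [/fS[i fi]|qS].
      by rewrite (row_ofE _ fi); case: (E i).
    by rewrite row_ofN.
  apply/forallP => q; rewrite load_row_of //.
  case: (pickP (fun i => shift f E i == q :> nat)) => [i fi|no].
    rewrite (bigD1 i) //= fi big1 // => j ji; case: eqP => // fj.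
    by case/eqP: ji; apply: inj; rewrite fj (eqP fi).
  by rewrite big1 // => i _; rewrite no.
apply/eqP/ffunP => i; rewrite ffunE; case: insubP => [q fa qi|].
  by rewrite (@row_ofE E i) //; case: (E i).
by move=> /negbTE h; have := ok i; rewrite /walk_ok h.
Qed.

Lemma represents_shift (E : {ffun 'I_a -> bool}) : okmove f E ->
  represents r (nextset r (row_of E)) (shift f E).
Proof.
move=> /andP[/forallP ok /injectiveP inj]; case: (rf) => _ fS fv; split=> // [q|x ax].
  rewrite inE load_row_of //; split.
    case: (pickP (fun i => shift f E i == q :> nat)) => [i /eqP fi _|no]; first by exists i.
    by rewrite big1 // => i _; rewrite no.
  case=> i fi; rewrite (bigD1 i) //= fi eqxx big1 // => j ji; case: eqP => // fj.
  by case/eqP: ji; apply: inj; rewrite fj fi.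
split.
  case=> i xi; have fi : f i = x.+1.
    have ia := ltn_ord i.
    by move: (ok i) xi; rewrite /walk_ok /shift /walk_step; case: ltnP => h; case: (E i) => //=; lia.
  have /fv[|q [qS qr e]] : exists i, f i = x.+1 by exists i.
  - by apply: leqW.
  - by have qa := ltn_ord q; exists q; split=> //; lia.
case=> q [qS qr e]; have /fv[|i fi] : exists q : 'I_a, [/\ q \notin S0, (q < r.+1)%N & x.+1 = (a.-1 + (r.+1 - q))%N].
- by have qa := ltn_ord q; exists q; split=> //; lia.
- by apply: leqW.
exists i; have := ok i; rewrite /walk_ok /shift /walk_step fi ltnNge leqW //= => ->.
by rewrite subn1.
Qed.

End Step.

(** Induction on the number of rows: on both sides the first row is summed over the
    admissible moves. *)
Lemma cnt_wdet r S (f : 'I_a -> nat) : represents r S f ->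
  cnt r S = (-1) ^+ inversions f * wdet R r f.
Proof.
elim: r S f => [|r IH] S f rf.
  have fa i : (f i < a)%N.
    case: (ltnP (f i) a) => // h; case: rf => _ _ /(_ _ h)[]; case; first by exists i.
    by move=> q [_]; rewrite ltn0.
  case: (rf) => f_inj fS _.
  rewrite cnt0 /wdet det_indicator // -expr2 sqrr_sign.
  have -> : S == setT; last by [].
  apply/eqP/setP => q; rewrite inE; apply/fS.
  have g_inj : injective (fun i => Ordinal (fa i)) by move=> i j /(congr1 val) /f_inj.
  by exists (invF g_inj q); have /(congr1 val) := f_invF g_inj q.
rewrite cntS wdetS mulr_sumr.
rewrite (reindex_onto (fun E : {ffun 'I_a -> bool} => row_of f E) (move_of f)) /=; last exact: (row_of_move rf).
rewrite (eq_bigl _ _ (okmoveE rf)); apply: eq_bigr => E ok.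
case: (rf) => f_inj _ _.
by rewrite (IH _ _ (represents_shift rf ok)) (shift_inversions f_inj ok).
Qed.

End Rows.

(** * Summation over the first row *)

Section Total.
Variables (R : comNzRingType) (a m : nat) (w : R).

(** A triangle q of row 0 that chooses its bottom neighbour creates a particle in the last
    place, a - 1, after a + m - q steps; its waiting place is that far beyond it. *)
Definition start (S0 : {set 'I_a}) (q : 'I_a) : nat :=
  if q \in S0 then nat_of_ord q else (2 * a + m - 1 - q)%N.

Lemma start_represents S0 : represents S0 (a + m) S0 (start S0).
Proof.
split.
- move=> i j; have ia := ltn_ord i; have ja := ltn_ord j; rewrite /start => e.
  apply: val_inj => /=; move: e.
  by case: (i \in S0); case: (j \in S0); move: ia ja; clear; lia.
- move=> q; split=> [qS|]; first by exists q; rewrite /start qS.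
  case=> i; rewrite /start; case: ifP => [iS /val_inj <- // | _ e].
  by have := ltn_ord i; have := ltn_ord q; move: e; clear; lia.
move=> x ax; split=> [[i ]|[q [qS qr ->]]].
  rewrite /start; case: ifP => [iS e|iS e]; have ia := ltn_ord i.
    by rewrite -e leqNgt ia in ax.
  by exists i; rewrite iS; split=> //; move: e ia; clear; lia.
exists q; rewrite /start (negbTE qS); have := ltn_ord q; clear -qr; lia.
Qed.

Lemma start_inversions S0 :
  inversions (start S0) = (\sum_(i < a | i \notin S0) (a - 1 - i))%N.
Proof.
rewrite /inversions [RHS]big_mkcond; apply: eq_bigr => i _.
transitivity (\sum_(j < a | (i < j)%N) (i \notin S0 : nat))%N.
  apply: eq_bigr => j ij; have ia := ltn_ord i; have ja := ltn_ord j; congr nat_of_bool.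
  by rewrite /start; case: (i \in S0); case: (j \in S0) => /=; move: ij ia ja; clear; lia.
have cardE : (\sum_(j < a | (i < j)%N) 1 = a - 1 - i)%N.
  have -> : (\sum_(j < a | (i < j)%N) 1 = \sum_(i.+1 <= j < a) 1)%N.
    by rewrite (@big_nat_widenl _ _ _ i.+1 0) // big_mkord; apply: eq_bigl => j.
  by rewrite sum_nat_const_nat muln1; clear; lia.
case: (i \in S0) => /=; first by rewrite big1.
by rewrite cardE.
Qed.

(** The first summand of row i belongs to i in S0, the second to i outside S0, with the
    sign of the waiting places. *)
Definition kmat : 'M[R]_a := \matrix_(i < a, j < a)
   (w * ((j <= i)%N%:R * 'C(a + m, i - j)%:R) + (-1) ^+ (a - 1 - i) * 'C(i, a - 1 - j)%:R).

Lemma sum_rows_det :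
  \sum_(rows : {ffun 'I_(a + m) -> row_choice a} | admissible (not_bottom_in rows 0) rows) w ^+ #|not_bottom_in rows 0| =
  \det kmat.
Proof.
rewrite (partition_big (fun rows => not_bottom_in rows 0) xpredT) //=.
transitivity (\sum_(S0 : {set 'I_a}) w ^+ #|S0| *
   ((-1) ^+ (\sum_(i < a | i \notin S0) (a - 1 - i))%N * wdet R (a + m) (start S0))).
  apply: eq_bigr => S0 _; rewrite -start_inversions -(cnt_wdet R (start_represents S0)) /cnt.
  rewrite mulr_sumr; apply: eq_big => [rows|rows /andP[_ /eqP ->]]; last by rewrite mulr1.
  by case: eqP => [->|]; rewrite ?andbT ?andbF.
have -> : kmat = \matrix_(i < a, j < a) \sum_(e : bool)
     (if e then w else (-1) ^+ (a - 1 - i)) *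
     (walks R a (a + m) (if e then nat_of_ord i else (2 * a + m - 1 - i)%N) j).
  apply/matrixP => i j; rewrite !mxE big_bool /=; congr (_ + _).
    by rewrite walks_inside.
  have ia := ltn_ord i; have ja := ltn_ord j; have a0 : (0 < a)%N by move: ia; clear; lia.
  have -> : (a + m = i + (a + m - i))%N by move: ia; clear; lia.
  rewrite (@walks_outside _ _ _ _ (2 * a + m - 1 - i)%N) //; last by move: ia; clear; lia.
  have j1 : (j <= a.-1)%N by move: ja; clear; lia.
  rewrite walks_inside; last by move: a0; clear; lia.
  rewrite j1 mul1r.
  by rewrite -subn1.
rewrite (det_sum_rows (fun i (e : bool) => if e then w else (-1) ^+ (a - 1 - i))
   (fun i (e : bool) (j : 'I_a) => walks R a (a + m) (if e then nat_of_ord i else (2 * a + m - 1 - i)%N) j)).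
rewrite (reindex (fun E : {ffun 'I_a -> bool} => [set i | E i])) /=; last first.
  exists (fun S : {set 'I_a} => [ffun i => i \in S]) => [E _|S _].
    by apply/ffunP => i; rewrite ffunE inE.
  by apply/setP => i; rewrite inE ffunE.
apply: eq_bigr => E _; rewrite mulrA; congr (_ * _); last first.
  by congr (\det _); apply/matrixP => i j; rewrite !mxE /start inE.
rewrite [RHS](bigID (fun i => E i)) /=; congr (_ * _).
  rewrite (eq_bigr (fun=> w)) => [|i ->//]; rewrite prodr_const; congr (_ ^+ _).
  by apply: eq_card => i; rewrite inE.
rewrite expr_sum; apply: eq_big => [i|i]; rewrite inE // => /negbTE ->.
by [].
Qed.

End Total.

(** * Reduction of the determinant *)

Section AlternatingSums.
Variable R : comNzRingType.

(** The entries of the product of the binomials C(M, j) with the unitriangular matrix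
    that is used in [det_kmat]. *)
Definition altconv (M A l : nat) : R :=
  \sum_(j < l.+1) 'C(M, j)%:R * ((-1) ^+ (l - j) * 'C(A - j, l - j)%:R).

Lemma altconv0 M A : altconv M A 0 = 1.
Proof. by rewrite /altconv big_ord1 /= !bin0 expr0 !mul1r. Qed.

Lemma altconvS M A l : altconv M.+1 A.+1 l.+1 = altconv M A.+1 l.+1 + altconv M A l.
Proof.
rewrite /altconv [LHS]big_ord_recl [X in _ = X + _]big_ord_recl -addrA; congr (_ + _).
  by rewrite !bin0.
rewrite -big_split /=; apply: eq_bigr => j _.
by rewrite /bump /= add1n binS natrD mulrDl !subSS.
Qed.

(** Pascal's rule in the first argument; the convolution behaves like C(M - A - 1 + l, l)
    continued to M <= A. *)
Lemma altconv_low M A l : (M <= A)%N -> (l <= A)%N -> altconv M A l = (-1) ^+ l * 'C(A - M, l)%:R.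
Proof.
elim: M A l => [|M IH] A l MA lA.
  rewrite /altconv big_ord_recl big1 => [|i _]; last by rewrite /= bin0n mul0r.
  by rewrite /= bin0 !subn0 mul1r addr0.
case: l lA => [|l] lA; first by rewrite altconv0 bin0 mulr1.
case: A MA lA => // A MA lA; rewrite altconvS !IH //; last exact: leqW.
by rewrite subSn // binS natrD subSS exprS; ring.
Qed.

Lemma altconv_high d A l : (l <= A)%N -> altconv (A + d.+1) A l = 'C(d + l, l)%:R.
Proof.
elim: l d A => [|l IHl] d A lA; first by rewrite altconv0 bin0.
case: A lA => // A lA; elim: d => [|d IHd].
  have := IHl 0 A lA; rewrite !addn1 add0n binn altconvS (altconv_low (leqnn A.+1)) // subnn => ->.
  by rewrite !add0n binn bin0n mulr0 add0r.
rewrite addnS altconvS IHd addSnnS IHl // [in RHS]addSn [in RHS]binS natrD addSn.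
by rewrite -addnS.
Qed.

(** Pascal's rule reduces the pair (r + 1, l + 1) to (r, l). *)
Lemma binomial_inversion n r l : (r < n)%N ->
  \sum_(i < n) 'C(r, i)%:R * ((-1) ^+ i * 'C(i, l)%:R) = (-1) ^+ l * (r == l)%:R :> R.
Proof.
elim: r l n => [|r IH] l n rn.
  case: n rn => // n _; rewrite big_ord_recl big1 => [|i _]; last by rewrite /= bin0n mul0r.
  rewrite /= bin0 bin0n addr0 !mul1r eq_sym.
  by case: l => [|l]; rewrite ?mulr1 ?mulr0.
case: n rn => // n rn.
have E : \sum_(i < n.+1) 'C(r.+1, i)%:R * ((-1) ^+ i * 'C(i, l)%:R) =
   \sum_(i < n.+1) 'C(r, i)%:R * ((-1) ^+ i * 'C(i, l)%:R) -
   \sum_(i < n) 'C(r, i)%:R * ((-1) ^+ i * 'C(i.+1, l)%:R) :> R.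
  rewrite [LHS]big_ord_recl [X in _ = X - _]big_ord_recl !bin0 -addrA; congr (_ + _).
  rewrite -sumrB; apply: eq_bigr => i _; rewrite /= /bump /= add1n binS natrD exprS.
  by ring.
rewrite E IH; last exact: leqW.
case: l {E} => [|l].
  rewrite (eq_bigr (fun i : 'I_n => 'C(r, i)%:R * ((-1) ^+ i * 'C(i, 0)%:R))) => [|i _]; last by rewrite !bin0.
  by rewrite IH // subrr mulr0.
rewrite (eq_bigr (fun i : 'I_n => 'C(r, i)%:R * ((-1) ^+ i * 'C(i, l.+1)%:R) +
    'C(r, i)%:R * ((-1) ^+ i * 'C(i, l)%:R))) => [|i _]; last first.
  by rewrite binS natrD; ring.
by rewrite big_split /= !IH // eqSS exprS; ring.
Qed.

End AlternatingSums.

Lemma det_rev (R : comNzRingType) n (A : 'M[R]_n) :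
  \det (\matrix_(i, j) A (rev_ord i) (rev_ord j)) = \det A.
Proof.
pose s := perm (@rev_ord_inj n).
have -> : \matrix_(i, j) A (rev_ord i) (rev_ord j) = row_perm s (col_perm s A).
  by apply/matrixP => i j; rewrite !mxE !permE.
rewrite row_permE col_permE !det_mulmx !det_perm odd_permV.
by rewrite mulrCA mulrC -mulrA mulr1_sqrr || rewrite mulrCA -signr_addb addbb mulr1.
Qed.

Lemma poch_bin (F : numFieldType) (x k : nat) :
  poch (x%:R + 1 : F) k / k`!%:R = 'C(x + k, k)%:R.
Proof.
elim: k => [|k IH]; first by rewrite poch0 bin0 fact0 divr1.
have k0 : k.+1%:R != 0 :> F by rewrite pnatr_eq0.
apply: (mulfI k0); rewrite pochS factS natrM.
transitivity (poch (x%:R + 1) k / k`!%:R * (x%:R + 1 + k%:R) : F).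
  have f0 : k`!%:R != 0 :> F by rewrite pnatr_eq0 -lt0n fact_gt0.
  move: (x%:R + 1 + k%:R) (k.+1%:R : F) k0 (k`!%:R : F) f0 (poch _ k) => y K k0 f f0 p.
  by field; rewrite f0 k0.
rewrite IH addnS -natrM -mul_bin_diag natrM mulrC; congr (_ * _).
by rewrite -addn1 !natrD; ring.
Qed.

Section Kmat.
Variables (F : numFieldType) (a m : nat) (w : F).

(** After reversing the order of the indices, multiply by P = C(r, i) on the left and by
    Q = (-1)^(l-j) C(a-1-j, l-j) on the right, both unitriangular.  Q turns the sign part
    into (-1)^(i+l) C(i, l), the inverse of P.  P turns the weighted part into C(a+m+r, j)
    by the Vandermonde convolution, and Q turns this into C(m+r+l, l). *)
Lemma det_kmat : \det (kmat a m w) = gdet w a m%:R.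
Proof.
rewrite -det_rev.
pose P : 'M[F]_a := \matrix_(r, i) 'C(r, i)%:R.
pose Q : 'M[F]_a := \matrix_(j, l)
   ((j <= l)%N%:R * ((-1) ^+ (l - j) * 'C(a - 1 - j, l - j)%:R)).
have dP : \det P = 1.
  rewrite det_trig; first by rewrite big1 // => i _; rewrite mxE binn.
  by apply/is_trig_mxP => i j ij; rewrite mxE bin_small.
have dQ : \det Q = 1.
  rewrite -det_tr det_trig.
    by rewrite big1 // => i _; rewrite !mxE leqnn subnn bin0 expr0 !mul1r.
  by apply/is_trig_mxP => i j ij; rewrite !mxE leqNgt ij mul0r.
set K := \matrix_(i, j) _.
rewrite -[LHS]mul1r -{1}dP -[LHS]mulr1 -{1}dQ -!det_mulmx /gdet; congr (\det _).
have convQ M (l : 'I_a) :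
    \sum_(j < a) 'C(M, j)%:R * Q j l = altconv F M (a - 1) l.
  rewrite /altconv (big_ord_widen a (fun j => 'C(M, j)%:R * ((-1) ^+ (l - j) * 'C(a - 1 - j, l - j)%:R))) //.
  rewrite [RHS]big_mkcond; apply: eq_bigr => j _; rewrite mxE ltnS.
  by case: leqP; rewrite ?mul1r // mul0r mulr0.
apply/matrixP => r l; have la := ltn_ord l; have ra := ltn_ord r.
have PKE (j : 'I_a) : (P *m K) r j =
   \sum_(i < a) 'C(r, i)%:R * ((-1) ^+ i * 'C(a - 1 - i, j)%:R) + w * 'C(a + m + r, j)%:R.
  rewrite mxE.
  have -> : 'C(a + m + r, j)%:R = \sum_(i < a) 'C(r, i)%:R * ((i <= j)%N%:R * 'C(a + m, j - i)%:R) :> F.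
    rewrite addnC -binomial.Vandermonde natr_sum.
    rewrite (big_ord_widen a (fun i => ('C(r, i) * 'C(a + m, j - i))%:R)) //.
    rewrite [LHS]big_mkcond; apply: eq_bigr => i _; rewrite ltnS.
    by case: leqP; rewrite ?mul1r ?natrM // mul0r mulr0.
  rewrite mulr_sumr -big_split /=; apply: eq_bigr => i _; rewrite !mxE /=.
  have ia := ltn_ord i; have ja := ltn_ord j.
  have -> : ((a - j.+1 <= a - i.+1) = (i <= j))%N by move: ia ja; clear; lia.
  have -> : (a - 1 - (a - i.+1) = i)%N by move: ia; clear; lia.
  have -> : (a - 1 - (a - j.+1) = j)%N by move: ja; clear; lia.
  have -> : (a - i.+1 = a - 1 - i)%N by move: ia; clear; lia.
  case: leqP => ij; last by rewrite !mul0r !mulr0 add0r addr0.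
  have -> : (a - 1 - i - (a - j.+1) = j - i)%N by move: ia ja ij; clear; lia.
  by rewrite !mul1r; ring.
rewrite mxE; under eq_bigr => j _ do rewrite PKE mulrDl.
rewrite big_split /= mxE; congr (_ + _).
  under eq_bigr => j _ do rewrite mulr_suml.
  rewrite exchange_big /=.
  transitivity ((-1) ^+ l * \sum_(i < a) 'C(r, i)%:R * ((-1) ^+ i * 'C(i, l)%:R) : F).
    rewrite mulr_sumr; apply: eq_bigr => i _; have ia := ltn_ord i.
    under eq_bigr => j _ do rewrite -!mulrA.
    rewrite -!mulr_sumr convQ altconv_low; [|move: ia; clear; lia|move: la; clear; lia].
    have -> : (a - 1 - (a - 1 - i) = i)%N by move: ia; clear; lia.
    by ring.
  by rewrite binomial_inversion // mulrA -expr2 sqrr_sign mul1r -val_eqE.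
under eq_bigr => j _ do rewrite -mulrA.
rewrite -mulr_sumr convQ; congr (_ * _).
have -> : (a + m + r = a - 1 + (m + r).+1)%N by move: ra; clear; lia.
rewrite altconv_high; last by move: la; clear; lia.
by rewrite -poch_bin natrD addrAC.
Qed.

End Kmat.

(** * Tilings as choices of neighbours *)

Section Matching.
Variables a m : nat.
Implicit Types (c d : cell a m) (e : 'I_3) (T : {set {set cell a m}}).

(** The neighbours are numbered so that the rotation adds 1 modulo 3. *)
Definition nbr (e : 'I_3) c d : bool :=
  match val e with 0%N => left_nbr c d | 1%N => bottom_nbr c d | _ => top_nbr c d end.

Lemma cell_eq c d : cx c = cx d -> cy c = cy d -> cz c = cz d -> c = d.
Proof.
case: c d => [[x y] z] [[x' y'] z']; rewrite /cx /cy /cz /= => ex ey ez.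
by congr (_, _, _); apply: val_inj.
Qed.

Lemma nbr_or c d : [|| left_nbr c d, bottom_nbr c d | top_nbr c d] = [exists e, nbr e c d].
Proof.
apply/or3P/existsP => [[h|h|h]|[[[|[|[|//]]] e3]]]; rewrite /nbr /=.
- by exists (inord 0); rewrite inordK.
- by exists (inord 1); rewrite inordK.
- by exists (inord 2); rewrite inordK.
- by constructor 1.
- by constructor 2.
- by constructor 3.
Qed.

Lemma nbr_coord e c d : nbr e c d ->
  [/\ (cx c = cx d + (val e == 0%N))%N, (cy c = cy d + (val e == 1%N))%N &
      (cz c = cz d + (val e == 2%N))%N].
Proof.
by case: e => [[|[|[|//]]] e3]; rewrite /nbr /= => /and3P[/eqP h1 /eqP h2 /eqP h3];
  rewrite ?addn0 ?addn1.
Qed.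

Lemma coord_nbr e c d :
  (cx c = cx d + (val e == 0%N))%N -> (cy c = cy d + (val e == 1%N))%N ->
  (cz c = cz d + (val e == 2%N))%N -> nbr e c d.
Proof.
by case: e => [[|[|[|//]]] e3]; rewrite /nbr /= ?addn0 ?addn1 => h1 h2 h3;
  apply/and3P; rewrite h1 h2 h3 !eqxx.
Qed.

Lemma nbr_funl e c d d' : nbr e c d -> nbr e c d' -> d = d'.
Proof.
move=> /nbr_coord[x y z] /nbr_coord[x' y' z'].
by apply: cell_eq; [move: x'; rewrite x|move: y'; rewrite y|move: z'; rewrite z] => /addIn.
Qed.

Lemma nbr_funr e c c' d : nbr e c d -> nbr e c' d -> c = c'.
Proof.
move=> /nbr_coord[x y z] /nbr_coord[x' y' z'].
by apply: cell_eq; rewrite ?x ?y ?z.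
Qed.

Lemma nbr_dir e e' c d : nbr e c d -> nbr e' c d -> e = e'.
Proof.
move=> /nbr_coord[x y z] /nbr_coord[x' y' z']; apply: val_inj.
move: x' y' z'; rewrite {}x {}y {}z => /addnI x /addnI y /addnI z.
by move: x y z; case: e => [[|[|[|//]]] ?]; case: e' => [[|[|[|//]]] ?].
Qed.

Lemma nbr_pointing e c d : nbr e c d -> right_pointing c = left_pointing d.
Proof.
move=> /nbr_coord[x y z]; rewrite /right_pointing /left_pointing {}x {}y {}z.
case: e => [[|[|[|//]]] ?] /=; congr (_ == _); move: (cx d) (cy d) (cz d); clear; lia.
Qed.

Lemma right_not_left c : right_pointing c -> left_pointing c = false.
Proof.
by rewrite /right_pointing /left_pointing => /eqP <-; rewrite eqn_leq ltnn.
Qed.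

Lemma rot_inj : injective (@rot a m).
Proof. by move=> [[x y] z] [[x' y'] z'] [-> -> ->]. Qed.

Lemma rot3 c : rot (rot (rot c)) = c.
Proof. by case: c => [[x y] z]. Qed.

Lemma nbr_rot e c d : nbr (e + 1) (rot c) (rot d) = nbr e c d.
Proof.
by case: e => [[|[|[|//]]] ?]; rewrite /nbr /= /left_nbr /bottom_nbr /top_nbr /rot /cx /cy /cz /=;
  do 3 case: (_ == _).
Qed.

Lemma right_rot c : right_pointing (rot c) = right_pointing c.
Proof. by rewrite /right_pointing /rot /cx /cy /cz /= -addnA addnC. Qed.

Lemma left_rot c : left_pointing (rot c) = left_pointing c.
Proof. by rewrite /left_pointing /rot /cx /cy /cz /= -addnA addnC. Qed.

Lemma core_rot c : in_core (rot c) = in_core c.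
Proof. by rewrite /in_core /rot /cx /cy /cz /= andbC andbA. Qed.

Definition rcells : {set cell a m} := [set c | right_pointing c & ~~ in_core c].
Definition lcells : {set cell a m} := [set c | left_pointing c & ~~ in_core c].

Lemma rcells_rot c : (rot c \in rcells) = (c \in rcells).
Proof. by rewrite !inE right_rot core_rot. Qed.

Lemma lcells_rot c : (rot c \in lcells) = (c \in lcells).
Proof. by rewrite !inE left_rot core_rot. Qed.

Lemma hexagonE c : (c \in cored_hexagon a m) = (c \in rcells) || (c \in lcells).
Proof. by rewrite !inE andb_orl. Qed.

Lemma rl_disj c : c \in rcells -> c \in lcells -> False.
Proof. by rewrite !inE => /andP[/right_not_left ->]. Qed.

Implicit Type mu : cell a m -> 'I_3.

Definition tiling_of mu : {set {set cell a m}} :=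
  [set [set x.1; x.2] | x : cell a m * cell a m & (x.1 \in rcells) && nbr (mu x.1) x.1 x.2].

(** For a tiling T the default value ord0 is not reached on the right-pointing triangles
    outside the core. *)
Definition dir_of T c : 'I_3 :=
  odflt ord0 [pick e | [exists d, nbr e c d && ([set c; d] \in T)]].

Definition perfect mu :=
  (forall c, c \in rcells -> exists2 d, d \in lcells & nbr (mu c) c d) /\
  (forall d, d \in lcells -> #|[set c in rcells | nbr (mu c) c d]| = 1%N).

Lemma tiling_ofP mu l : reflect
  (exists c d, [/\ c \in rcells, nbr (mu c) c d & l = [set c; d]]) (l \in tiling_of mu).
Proof.
apply: (iffP imsetP) => [[[c d]]|[c [d [cR n ->]]]].
  by rewrite inE /= => /andP[cR n] ->; exists c, d.
by exists (c, d); rewrite // inE /= cR.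
Qed.

Section Tiling.
Variable T : {set {set cell a m}}.
Hypothesis tT : is_tiling T.

Lemma tiling_lozenge l : l \in T ->
  exists c d e, [/\ c \in rcells, d \in lcells, nbr e c d & l = [set c; d]].
Proof.
case/andP: tT => pT /forallP/(_ l) /implyP h lT.
case/existsP: (h lT) => c /existsP[d /and4P[rc ld n /eqP el]].
move: n; rewrite nbr_or => /existsP[e n].
have sub x : x \in l -> x \in cored_hexagon a m.
  by rewrite -(cover_partition pT) => xl; apply/bigcupP; exists l.
have cH : c \in cored_hexagon a m by apply: sub; rewrite el !inE eqxx.
have dH : d \in cored_hexagon a m by apply: sub; rewrite el !inE eqxx orbT.
exists c, d, e; split=> //.
  by move: cH; rewrite !inE rc => /andP[_ ->].
by move: dH; rewrite !inE ld => /andP[_ ->].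
Qed.

Lemma tiling_unique l l' x : l \in T -> l' \in T -> x \in l -> x \in l' -> l = l'.
Proof.
case/andP: tT => /and3P[_ /trivIsetP tr _] _ lT l'T xl xl'.
have [//|ne] := eqVneq l l'.
by have /disjoint_setI0/setP/(_ x) := tr _ _ lT l'T ne; rewrite !inE xl xl'.
Qed.

Lemma tiling_cover x : x \in cored_hexagon a m -> exists2 l, l \in T & x \in l.
Proof.
by case/andP: tT => pT _; rewrite -(cover_partition pT) => /bigcupP[l lT xl]; exists l.
Qed.

Lemma tiling_pair c d c' d' : c \in rcells -> d' \in lcells -> c' \in rcells -> d \in lcells ->
  [set c; d] = [set c'; d'] -> c = c' /\ d = d'.
Proof.
move=> cR d'L c'R dL e; split.
  have : c \in [set c'; d'] by rewrite -e !inE eqxx.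
  by rewrite !inE => /orP[/eqP //|/eqP ec]; case: (@rl_disj c) => //; rewrite ec.
have : d \in [set c'; d'] by rewrite -e !inE eqxx orbT.
by rewrite !inE => /orP[/eqP ed|/eqP //]; case: (@rl_disj d) => //; rewrite ed.
Qed.

Lemma dir_ofP c : c \in rcells -> exists d,
  [/\ d \in lcells, nbr (dir_of T c) c d & [set c; d] \in T].
Proof.
move=> cR; have [|l lT cl] := @tiling_cover c; first by rewrite hexagonE cR.
have [c' [d [e [c'R dL n el]]]] := tiling_lozenge lT.
have ec : c = c'.
  by move: cl; rewrite el !inE => /orP[/eqP //|/eqP ec]; case: (@rl_disj c) => //; rewrite ec.
rewrite /dir_of; case: pickP => /= [e' /existsP[d' /andP[n' l'T]]|/(_ e)].
  exists d'; split=> //.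
  have e2 := tiling_unique l'T lT (set21 _ _) cl.
  have : d' \in l by rewrite -e2 set22.
  rewrite el in_set2 => /orP[/eqP ed|/eqP -> //].
  have := nbr_pointing n'; rewrite ed; move: (c'R) (cR).
  by rewrite !in_set => /andP[h _] /andP[-> _]; rewrite (right_not_left h).
by move=> /existsP[]; exists d; rewrite ec n -el.
Qed.

Lemma dir_of_eq c d e : c \in rcells -> nbr e c d -> [set c; d] \in T -> dir_of T c = e.
Proof.
move=> cR n lT; have [d' [d'L n' l'T]] := dir_ofP cR.
have e2 := tiling_unique l'T lT (set21 _ _) (set21 _ _).
have : d' \in [set c; d] by rewrite -e2 set22.
rewrite !inE => /orP[/eqP ed|/eqP ed]; first by case: (@rl_disj d') => //; rewrite ed.
by apply: (nbr_dir n'); rewrite ed.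
Qed.

Lemma tiling_of_dir : tiling_of (dir_of T) = T.
Proof.
apply/setP => l; apply/tiling_ofP/idP => [[c [d [cR n ->]]]|lT].
  by have [d' [_ n' l'T]] := dir_ofP cR; rewrite (nbr_funl n n').
have [c [d [e [cR dL n el]]]] := tiling_lozenge lT.
by exists c, d; split=> //; rewrite (dir_of_eq cR n) // -el.
Qed.

(** Together with [tiling_of_dir], [perfect_tiling] and [dir_of_tiling], this
    identifies tilings with perfect choices. *)
Lemma perfect_dir : perfect (dir_of T).
Proof.
split=> [c cR|d dL]; first by have [d [dL n _]] := dir_ofP cR; exists d.
have [|l lT dl] := @tiling_cover d; first by rewrite hexagonE dL orbT.
have [c [d' [e [cR d'L n el]]]] := tiling_lozenge lT.
have ed : d = d'.
  by move: dl; rewrite el !inE => /orP[/eqP ed|/eqP //]; case: (@rl_disj d) => //; rewrite ed.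
have cT : [set c; d] \in T by rewrite ed -el.
rewrite (_ : [set _ in _ | _] = [set c]) ?cards1 //.
apply/setP => c'; rewrite in_set in_set1; apply/andP/eqP => [[c'R n']|->].
  have [d2 [_ n2 l2]] := dir_ofP c'R; rewrite (nbr_funl n2 n') in l2.
  have e2 := tiling_unique l2 cT (set22 _ _) (set22 _ _).
  by have [] := tiling_pair c'R dL cR dL e2.
have nd : nbr e c d by rewrite ed.
by split=> //; rewrite (dir_of_eq cR nd cT).
Qed.

End Tiling.

Lemma perfect_tiling mu : perfect mu -> is_tiling (tiling_of mu).
Proof.
case=> pc pd; apply/andP; split; last first.
  apply/forallP => l; apply/implyP => /tiling_ofP[c [d [cR n ->]]].
  apply/existsP; exists c; apply/existsP; exists d; rewrite nbr_or eqxx andbT.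
  move: (cR); rewrite inE -(nbr_pointing n) => /andP[-> _] /=; apply/existsP; by exists (mu c).
have dL c d : c \in rcells -> nbr (mu c) c d -> d \in lcells.
  by move=> cR n; have [d' d'L n'] := pc _ cR; rewrite (nbr_funl n n').
apply/and3P; split.
- apply/eqP/setP => x; rewrite hexagonE; apply/bigcupP/orP => [[l]|[xR|xL]].
  + case/tiling_ofP=> c [d [cR n ->]]; rewrite !in_set2 => /orP[/eqP ->|/eqP ->]; [by left|right].
    exact: dL n.
  + have [d _ n] := pc _ xR; exists [set x; d]; last exact: set21.
    by apply/tiling_ofP; exists x, d.
  + have /eqP/cards1P[c ec] := pd _ xL.
    have : c \in [set c in rcells | nbr (mu c) c x] by rewrite ec set11.
    rewrite in_set => /andP[cR n]; exists [set c; x]; last exact: set22.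
    by apply/tiling_ofP; exists c, x.
- apply/trivIsetP => l l' /tiling_ofP[c [d [cR n ->]]] /tiling_ofP[c' [d' [c'R n' ->]]] ne.
  apply/pred0P => x /=; apply/negP => /andP[]; rewrite !in_set2.
  have cc : c <> c' by move=> ec; case/eqP: ne; subst c'; rewrite (nbr_funl n n').
  have dd : d <> d'.
    move=> ed; subst d'; have /eqP/cards1P[c0 ec] := pd _ (dL _ _ cR n); apply: cc.
    have : c \in [set c in rcells | nbr (mu c) c d] by rewrite in_set cR.
    have : c' \in [set c in rcells | nbr (mu c) c d] by rewrite in_set c'R.
    by rewrite ec !inE => /eqP -> /eqP ->.
  case/orP=> /eqP -> /orP[] /eqP e //.
    by apply: (@rl_disj c) => //; rewrite e; apply: dL n'.
  by apply: (@rl_disj c') => //; rewrite -e; apply: dL n.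
apply/negP => /tiling_ofP[c [d [_ _ /setP/(_ c)]]]; by rewrite !inE eqxx.
Qed.

Lemma dir_of_tiling mu c : perfect mu -> c \in rcells -> dir_of (tiling_of mu) c = mu c.
Proof.
move=> pm cR; have [d dL n] := pm.1 _ cR.
apply: (dir_of_eq (perfect_tiling pm) cR n).
by apply/tiling_ofP; exists c, d.
Qed.

Definition equivariant mu := forall c, c \in rcells -> mu (rot c) = mu c + 1.

Lemma dir_of_equivariant T : is_tiling T -> cyclically_symmetric T -> equivariant (dir_of T).
Proof.
move=> tT /eqP sT c cR; have [d [dL n lT]] := dir_ofP tT cR.
apply: (@dir_of_eq T tT _ (rot d)); rewrite ?rcells_rot ?nbr_rot //.
rewrite -sT; apply/imsetP; exists [set c; d] => //.
by rewrite imsetU !imset_set1.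
Qed.

Lemma equivariant_tiling mu : equivariant mu -> cyclically_symmetric (tiling_of mu).
Proof.
move=> em.
have sub l : l \in tiling_of mu -> (@rot a m) @: l \in tiling_of mu.
  case/tiling_ofP=> c [d [cR n ->]]; apply/tiling_ofP; exists (rot c), (rot d).
  by rewrite rcells_rot em // nbr_rot imsetU !imset_set1.
rewrite /cyclically_symmetric eqEcard (card_imset (tiling_of mu) (imset_inj rot_inj)) leqnn andbT.
by apply/subsetP => _ /imsetP[l lT ->]; apply: sub.
Qed.

Lemma card_incoming_rot mu d : equivariant mu ->
  #|[set c in rcells | nbr (mu c) c (rot d)]| = #|[set c in rcells | nbr (mu c) c d]|.
Proof.
move=> em; rewrite -[RHS](card_imset _ rot_inj); apply: eq_card => c.
apply/setIdP/imsetP => [[cR n]|[c' /setIdP[cR n] ->]]; last first.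
  by rewrite rcells_rot em // nbr_rot.
exists (rot (rot c)); last by rewrite rot3.
have ccR : rot (rot c) \in rcells by rewrite !rcells_rot.
by apply/setIdP; rewrite -nbr_rot -em // rot3 //.
Qed.

End Matching.

(** * The fundamental domain *)

Section Domain.
Variables a m : nat.
Implicit Types (c d : cell a m) (e : 'I_3) (p : 'I_(a + m)) (q : 'I_a).
Implicit Types (rows : {ffun 'I_(a + m) -> row_choice a}) (mu : cell a m -> 'I_3).

(** Outside the core, the truth values of a <= x, a <= y, a <= z are not all equal, so
    exactly one rotation makes the second one true and the third one false. *)
Definition in_domain c : bool := (a <= cy c)%N && (cz c < a)%N.

Lemma cx_rot c : cx (rot c) = cz c. Proof. by []. Qed.

Lemma cy_rot c : cy (rot c) = cx c. Proof. by []. Qed.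

Lemma cz_rot c : cz (rot c) = cy c. Proof. by []. Qed.

(** The sum of the coordinates excludes that all three are less than a. *)
Lemma domain_rot c : (c \in rcells a m) || (c \in lcells a m) ->
  [|| [&& in_domain c, ~~ in_domain (rot c) & ~~ in_domain (rot (rot c))],
      [&& ~~ in_domain c, in_domain (rot c) & ~~ in_domain (rot (rot c))] |
      [&& ~~ in_domain c, ~~ in_domain (rot c) & in_domain (rot (rot c))]].
Proof.
rewrite !inE /right_pointing /left_pointing /in_core /in_domain !(cx_rot, cy_rot, cz_rot).
move: (cx c) (cy c) (cz c) => x y z; clear; lia.
Qed.

Fact rcx_lt p q : (2 * a + m - 1 - p - q < 2 * a + m)%N.
Proof. have := ltn_ord p; have := ltn_ord q; clear; lia. Qed.
Fact lcx_lt p q : (2 * a + m - 2 - p - q < 2 * a + m)%N.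
Proof. have := ltn_ord p; have := ltn_ord q; clear; lia. Qed.
Fact dcy_lt p : (a + p < 2 * a + m)%N.
Proof. have := ltn_ord p; clear; lia. Qed.
Fact dcz_lt q : (q < 2 * a + m)%N.
Proof. have := ltn_ord q; clear; lia. Qed.

(** The triangles of the domain with coordinates y = a + p and z = q. *)
Definition rcell p q : cell a m :=
  (Ordinal (rcx_lt p q), Ordinal (dcy_lt p), Ordinal (dcz_lt q)).
Definition lcell p q : cell a m :=
  (Ordinal (lcx_lt p q), Ordinal (dcy_lt p), Ordinal (dcz_lt q)).

Lemma rcell_in p q : rcell p q \in rcells a m.
Proof.
rewrite !inE /right_pointing /in_core /cx /cy /cz /=.
by have := ltn_ord p; have := ltn_ord q; clear; lia.
Qed.

Lemma lcell_in p q : lcell p q \in lcells a m.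
Proof.
rewrite !inE /left_pointing /in_core /cx /cy /cz /=.
by have := ltn_ord p; have := ltn_ord q; clear; lia.
Qed.

Lemma rcell_domain p q : in_domain (rcell p q).
Proof. by rewrite /in_domain /cy /cz /= leq_addr ltn_ord. Qed.

Lemma domain_coord c : in_domain c -> exists p q, cy c = (a + p)%N /\ cz c = q.
Proof.
case/andP=> yc zc; have py : (cy c - a < a + m)%N.
  by have := ltn_ord c.1.2; rewrite -/(cy c); move: yc zc; clear; lia.
by exists (Ordinal py), (Ordinal zc); rewrite /= subnKC.
Qed.

Lemma domain_right c : c \in rcells a m -> in_domain c -> exists p q, c = rcell p q.
Proof.
rewrite in_set => /andP[/eqP s _] /domain_coord[p [q [yc zc]]]; exists p, q.
apply: cell_eq => //; rewrite {2}/cx /=; move: s; rewrite yc zc; clear; lia.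
Qed.

Lemma domain_left c : c \in lcells a m -> in_domain c -> exists p q, c = lcell p q.
Proof.
rewrite in_set => /andP[/eqP s _] /domain_coord[p [q [yc zc]]]; exists p, q.
apply: cell_eq => //; rewrite {2}/cx /=; move: s; rewrite yc zc; clear; lia.
Qed.

Definition rdir rows c : 'I_3 :=
  if insub (cy c - a)%N is Some p then
    if insub (cz c) is Some q then rows p q else 0
  else 0.

Lemma rdir_rcell rows p q : rdir rows (rcell p q) = rows p q.
Proof.
by rewrite /rdir {1}/cy /= addKn valK /cz /= valK.
Qed.

(** Extends the choices on the domain by equivariance. *)
Definition mu_of rows c : 'I_3 :=
  if in_domain c then rdir rows c else
  if in_domain (rot c) then rdir rows (rot c) - 1 else rdir rows (rot (rot c)) + 1.

Lemma mu_rcell rows p q : mu_of rows (rcell p q) = rows p q.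
Proof. by rewrite /mu_of rcell_domain rdir_rcell. Qed.

Lemma three_I3 (x : 'I_3) : x + 1 + 1 = x - 1.
Proof. by apply/val_inj; case: x => [[|[|[|]]]]. Qed.

Lemma mu_equivariant rows : equivariant (mu_of rows).
Proof.
move=> c cR; have := @domain_rot c; rewrite cR => /(_ isT).
rewrite /mu_of rot3; case: (in_domain c); case: (in_domain (rot c));
  case: (in_domain (rot (rot c))) => //= _;
  by rewrite ?subrK ?three_I3.
Qed.

Definition rows_of mu : {ffun 'I_(a + m) -> row_choice a} :=
  [ffun p => [ffun q => mu (rcell p q)]].

Lemma mu_of_rows mu c : equivariant mu -> c \in rcells a m -> mu_of (rows_of mu) c = mu c.
Proof.
move=> em cR.
have H c' : c' \in rcells a m -> in_domain c' -> rdir (rows_of mu) c' = mu c'.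
  by move=> c'R /(domain_right c'R)[p [q ->]]; rewrite rdir_rcell !ffunE.
have := @domain_rot c; rewrite cR => /(_ isT) dc; rewrite /mu_of.
case: ifP => [d0|d0]; first exact: H.
case: ifP => [d1|d1]; first by rewrite H ?rcells_rot // em // addrK.
have d2 : in_domain (rot (rot c)) by move: dc; rewrite d0 d1.
by rewrite H ?rcells_rot // !em ?rcells_rot // three_I3 addrK.
Qed.

Lemma perfect_domain mu : equivariant mu ->
  (forall p q, exists2 d, d \in lcells a m & nbr (mu (rcell p q)) (rcell p q) d) ->
  (forall p q, #|[set c in rcells a m | nbr (mu c) c (lcell p q)]| = 1%N) -> perfect mu.
Proof.
move=> em hR hL; split=> [c cR|d dL].
  have H c' : c' \in rcells a m -> in_domain c' -> exists2 d, d \in lcells a m & nbr (mu c') c' d.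
    by move=> c'R /(domain_right c'R)[p [q ->]].
  have back c' : c' \in rcells a m -> (exists2 d, d \in lcells a m & nbr (mu (rot c')) (rot c') d) ->
      exists2 d, d \in lcells a m & nbr (mu c') c' d.
    move=> c'R [d dL n]; exists (rot (rot d)); first by rewrite !lcells_rot.
    by rewrite -nbr_rot rot3 -em.
  have := @domain_rot c; rewrite cR => /(_ isT) /or3P[] /and3P[d0 d1 d2].
  - exact: H.
  - by apply: back => //; apply: H; rewrite ?rcells_rot.
  - by apply: (back); last apply: (back); rewrite ?rcells_rot //; apply: (H); rewrite ?rcells_rot.
have H d' : d' \in lcells a m -> in_domain d' -> #|[set c in rcells a m | nbr (mu c) c d']| = 1%N.
  by move=> d'L /(domain_left d'L)[p [q ->]].
have := @domain_rot d; rewrite dL orbT => /(_ isT) /or3P[] /and3P[d0 d1 d2].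
- exact: H.
- by rewrite -card_incoming_rot // H ?lcells_rot.
- by rewrite -2?card_incoming_rot // H ?lcells_rot.
Qed.

Lemma legal_nbr rows p q :
  (exists2 d, d \in lcells a m & nbr (mu_of rows (rcell p q)) (rcell p q) d) <->
  (val (rows p q) = 2%N -> (0 < q)%N).
Proof.
have qa := ltn_ord q; have pN := ltn_ord p; rewrite mu_rcell.
set e := rows p q; split=> [[d _ /nbr_coord[_ _]]|h].
  rewrite {1}/cz /= => eq e2; rewrite e2 in eq; move: eq; clear; lia.
have xl : (cx (rcell p q) - (val e == 0%N) < 2 * a + m)%N.
  by rewrite {1}/cx /=; move: qa; clear; lia.
have yl : (cy (rcell p q) - (val e == 1%N) < 2 * a + m)%N.
  by rewrite {1}/cy /=; move: qa pN; clear; lia.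
have zl : (cz (rcell p q) - (val e == 2%N) < 2 * a + m)%N.
  by rewrite {1}/cz /=; move: qa pN; clear; lia.
pose d : cell a m := (Ordinal xl, Ordinal yl, Ordinal zl).
have n : nbr e (rcell p q) d.
  apply: coord_nbr; rewrite /cx /cy /cz /= /cx /cy /cz /=.
  - by case: (_ == 0)%N; move: qa pN; clear; lia.
  - by case: (_ == 1)%N; move: qa pN; clear; lia.
  - by case: eqP => [/h|_]; [clear; lia|rewrite subn0 addn0].
exists d => //; rewrite inE -(nbr_pointing n).
have := rcell_in p q; rewrite inE => /andP[-> _] /=.
rewrite /in_core negb_and; apply/orP; right; rewrite negb_and; apply/orP; right.
by rewrite /cz /= /cz /= -ltnNge; move: qa; clear; lia.
Qed.

Lemma card_incoming mu d : #|[set c in rcells a m | nbr (mu c) c d]| =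
  (\sum_(e < 3) #|[set c in rcells a m | nbr e c d && (mu c == e)]|)%N.
Proof.
rewrite -sum1_card (partition_big mu xpredT) //=; apply: eq_bigr => e _.
rewrite -sum1_card; apply: eq_bigl => c; rewrite !in_set.
by rewrite -andbA; congr (_ && _); case: eqP => [->|]; rewrite ?andbF.
Qed.

Lemma card_in1 mu e c d : nbr e c d ->
  #|[set c in rcells a m | nbr e c d && (mu c == e)]| = (c \in rcells a m) && (mu c == e) :> nat.
Proof.
move=> n; set A := [set _ in _ | _].
have cA c' : c' \in A -> c' = c.
  by rewrite in_set => /and3P[_ n' _]; apply: nbr_funr n.
case: (boolP ((c \in rcells a m) && (mu c == e))) => h.
  rewrite (_ : A = [set c]) ?cards1 //; apply/setP => c'; rewrite in_set1.
  apply/idP/eqP => [/cA //|->]; rewrite in_set n /=; by case/andP: h => -> ->.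
rewrite (_ : A = set0) ?cards0 //; apply/setP => c'; rewrite in_set0.
apply/negP => c'A; case/negP: h; rewrite -(cA _ c'A); move: c'A.
by rewrite in_set => /and3P[-> _ ->].
Qed.

Lemma card_in0 mu e d : (forall c, ~~ nbr e c d) ->
  #|[set c in rcells a m | nbr e c d && (mu c == e)]| = 0%N.
Proof.
move=> h; apply/eqP; rewrite cards_eq0; apply/eqP/setP => c.
by rewrite in_set in_set0 (negbTE (h c)) andbF.
Qed.

(** The left and top choices come from row p, the bottom choice from row p + 1.  In the
    last place q = a - 1 the top side borders on a triangle outside the domain; its
    second rotation is the triangle N - 1 - p of row 0 (N = a + m), and the top choice
    there corresponds to the bottom choice. *)
Lemma incoming_load rows p q :
  #|[set c in rcells a m | nbr (mu_of rows c) c (lcell p q)]| =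
  (load (rows p) (wraps (not_bottom_in rows 0) (a + m - p.+1)) q + (q \notin not_bottom_in rows p.+1))%N.
Proof.
have qa := ltn_ord q; have pN := ltn_ord p.
rewrite card_incoming !big_ord_recl big_ord0 addn0 addnA addnAC /load -[(_ + _ + (_ && _))%N]addnA; congr (_ + _ + _)%N.
- have n : nbr ord0 (rcell p q) (lcell p q).
    by apply: coord_nbr; rewrite /cx /cy /cz /= ?addn0 //; move: qa pN; clear; lia.
  by rewrite (card_in1 _ n) rcell_in mu_rcell.
- set e := lift _ _; have e2 : val e = 2%N by [].
  have [q1|q1] := ltnP q.+1 a.
    pose q' := Ordinal q1.
    have n : nbr e (rcell p q') (lcell p q).
      by apply: coord_nbr; rewrite e2 /cx /cy /cz /= ?addn0 ?addn1 //; move: qa pN; clear; lia.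
    rewrite (card_in1 _ n) rcell_in mu_rcell -val_eqE e2 (ltn_eqF q1) andbF addn0 andTb.
    congr nat_of_bool; apply/idP/existsP => [h|[q2 /andP[/eqP e3 h]]].
      by exists q'; rewrite eqxx.
    by rewrite (_ : q' = q2) //; apply: val_inj.
  have qE : q.+1 = a by apply/eqP; rewrite eqn_leq qa q1.
  have -> : [exists q' : 'I_a, (q' == q.+1 :> nat) && (val (rows p q') == 2%N)] = false.
    by apply/existsP => -[q' /andP[/eqP h _]]; move: (ltn_ord q'); rewrite h qE ltnn.
  rewrite qE eqxx andbT add0n.
  have xl : (a + m - p.+1 < 2 * a + m)%N by move: qa; clear; lia.
  have zl : (a < 2 * a + m)%N by move: qa; clear; lia.
  pose c : cell a m := (Ordinal xl, Ordinal (dcy_lt p), Ordinal zl).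
  have n : nbr e c (lcell p q).
    by apply: coord_nbr; rewrite e2 /cx /cy /cz /= ?addn0 ?addn1 //; move: qE pN; clear; lia.
  rewrite (card_in1 _ n).
  have [xa|xa] := ltnP (a + m - p.+1) a; last first.
    rewrite [c \in _](_ : _ = false) /=; last first.
      by rewrite !inE /in_core /cx /cy /cz /= xa leq_addr leqnn andbF.
    have -> : wraps (not_bottom_in rows 0) (a + m - p.+1) = false.
      by apply/existsP => -[q' /andP[/eqP h _]]; move: (ltn_ord q'); rewrite h ltnNge xa.
    by [].
  have cR : c \in rcells a m.
    by rewrite !inE /right_pointing /in_core /cx /cy /cz /=; move: xa pN qE; clear; lia.
  have N0 : (0 < a + m)%N by move: pN; clear; lia.
  have cE : rot (rot c) = rcell (Ordinal N0) (Ordinal xa).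
    by apply: cell_eq; rewrite /cx /cy /cz /= ?addn0 //; move: xa pN; clear; lia.
  rewrite cR /mu_of cE rdir_rcell.
  have -> : in_domain c = false by rewrite /in_domain /cy /cz /= ltnn andbF.
  have -> : in_domain (rot c) = false by rewrite /in_domain /cy /cz /= leqNgt xa.
  have -> : wraps (not_bottom_in rows 0) (a + m - p.+1) = (val (rows (Ordinal N0) (Ordinal xa)) == 1%N).
    have nb0 : not_bottom_in rows 0 = not_bottom (rows (Ordinal N0)).
      rewrite /not_bottom_in; case: insubP => [u _ u0|]; last by rewrite N0.
      by congr (not_bottom (rows _)); apply: val_inj.
    apply/existsP/idP => [[q' /andP[/eqP h]]|h].
      rewrite nb0 inE negbK (_ : q' = Ordinal xa) //; exact: val_inj.
    by exists (Ordinal xa); rewrite nb0 inE negbK eqxx.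
  by case: (rows _ _) => [[|[|[|//]]] ?].
- set e := lift _ _; have e1 : val e = 1%N by [].
  rewrite /not_bottom_in; case: insubP => [p' p1 pE|p1].
    have {}pE : nat_of_ord p' = p.+1 := pE.
    have n : nbr e (rcell p' q) (lcell p q).
      by apply: coord_nbr; rewrite e1 /cx /cy /cz /= ?pE ?addn0 ?addn1 ?addnS //; move: qa pN; clear; lia.
    by rewrite (card_in1 _ n) rcell_in mu_rcell inE negbK -val_eqE e1.
  rewrite card_in0 ?inE // => c; apply/negP => /nbr_coord[_ + _].
  rewrite e1 [cy (lcell _ _)]/cy /=; have := ltn_ord c.1.2; rewrite -/(cy c).
  by move: pN p1; clear; lia.
Qed.

(** By equivariance it is enough to look at the triangles of the domain. *)
Lemma admissible_perfect rows : admissible (not_bottom_in rows 0) rows <-> perfect (mu_of rows).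
Proof.
split=> [/andP[/forallP lg /forallP ld]|[hR hL]].
  apply: perfect_domain => [|p q|p q]; first exact: mu_equivariant.
    by apply/legal_nbr => h; move/forallP/(_ q): (lg p); rewrite h.
  rewrite incoming_load; move/forallP/(_ q)/eqP: (ld p) => ->.
  by case: (_ \in _).
apply/andP; split; apply/forallP => p; apply/forallP => q.
  apply/implyP => /eqP; apply/legal_nbr; exact/hR/rcell_in.
have := hL _ (lcell_in p q); rewrite incoming_load; case: (_ \in _) => /= h.
  by apply/eqP; rewrite addn0 in h.
by move: h; rewrite addn1 => -[->].
Qed.

(** The extension of the core consists of the bottom sides of row 0. *)
Lemma nstat_rows rows : perfect (mu_of rows) -> nstat (tiling_of (mu_of rows)) = #|not_bottom_in rows 0|.
Proof.
move=> pm; rewrite /nstat; have tT := perfect_tiling pm.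
have bot c : c \in rcells a m ->
   [exists d, bottom_nbr c d && ([set c; d] \in tiling_of (mu_of rows))] = (val (mu_of rows c) == 1%N).
  move=> cR; have i1 : val (inord 1 : 'I_3) = 1%N by rewrite /= inordK.
  apply/existsP/eqP => [[d /andP[b dT]]|e1].
    rewrite -(dir_of_tiling pm cR) (@dir_of_eq _ _ _ tT c d (inord 1)) //.
    by rewrite /nbr i1.
  have [d [_ n dT]] := dir_ofP tT cR; exists d; rewrite dT andbT.
  by move: n; rewrite (dir_of_tiling pm cR) /nbr e1.
have aboveP c : above_extension c -> exists p q, c = rcell p q /\ val p = 0%N.
  case/and3P=> rc /eqP yc zc.
  have cR : c \in rcells a m by rewrite inE rc /in_core yc leqnn [(a <= cz c)%N]leqNgt zc andbF.
  have cD : in_domain c by rewrite /in_domain yc leqnn zc.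
  have [p [q cE]] := domain_right cR cD; exists p, q; split=> //.
  by move: yc; rewrite cE /cy /=; clear; lia.
rewrite /not_bottom_in; case: insubP => [p _ p0|N0]; last first.
  rewrite (_ : [set _ | _] = set0) ?cards0; last first.
    apply/setP => c; rewrite in_set in_set0; apply/negP => /andP[/aboveP[p _] _].
    by move: (ltn_ord p) N0; clear; lia.
  by rewrite cardsT card_ord; move: N0; clear; lia.
rewrite -(card_imset (not_bottom (rows p)) (f := rcell p)); last first.
  by move=> q q' [/= _ e]; apply: val_inj.
apply: eq_card => c; rewrite inE; apply/andP/imsetP => [[ca]|[q qn ->]].
  have [p' [q [cE p'0]]] := aboveP c ca.
  have pp : p' = p by apply: val_inj; rewrite p'0 p0.
  subst p'; rewrite cE bot ?rcell_in // mu_rcell => h; exists q => //.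
  by rewrite inE.
split; last by rewrite bot ?rcell_in // mu_rcell; move: qn; rewrite inE.
have := rcell_in p q; rewrite inE => /andP[h _]; apply/and3P; split=> //; last exact: (ltn_ord q).
by rewrite /cy /= (p0 : nat_of_ord p = 0%N) addn0.
Qed.

Lemma Lc_rows (C : nzRingType) (w : C) :
  Lc w a m = \sum_(rows : {ffun 'I_(a + m) -> row_choice a} | admissible (not_bottom_in rows 0) rows) w ^+ #|not_bottom_in rows 0|.
Proof.
rewrite /Lc (reindex_onto (fun rows => tiling_of (mu_of rows)) (fun T => rows_of (dir_of T))) /=.
  apply: eq_big => [rows|rows /andP[/andP[tT sT] /eqP e]]; last first.
    rewrite nstat_rows //.
    have := perfect_dir tT; set mu := dir_of _ => -[h1 h2].
    have H c : c \in rcells a m -> mu_of rows c = mu c.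
      move=> cR; rewrite -e mu_of_rows //; exact: dir_of_equivariant.
    split=> [c cR|d dL]; first by rewrite H //; exact: h1.
    rewrite -[RHS](h2 d dL); apply: eq_card => c; rewrite !in_set.
    by apply: andb_id2l => cR; rewrite H // inE.
  apply/idP/idP => [/andP[/andP[tT sT] /eqP e]|/admissible_perfect pm].
    apply/admissible_perfect.
    have := perfect_dir tT; set mu := dir_of _ => -[h1 h2].
    have H c : c \in rcells a m -> mu_of rows c = mu c.
      move=> cR; rewrite -e mu_of_rows //; exact: dir_of_equivariant.
    split=> [c cR|d dL]; first by rewrite H //; exact: h1.
    rewrite -[RHS](h2 d dL); apply: eq_card => c; rewrite !in_set.
    by apply: andb_id2l => cR; rewrite H // inE.
  rewrite perfect_tiling // equivariant_tiling ?andTb; last exact: mu_equivariant.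
  apply/eqP/ffunP => p; rewrite ffunE; apply/ffunP => q; rewrite ffunE.
  by rewrite dir_of_tiling ?rcell_in // mu_rcell.
move=> T /andP[tT sT]; rewrite -[RHS](tiling_of_dir tT).
have H c : c \in rcells a m -> mu_of (rows_of (dir_of T)) c = dir_of T c.
  by move=> cR; rewrite mu_of_rows //; exact: dir_of_equivariant.
apply/setP => l; apply/tiling_ofP/tiling_ofP => -[c [d [cR n ->]]];
  by exists c, d; split=> //; move: n; rewrite H.
Qed.

End Domain.

(** * Roots of unity and the three evaluations *)

Local Open Scope complex_scope.

Lemma Lc_gdet (F : numFieldType) (w : F) a m : Lc w a m = gdet w a m%:R.
Proof. by rewrite Lc_rows sum_rows_det det_kmat. Qed.

Lemma cube_root_eq (F : fieldType) (w : F) : 3.-primitive_root w -> w ^+ 2 + w + 1 = 0.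
Proof.
move=> w3; have e := prim_expr_order w3.
have w1 : w - 1 != 0.
  rewrite subr_eq0; apply/eqP => w1; have := prim_order_dvd w3 1.
  by rewrite expr1 w1 eqxx.
apply: (mulfI w1); transitivity (w ^+ 3 - 1); first by ring.
by rewrite e subrr mulr0.
Qed.

Lemma sixth_root_eq (F : fieldType) (w : F) : 6.-primitive_root w -> w ^+ 2 - w + 1 = 0.
Proof.
move=> w6; have e := prim_expr_order w6.
have w3 : w ^+ 3 - 1 != 0 by rewrite subr_eq0 -(prim_order_dvd w6).
have e3 : w ^+ 3 + 1 = 0.
  apply: (mulfI w3); transitivity (w ^+ 6 - 1); first by ring.
  by rewrite e subrr mulr0.
have w1 : w + 1 != 0.
  apply/eqP => w1; have : w ^+ 2 == 1.
    have -> : w ^+ 2 = 1 + (w + 1) * (w - 1) by ring.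
    by rewrite w1 mul0r addr0.
  by rewrite -(prim_order_dvd w6).
by apply: (mulfI w1); rewrite mulr0 -e3; ring.
Qed.

(** The primitive sixth root of unity (1 + sqrt(-3)) / 2. *)
Lemma sixth_root_exists (F : numClosedFieldType) : exists z : F, z ^+ 2 = z - 1.
Proof.
exists ((1 + sqrtC (- 3)) / 2); have := sqrtCK (- 3 : F); set s := sqrtC _ => e.
have -> : ((1 + s) / 2) ^+ 2 = (1 + 2 * s + s ^+ 2) / 4 by field.
by rewrite e; field.
Qed.

Lemma third_shprod (F : numFieldType) (x : F) a : 
  \prod_(i < a) (poch (x + (3 * i + 1)%:R) (a - 4 * i)./2
          * poch (x + (3 * i + 3)%:R) (a - (4 * i + 3))./2
          * poch (x + a%:R - i%:R + 1 / 2) (a - (4 * i + 1))./2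
          * poch (x + a%:R - i%:R - 1 / 2) (a - (4 * i + 2))./2) = shprod (@third_factor F) x a.
Proof.
apply: eq_bigr => i _; rewrite /third_factor !(subnDA (4 * i)%N).
case: (leqP (4 * i) a) => ia; last first.
  by rewrite (eqP (ltnW ia : (a - 4 * i == 0)%N)) !sub0n /= !poch0.
have -> : a%:R = (a - 4 * i)%:R + 4 * i%:R :> F by rewrite -natrM -natrD subnK.
by congr (poch _ _ * poch _ _ * poch _ _ * poch _ _); rewrite ?natrD ?natrM; ring.
Qed.

Lemma sixth_shprod (F : numFieldType) (x : F) a : 
  \prod_(i < a) (poch (x + (3 * i)%:R + 3 / 2) (a - (4 * i + 1))./2
          * poch (x + (3 * i)%:R + 5 / 2) (a - (4 * i + 2))./2
          * poch (x + a%:R - i%:R) (a - 4 * i)./2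
          * poch (x + a%:R - i%:R) (a - (4 * i + 3))./2) = shprod (@sixth_factor F) x a.
Proof.
apply: eq_bigr => i _; rewrite /sixth_factor !(subnDA (4 * i)%N).
case: (leqP (4 * i) a) => ia; last first.
  by rewrite (eqP (ltnW ia : (a - 4 * i == 0)%N)) !sub0n /= !poch0.
have -> : a%:R = (a - 4 * i)%:R + 4 * i%:R :> F by rewrite -natrM -natrD subnK.
by congr (poch _ _ * poch _ _ * poch _ _ * poch _ _); rewrite ?natrD ?natrM; ring.
Qed.

Lemma fact_poch (F : numFieldType) m k : (m + k)`!%:R = m`!%:R * poch (m%:R + 1) k :> F.
Proof.
elim: k => [|k IH]; first by rewrite addn0 poch0 mulr1.
by rewrite addnS factS natrM IH pochS -addn1 !natrD; ring.
Qed.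

Lemma rmorph_poch (F G : nzRingType) (f : {rmorphism F -> G}) x k :
  f (poch x k) = poch (f x) k.
Proof. by rewrite rmorph_prod; apply: eq_bigr => i _; rewrite rmorphD rmorph_nat. Qed.

(** The evaluation needs a sixth root of unity in the field, but the factors are real. *)
Lemma rmorph_neg_term (F G : numFieldType) (f : {rmorphism F -> G}) m k :
  f ((neg_num m%:R k / neg_den m%:R k) ^+ 2 / neg_den_fact m%:R k) =
  (neg_num m%:R k / neg_den m%:R k) ^+ 2 / neg_den_fact m%:R k.
Proof.
rewrite /neg_num /neg_den /neg_den_fact !(fmorph_div, rmorphXn, rmorphM, rmorph_poch, rmorphD, rmorph_nat, rmorph1).
by [].
Qed.

(** Every quotient of two factorials of half-integers is a Pochhammer symbol. *)
Lemma rfact_neg_term (R : realType) m k :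
  (k`!)%:R ^+ 2 * rfact (m%:R / 2 + k%:R) ^+ 2
            * rfact (m%:R / 2 + (3 * k + 1)%:R) ^+ 2
            * ((m + 3 * k + 1)`!)%:R ^+ 2
            / (((2 * k)`!)%:R * ((2 * k + 1)`!)%:R
               * rfact (m%:R / 2 + (2 * k)%:R) ^+ 2
               * rfact (m%:R / 2 + (2 * k + 1)%:R) ^+ 2
               * ((m + 2 * k)`!)%:R * ((m + 2 * k + 1)`!)%:R) =
  (neg_num m%:R k / neg_den m%:R k) ^+ 2 / neg_den_fact m%:R k :> R.
Proof.
have x0 (n : nat) : 0 <= m%:R / 2 + n%:R :> R by rewrite addr_ge0 ?divr_ge0.
have -> : m%:R / 2 + (3 * k + 1)%:R = m%:R / 2 + (2 * k + 1)%:R + k%:R :> R.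
  by rewrite -addrA -natrD; congr (_ + _%:R); lia.
have -> : m%:R / 2 + (2 * k)%:R = m%:R / 2 + k%:R + k%:R :> R.
  by rewrite -addrA -natrD; congr (_ + _%:R); lia.
rewrite (EulerGamma.rfactD k (x0 (2 * k + 1)%N)) (EulerGamma.rfactD k (x0 k)) -!(addnA m) !addn1 !(fact_poch _ m) /neg_num /neg_den /neg_den_fact.
have -> : m%:R / 2 + (2 * k).+1%:R + 1 = m%:R / 2 + 2 + (2 * k)%:R :> R.
  by rewrite -[(2 * k).+1%:R]natr1; ring.
have -> : m%:R / 2 + k%:R + 1 = m%:R / 2 + 1 + k%:R :> R by ring.
have p0 (y : R) n : 0 < y -> poch y n != 0.
  by move=> y0; apply: poch_neq0 => i _; rewrite gt_eqF // ltr_wpDr.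
have h1 : poch (m%:R / 2 + 1 + k%:R) k != 0 :> R by rewrite p0 // addrAC ltr_wpDl.
have h2 n : poch (m%:R + 1) n != 0 :> R by rewrite p0 // ltr_wpDl.
have h3 n : n`!%:R != 0 :> R by rewrite pnatr_eq0 -lt0n fact_gt0.
have h4 n : rfact (m%:R / 2 + n%:R) != 0 :> R by rewrite gt_eqF // EulerGamma.rfact_gt0.
move: (poch (m%:R + 1) (3 * k).+1) (poch (m%:R + 1) (2 * k)) (h2 (2 * k)%N) (poch (m%:R + 1) (2 * k).+1) (h2 (2 * k).+1)
  (rfact (m%:R / 2 + k%:R)) (h4 k) (rfact (m%:R / 2 + (2 * k).+1%:R)) (h4 (2 * k).+1)
  (poch (m%:R / 2 + 1 + k%:R) k) h1 (poch (m%:R / 2 + 2 + (2 * k)%:R) k) (k`!%:R) ((2 * k)`!%:R) (h3 (2 * k)%N)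
  ((2 * k).+1`!%:R) (h3 (2 * k).+1) (m`!%:R) (h3 m).
clear=> A B B0 C C0 r r0 s s0 p pn0 q f g g0 h hn0 u u0.
by field; rewrite B0 C0 r0 s0 pn0 g0 hn0 u0.
Qed.

Theorem theorem7 (R : realType) (a m : nat) (w : R[i]) :
  (w = -1 ->
     (odd a -> Lc w a m = 0) /\
     (~~ odd a ->
        Lc w a m =
        ((-1) ^+ a./2 *
         \prod_(i < a./2)
           ((i`!)%:R ^+ 2 * rfact (m%:R / 2 + i%:R) ^+ 2
            * rfact (m%:R / 2 + (3 * i + 1)%:R) ^+ 2
            * ((m + 3 * i + 1)`!)%:R ^+ 2
            / (((2 * i)`!)%:R * ((2 * i + 1)`!)%:R
               * rfact (m%:R / 2 + (2 * i)%:R) ^+ 2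
               * rfact (m%:R / 2 + (2 * i + 1)%:R) ^+ 2
               * ((m + 2 * i)`!)%:R * ((m + 2 * i + 1)`!)%:R)) : R)%:C)) /\
  (3.-primitive_root w ->
     Lc w a m =
     (1 + w) ^+ a * 2 ^+ a./2
     / ((\prod_(1 <= i < (a./2).+1) (odd_dfact i)%:R)
        * (\prod_(1 <= i < ((a - 1)./2).+1) (odd_dfact i)%:R))
     * \prod_(i < a)
         (poch (m%:R / 2 + (3 * i + 1)%:R) (a - 4 * i)./2
          * poch (m%:R / 2 + (3 * i + 3)%:R) (a - (4 * i + 3))./2
          * poch (m%:R / 2 + a%:R - i%:R + 1 / 2) (a - (4 * i + 1))./2
          * poch (m%:R / 2 + a%:R - i%:R - 1 / 2) (a - (4 * i + 2))./2)) /\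
  (6.-primitive_root w ->
     Lc w a m =
     (1 + w) ^+ a * (2 / 3) ^+ a./2
     / ((\prod_(1 <= i < (a./2).+1) (odd_dfact i)%:R)
        * (\prod_(1 <= i < ((a - 1)./2).+1) (odd_dfact i)%:R))
     * \prod_(i < a)
         (poch (m%:R / 2 + (3 * i)%:R + 3 / 2) (a - (4 * i + 1))./2
          * poch (m%:R / 2 + (3 * i)%:R + 5 / 2) (a - (4 * i + 2))./2
          * poch (m%:R / 2 + a%:R - i%:R) (a - 4 * i)./2
          * poch (m%:R / 2 + a%:R - i%:R) (a - (4 * i + 3))./2)).
Proof.
have x0 : 0 <= m%:R / 2 :> R[i] by rewrite divr_ge0 ?ler0n.
have x2 : 2 * (m%:R / 2) = m%:R :> R[i] by rewrite mulrCA mulfV ?mulr1 // pnatr_eq0.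
split; last split.
- move=> ->; rewrite Lc_gdet; split=> [oa|ea].
    by apply: closed_minus1_odd => //; exact: sixth_root_exists.
  have aE : a = (a./2 + a./2)%N by rewrite addnn -[LHS]odd_double_half (negbTE ea).
  rewrite {1}aE closed_minus1; last exact: sixth_root_exists.
  rewrite rmorphM rmorphXn rmorphN1 rmorph_prod.
  have -> : (-1) ^+ a./2 = \prod_(i < a./2) -1 :> R[i] by rewrite prodr_const card_ord.
  rewrite -big_split /=.
  by apply: eq_bigr => i _; rewrite rfact_neg_term rmorph_neg_term mulNr mulN1r.
- move=> w3; have e := cube_root_eq w3; have ew := prim_expr_order w3.
  rewrite Lc_gdet (@closed_third _ w (- w ^+ 2)); last 2 first.
  + have -> : (- w ^+ 2) ^+ 2 = w ^+ 3 * w by ring.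
    by rewrite ew -[RHS]addr0 -e; ring.
  + by rewrite mulrN -exprS ew.
  by rewrite third_shprod -!mulrA (mulrA (2 ^+ _)) third_product // x2.
move=> w6; have e := sixth_root_eq w6.
have ew : w ^+ 3 = -1.
  have -> : w ^+ 3 = (w + 1) * (w ^+ 2 - w + 1) - 1 by ring.
  by rewrite e mulr0 sub0r.
rewrite Lc_gdet (@closed_sixth _ w (- w ^+ 2)); last 2 first.
- have -> : (- w ^+ 2) ^+ 2 = w ^+ 3 * w by ring.
  by rewrite ew -[RHS]addr0 -e; ring.
- by rewrite mulrN -exprS ew opprK.
by rewrite sixth_shprod -!mulrA (mulrA ((2 / 3) ^+ _)) sixth_product // x2.
Qed.
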